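(* Let $0<\beta<\alpha<\mu\le1$ and let $k$ satisfy the kernel regularity assumption with exponent $\mu$ given in the context. Let $c\in X_\alpha$ satisfy $\inf_{t\in\Gamma\setminus\mathcal D}|c(t)|\ge c_0>0$ with all lateral values of $c$ at the points of $\mathcal D$ nonzero, and put $$(\widetilde Kw)(t):=\int_\Gamma k(t,\tau)c(\tau)^{-1}w(\tau)\,d\tau .$$ Let $\lambda\in\mathbb C$ satisfy $\ker(I-\lambda\widetilde K)=\{0\}$ in $X_\beta$. Let $f\in X_\alpha$, let $\varphi$ be the solution of $$c(t)\varphi(t)-\lambda\int_\Gamma k(t,\tau)\varphi(\tau)\,d\tau=f(t),\qquad t\in\Gamma,$$ and $w:=c\varphi$. Then $w-\lambda\widetilde Kw=f$ and $[w]_{t_j^d}=[f]_{t_j^d}$ for $j=1,\ldots,n_d$. Moreover, fix $m\in\{2,3,4\}$ and let $w_h=s_h+J_f$, where $s_h\in S_h$ is defined by $$(s_h-\lambda\widetilde Ks_h)(t_i^B)=(f_C+\lambda\widetilde KJ_f)(t_i^B),\qquad i=1,\ldots,n_B.$$ Then, for all sufficiently small $h$, $w_h$ exists uniquely and $\varphi_h:=c^{-1}w_h$ satisfies $$\|\varphi-\varphi_h\|_{X_\beta}\le Ch^{\alpha-\beta}\|f\|_{X_\alpha}$$ with $C$ independent of $h$ and $f$.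
   Context: **Contour.** $\Gamma\subset\mathbb C$ is a simple, closed, positively oriented contour of class $C^2$ with a regular $C^2$, $2\pi$-periodic parametrization $\gamma:\mathbb R\to\Gamma$ (so $\gamma(\theta+2\pi)=\gamma(\theta)$, $\gamma'(\theta)\ne0$, $\gamma$ injective on $[0,2\pi)$). $\mathcal D=\{t_1^d,\ldots,t_{n_d}^d\}\subset\Gamma$, $n_d\ge1$, is a set of distinct points, $t_j^d=\gamma(\theta_j^d)$ with $0<\theta_1^d<\cdots<\theta_{n_d}^d<2\pi$; the point $t_*=\gamma(0)=\gamma(2\pi)\notin\mathcal D$ is the cut. The continuity arcs are the $n_d$ open arcs of $\Gamma\setminus\mathcal D$. For a function $v$ with one-sided limits, $v(t_j^d\pm0)$ denote the limits along the orientation ($-$: incoming, $+$: outgoing), $[v]_{t_j^d}:=v(t_j^d+0)-v(t_j^d-0)$, and functions are represented by incoming values $v(t_j^d)=v(t_j^d-0)$. **Spaces.** For $0<\sigma<1$, $X_\sigma=PH_\sigma(\Gamma,\mathcal D)$ is the space of complex functions that are $\sigma$-Hölder on every continuity arc and have finite lateral limits at all points of $\mathcal D$, with norm $\|v\|_{X_\sigma}=\max_I(\|v\|_{\infty,I}+[v]_{\sigma,I})$, the maximum over the continuity arcs $I$; here $\overline I^{\,\ell}$ is $I$ completed by its two endpoints carrying the lateral values, $\|v\|_{\infty,I}=\sup_{\overline I^{\,\ell}}|v|$ and $[v]_{\sigma,I}=\sup_{t\ne s\in\overline I^{\,\ell}}|v(t)-v(s)|/|t-s|^\sigma$. If $n_d=1$,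 the distance $|t-s|$ in this seminorm is understood as the distance along the (single) completed arc. $H_\sigma(\Gamma)$ ($0<\sigma\le1$) is the space of globally $\sigma$-Hölder (Lipschitz if $\sigma=1$) functions on $\Gamma$ with norm $\sup_\Gamma|v|+\sup_{t\ne s\in\Gamma}|v(t)-v(s)|/|t-s|^\sigma$. **Kernel regularity assumption.** There are constants $M_0,M_\mu$ with $|k(t,\tau)|\le M_0$ and $|k(t,\tau)-k(s,\tau)|\le M_\mu|t-s|^\mu$ for all $t,s,\tau\in\Gamma$, and a modulus of continuity $\omega_k$ with $\omega_k(r)\to0$ as $r\downarrow0$ such that $|k(t,\tau)-k(t,\zeta)|\le\omega_k(|\tau-\zeta|)$ for all $t,\tau,\zeta\in\Gamma$. **Generators and decomposition of the data.** For $0\le\theta<2\pi$: $H_j(\gamma(\theta))=0$ if $0\le\theta\le\theta_j^d$ and $=1$ if $\theta_j^d<\theta<2\pi$; $R(\gamma(\theta))=\theta/(2\pi)$; $G_j:=H_j-R$. For $f\in X_\alpha$: $J_f=\sum_{j=1}^{n_d}[f]_{t_j^d}G_j$ and $f_C=f-J_f\in H_\alpha(\Gamma)$. **Splines.** For an integer $n_B\ge4$ put $h=2\pi/n_B$ and choose a phase $\rho_h\in[0,h)$ with $\operatorname{dist}(\theta_j^d-\rho_h,h\mathbb Z)\ge\eta h$ for $j=1,\ldots,n_d$, where $0<\eta<1/(2n_d)$ is fixed. Put $\theta_i^B=\rho_h+(i-1)h\ (\mathrm{mod}\ 2\pi)$, $t_i^B=\gamma(\theta_i^B)$, $i=1,\ldots,n_B$.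 Let $N_m$ be the centered cardinal B-spline of order $m$ (degree $m-1$, support $[-m/2,m/2]$, $\sum_{r\in\mathbb Z}N_m(x-r)=1$), $B_j(\gamma(\theta))=\sum_{\ell\in\mathbb Z}N_m\big((\theta-\theta_j^B)/h-\ell n_B\big)$, and $S_h=\operatorname{span}\{B_1,\ldots,B_{n_B}\}$. The parameter $h$ ranges over the values $2\pi/n_B$. The solution $\varphi$ is sought in $X_\beta$. *)

(* Defs.v *)
(* Stdlib reals with Coquelicot. *)
From Stdlib Require Export Reals ClassicalEpsilon.
From Coquelicot Require Export Coquelicot.

Open Scope R_scope.

(* Functions on the curve are functions C -> C; only their values on the curve
   are ever used, and equality of such functions means equality on the curve. *)

Definition on_curve (gamma : R -> C) (t : C) : Prop := exists x, t = gamma x.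

Definition CDerive (g : R -> C) (x : R) : C :=
  (Derive (fun u => Re (g u)) x, Derive (fun u => Im (g u)) x).

(* [ex_derive_n f i] only speaks about the last of the i differentiations, hence
   the quantification over all i <= 2. *)
Definition class_C2 (g : R -> R) : Prop :=
  (forall i x, (i <= 2)%nat -> ex_derive_n g i x) /\
  (forall x, continuous (Derive_n g 2) x).

Definition contour_int (gamma : R -> C) (g : C -> C) : C :=
  RInt (V := C_R_CompleteNormedModule)
       (fun x => (g (gamma x) * CDerive gamma x)%C) 0 (2 * PI).

(* z lies in the bounded component of the complement of the curve: the points
   reachable from z by paths avoiding the curve form a bounded set. *)
Definition inside (gamma : R -> C) (z : C) : Prop :=
  ~ on_curve gamma z /\
  exists M : R, forall p : R -> C,
    (forall s, continuous (U := C_UniformSpace) p s) ->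
    p 0 = z -> (forall s, 0 <= s <= 1 -> ~ on_curve gamma (p s)) ->
    Cmod (p 1) <= M.

Definition winding (gamma : R -> C) (z : C) : C :=
  (/ (RtoC (2 * PI) * Ci) * contour_int gamma (fun t => / (t - z)))%C.

Definition positively_oriented (gamma : R -> C) : Prop :=
  forall z, inside gamma z -> winding gamma z = RtoC 1.

Definition C2_contour (gamma : R -> C) : Prop :=
  class_C2 (fun x => Re (gamma x)) /\
  class_C2 (fun x => Im (gamma x)) /\
  (forall x, gamma (x + 2 * PI) = gamma x) /\
  (forall x, CDerive gamma x <> RtoC 0) /\
  (forall x y, 0 <= x < 2 * PI -> 0 <= y < 2 * PI -> gamma x = gamma y -> x = y) /\
  positively_oriented gamma.

(* The break parameters are thd 1 < ... < thd nd. *)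
Definition break_params (nd : nat) (thd : nat -> R) : Prop :=
  (1 <= nd)%nat /\
  0 < thd 1%nat /\ thd nd < 2 * PI /\
  (forall j, (1 <= j)%nat -> (j < nd)%nat -> thd j < thd (S j)).

Definition break_point (gamma : R -> C) (nd : nat) (thd : nat -> R) (t : C) : Prop :=
  exists j, (1 <= j <= nd)%nat /\ t = gamma (thd j).

(* v (gamma x + 0) and v (gamma x - 0); meaningful when the limits exist. *)
Definition lat_out (gamma : R -> C) (v : C -> C) (x : R) : C :=
  lim (T := C_R_CompleteNormedModule)
      (filtermap (fun y => v (gamma y)) (at_right x)).

Definition lat_in (gamma : R -> C) (v : C -> C) (x : R) : C :=
  lim (T := C_R_CompleteNormedModule)
      (filtermap (fun y => v (gamma y)) (at_left x)).

Definition jump (gamma : R -> C) (thd : nat -> R) (v : C -> C) (j : nat) : C :=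
  (lat_out gamma v (thd j) - lat_in gamma v (thd j))%C.

(* The j-th continuity arc is gamma (]arc_lo j, arc_hi j[); the last one passes
   through the cut gamma 0 = gamma (2 * PI). *)
Definition arc_lo (thd : nat -> R) (j : nat) : R := thd j.

Definition arc_hi (nd : nat) (thd : nat -> R) (j : nat) : R :=
  if Nat.ltb j nd then thd (S j) else thd 1%nat + 2 * PI.

(* Distance between the points of parameters x and y of a completed arc: arc
   length if there is a single arc (its two endpoints coincide in the plane),
   and the chord otherwise. *)
Definition arc_dist (gamma : R -> C) (nd : nat) (x y : R) : R :=
  if Nat.eqb nd 1 then Rabs (RInt (fun u => Cmod (CDerive gamma u)) x y)
  else Cmod (gamma x - gamma y)%C.

(* PH_sigma (Gamma, D), its elements carrying their incoming value at each
   break point. *)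
Definition PH (gamma : R -> C) (nd : nat) (thd : nat -> R) (sigma : R)
    (v : C -> C) : Prop :=
  (forall j, (1 <= j <= nd)%nat -> exists M : R, forall x y,
     arc_lo thd j < x < arc_hi nd thd j -> arc_lo thd j < y < arc_hi nd thd j ->
     x <> y ->
     Cmod (v (gamma x) - v (gamma y))%C <= M * Rpower (arc_dist gamma nd x y) sigma) /\
  (forall j, (1 <= j <= nd)%nat ->
     (exists l : C, filterlim (fun x => v (gamma x)) (at_right (thd j))
                              (locally (T := C_UniformSpace) l)) /\
     filterlim (fun x => v (gamma x)) (at_left (thd j))
               (locally (T := C_UniformSpace) (v (gamma (thd j))))).

(* v on the j-th completed arc, as a function of the parameter in
   [arc_lo j, arc_hi j]. *)
Definition arc_trace (gamma : R -> C) (nd : nat) (thd : nat -> R) (v : C -> C)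
    (j : nat) (x : R) : C :=
  if Rle_dec x (arc_lo thd j) then lat_out gamma v (arc_lo thd j)
  else if Rle_dec (arc_hi nd thd j) x then lat_in gamma v (arc_hi nd thd j)
  else v (gamma x).

Definition arc_sup (gamma : R -> C) (nd : nat) (thd : nat -> R) (v : C -> C)
    (j : nat) : Rbar :=
  Lub_Rbar (fun r => exists x, arc_lo thd j <= x <= arc_hi nd thd j /\
    r = Cmod (arc_trace gamma nd thd v j x)).

Definition arc_seminorm (gamma : R -> C) (nd : nat) (thd : nat -> R) (sigma : R)
    (v : C -> C) (j : nat) : Rbar :=
  Lub_Rbar (fun r => exists x y,
    arc_lo thd j <= x <= arc_hi nd thd j /\ arc_lo thd j <= y <= arc_hi nd thd j /\
    x <> y /\
    r = Cmod (arc_trace gamma nd thd v j x - arc_trace gamma nd thd v j y)%C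
        / Rpower (arc_dist gamma nd x y) sigma).

(* The maximum over the arcs, as the supremum of a finite nonempty set. *)
Definition PH_norm (gamma : R -> C) (nd : nat) (thd : nat -> R) (sigma : R)
    (v : C -> C) : Rbar :=
  Rbar_lub (fun r => exists j, (1 <= j <= nd)%nat /\
    r = Rbar_plus (arc_sup gamma nd thd v j) (arc_seminorm gamma nd thd sigma v j)).

Definition kernel_regular (gamma : R -> C) (mu : R) (k : C -> C -> C) : Prop :=
  (exists M0 : R, forall t tau, on_curve gamma t -> on_curve gamma tau ->
     Cmod (k t tau) <= M0) /\
  (exists Mmu : R, forall t s tau,
     on_curve gamma t -> on_curve gamma s -> on_curve gamma tau -> t <> s ->
     Cmod (k t tau - k s tau)%C <= Mmu * Rpower (Cmod (t - s)%C) mu) /\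
  (exists omega : R -> R,
     filterlim omega (at_right 0) (locally 0) /\
     forall t tau zeta,
       on_curve gamma t -> on_curve gamma tau -> on_curve gamma zeta ->
       Cmod (k t tau - k t zeta)%C <= omega (Cmod (tau - zeta)%C)).

Definition Kop (gamma : R -> C) (k : C -> C -> C) (w : C -> C) (t : C) : C :=
  contour_int gamma (fun tau => (k t tau * w tau)%C).

Definition Ktilde (gamma : R -> C) (k : C -> C -> C) (c : C -> C)
    (w : C -> C) (t : C) : C :=
  contour_int gamma (fun tau => (k t tau * / c tau * w tau)%C).

Definition solves (gamma : R -> C) (k : C -> C -> C) (c : C -> C) (lambda : C)
    (f phi : C -> C) : Prop :=
  forall t, on_curve gamma t -> (c t * phi t - lambda * Kop gamma k phi t)%C = f t.

(* The parameter in [0, 2 * PI) of a point of the curve. *)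
Definition angle (gamma : R -> C) (t : C) : R :=
  epsilon (inhabits 0) (fun x => 0 <= x < 2 * PI /\ gamma x = t).

Definition Hgen (gamma : R -> C) (thd : nat -> R) (j : nat) (t : C) : R :=
  if Rle_dec (angle gamma t) (thd j) then 0 else 1.

Definition ramp (gamma : R -> C) (t : C) : R := angle gamma t / (2 * PI).

Definition Ggen (gamma : R -> C) (thd : nat -> R) (j : nat) (t : C) : R :=
  Hgen gamma thd j t - ramp gamma t.

Definition Jpart (gamma : R -> C) (nd : nat) (thd : nat -> R) (f : C -> C) (t : C) : C :=
  sum_n_m (G := C_AbelianMonoid)
    (fun j => (jump gamma thd f j * RtoC (Ggen gamma thd j t))%C) 1 nd.

Definition Cpart (gamma : R -> C) (nd : nat) (thd : nat -> R) (f : C -> C) (t : C) : C :=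
  (f t - Jpart gamma nd thd f t)%C.

(* Centered cardinal B-spline of order m: the m-fold convolution of the
   indicator function of [-1/2, 1/2). *)
Fixpoint Nspline (m : nat) (x : R) : R :=
  match m with
  | O => 0
  | S O => if Rle_dec (- (1 / 2)) x then if Rlt_dec x (1 / 2) then 1 else 0 else 0
  | S m' => RInt (Nspline m') (x - 1 / 2) (x + 1 / 2)
  end.

(* Sum over the integers; below it has only finitely many nonzero terms. *)
Definition Zsum (a : Z -> R) : R :=
  Series (fun l => a (Z.of_nat l)) + Series (fun l => a (- Z.of_nat (S l))%Z).

Definition mesh (n : nat) : R := 2 * PI / INR n.

(* For 0 <= rho < mesh n and 1 <= i <= n this lies in [0, 2 * PI), so that no
   reduction modulo 2 * PI is needed. *)
Definition knot (n : nat) (rho : R) (i : nat) : R := rho + (INR i - 1) * mesh n.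

Definition admissible_phase (nd : nat) (thd : nat -> R) (eta : R) (n : nat) (rho : R) : Prop :=
  0 <= rho < mesh n /\
  forall j (z : Z), (1 <= j <= nd)%nat ->
    eta * mesh n <= Rabs (thd j - rho - mesh n * IZR z).

Definition Bspline (gamma : R -> C) (m n : nat) (rho : R) (j : nat) (t : C) : R :=
  Zsum (fun l => Nspline m ((angle gamma t - knot n rho j) / mesh n - IZR l * INR n)).

Definition in_spline_space (gamma : R -> C) (m n : nat) (rho : R) (s : C -> C) : Prop :=
  exists a : nat -> C, forall t, on_curve gamma t ->
    s t = sum_n_m (G := C_AbelianMonoid)
            (fun j => (a j * RtoC (Bspline gamma m n rho j t))%C) 1 n.

Definition collocates (gamma : R -> C) (nd : nat) (thd : nat -> R)
    (k : C -> C -> C) (c : C -> C) (lambda : C) (f : C -> C)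
    (n : nat) (rho : R) (s : C -> C) : Prop :=
  forall i, (1 <= i <= n)%nat ->
    let t := gamma (knot n rho i) in
    (s t - lambda * Ktilde gamma k c s t)%C =
    (Cpart gamma nd thd f t
     + lambda * Ktilde gamma k c (Jpart gamma nd thd f) t)%C.

(* w_h = s_h + J_f, with s_h in S_h a solution of the collocation equations. *)
Definition approx_solution (gamma : R -> C) (nd : nat) (thd : nat -> R)
    (k : C -> C -> C) (c : C -> C) (lambda : C) (f : C -> C)
    (m n : nat) (rho : R) (wh : C -> C) : Prop :=
  exists s : C -> C,
    in_spline_space gamma m n rho s /\
    collocates gamma nd thd k c lambda f n rho s /\
    forall t, on_curve gamma t -> wh t = (s t + Jpart gamma nd thd f t)%C.

(* Main.v *)
(* Writing w = c phi, the equation becomes w - A w = f with A = lambda Ktilde. Since A maps bounded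
   functions to mu-Hoelder ones, w and f have the same jumps, and w = u + J_f with u continuous,
   u - A u = f_C + A J_f. On continuous functions I - A is boundedly invertible: subtracting from A
   its composition with a fine sampling operator leaves a contraction, and the remaining finite rank
   equation is an injective square linear system.

   The spline interpolation matrix is diagonally dominant because N_m(0) >= 2/3 for m <= 4, whence
   the error estimates for interpolation of Hoelder functions at the nodes. If E = u - s_h, the
   collocation equations say that E = A E at the nodes, that is, s_h interpolates v = u - A E, and
   E - A E = v - s_h. Hence |E| <= C h^alpha (|u|_alpha + |E|), where the last term is absorbed for
   small h; with u = 0 this also shows that the discrete problem is injective. *)

(* All analysis takes place in the parameter: a function [v] on the curve becomes the periodic
   function [v (gamma x)]. On each completed arc [arc_dist] is comparable with the parameter
   distance, because [gamma] is regular and injective; hence norms transfer up to constants. Break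
   points force the use of traces, functions on the closed parameter intervals of the arcs, since
   the value at a break point belongs to the arc ending there.

   Two spaces compete: the kernel hypothesis concerns piecewise [beta]-Hoelder functions, the
   Fredholm argument continuous periodic functions with the sup norm. Smoothing reconciles them, a
   continuous solution of [u = A u] being Hoelder. Compactness enters without extracting
   subsequences: hat function sampling approximates all functions with a given Hoelder constant
   uniformly.

   The exponent [alpha - beta] is the price of measuring the interpolation error of an
   [alpha]-Hoelder function with exponent [beta]. The sup norm error is of the better order
   [h^alpha]; it is the quantity absorbed, and the [beta]-seminorm is estimated afterwards from
   [E = A E + (v - s_h)]. *)
Require Import Defs.
From Stdlib Require Import Reals Lra Lia ZArith FunctionalExtensionality ClassicalEpsilon Classical.
From Coquelicot Require Import Coquelicot.

Open Scope R_scope.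

(** * Powers and complex limits *)

(* [Rpower 0 s] is [1]; here [0] to the power [s] is [0]. *)
Definition rpow (d s : R) : R := if Req_EM_T d 0 then 0 else Rpower d s.

Lemma rpow_0 (s : R) : rpow 0 s = 0.
Proof. unfold rpow. destruct (Req_EM_T 0 0); lra. Qed.

Lemma rpow_pos_eq (d s : R) : 0 < d -> rpow d s = Rpower d s.
Proof. intros H. unfold rpow. destruct (Req_EM_T d 0); lra. Qed.

Lemma rpow_ge_0 (d s : R) : 0 <= rpow d s.
Proof.
  unfold rpow. destruct (Req_EM_T d 0); [lra|].
  unfold Rpower. left; apply exp_pos.
Qed.

Lemma rpow_mono (d e s : R) : 0 < s -> 0 <= d -> d <= e -> rpow d s <= rpow e s.
Proof.
  intros Hs [Hd|Hd] He.
  - rewrite !rpow_pos_eq by lra. apply Rle_Rpower_l; lra.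
  - subst d. rewrite rpow_0. apply rpow_ge_0.
Qed.

Lemma rpow_mult (d e s : R) : 0 <= d -> 0 <= e -> rpow (d * e) s = rpow d s * rpow e s.
Proof.
  intros [Hd|<-] [He|<-].
  - rewrite !rpow_pos_eq by nra. now rewrite Rpower_mult_distr.
  - rewrite Rmult_0_r, rpow_0; ring.
  - rewrite Rmult_0_l, rpow_0; ring.
  - rewrite Rmult_0_l, rpow_0; ring.
Qed.

Lemma rpow_small (d s s' : R) : 0 <= d <= 1 -> s' <= s -> rpow d s <= rpow d s'.
Proof.
  intros [[Hd|<-] Hd1] Hs.
  - rewrite !rpow_pos_eq by lra. unfold Rpower.
    destruct (Rle_lt_or_eq_dec d 1 Hd1) as [H1|H1].
    + assert (ln d < 0) by (rewrite <- ln_1; apply ln_increasing; lra).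
      destruct (Req_dec (s * ln d) (s' * ln d)) as [->|Hn]; [lra|].
      left. apply exp_increasing. nra.
    + subst d. rewrite ln_1, !Rmult_0_r. lra.
  - rewrite !rpow_0; lra.
Qed.

Lemma rpow_ge_1 (d s : R) : 1 <= d -> 0 <= s -> 1 <= rpow d s.
Proof.
  intros Hd Hs. rewrite rpow_pos_eq by lra.
  rewrite <- (Rpower_O d) by lra. apply Rle_Rpower; lra.
Qed.

Lemma rpow_1 (d : R) : 0 <= d -> rpow d 1 = d.
Proof.
  intros [Hd|<-]; [|apply rpow_0].
  rewrite rpow_pos_eq by lra. now apply Rpower_1.
Qed.

Lemma rpow_plus (d s s' : R) : 0 <= d -> rpow d (s + s') = rpow d s * rpow d s'.
Proof.
  intros [Hd|<-].
  - rewrite !rpow_pos_eq by lra. apply Rpower_plus.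
  - rewrite !rpow_0; ring.
Qed.

Lemma rpow_small_radius (s e M : R) : 0 < s -> 0 < e ->
  exists d, 0 < d /\ forall x, 0 <= x -> x < d -> M * rpow x s < e.
Proof.
  intros Hs He. pose proof (Rabs_pos M) as HM. pose proof (RRle_abs M).
  assert (He' : 0 < e / (Rabs M + 1)) by (apply Rdiv_lt_0_compat; lra).
  (* The radius solves [(Rabs M + 1) * x^s = e]; the added 1 keeps the quotient meaningful for
     [M = 0]. *)
  exists (Rpower (e / (Rabs M + 1)) (/ s)). split.
  - unfold Rpower; apply exp_pos.
  - intros x Hx Hxd.
    assert (Hr : rpow x s < e / (Rabs M + 1)).
    { destruct Hx as [Hx|<-]; [|now rewrite rpow_0].
      rewrite rpow_pos_eq by lra.
      replace (e / (Rabs M + 1)) with (Rpower (Rpower (e / (Rabs M + 1)) (/ s)) s).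
      - apply Rlt_Rpower_l; lra.
      - rewrite Rpower_mult, Rinv_l, Rpower_1; lra. }
    pose proof (rpow_ge_0 x s).
    apply Rle_lt_trans with ((Rabs M + 1) * rpow x s); [nra|].
    replace e with ((Rabs M + 1) * (e / (Rabs M + 1))) by (field; lra).
    apply Rmult_lt_compat_l; lra.
Qed.

Lemma Cmod_sub_sym (a b : C) : Cmod (a - b) = Cmod (b - a).
Proof. replace (b - a)%C with (- (a - b))%C by ring. now rewrite Cmod_opp. Qed.

Lemma Cmod_sub_triangle (a b c : C) : Cmod (a - c) <= Cmod (a - b) + Cmod (b - c).
Proof. replace (a - c)%C with ((a - b) + (b - c))%C by ring. apply Cmod_triangle. Qed.

Lemma Cmod_sub_le (a b : C) : Cmod (a - b) <= Cmod a + Cmod b.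
Proof.
  unfold Cminus. eapply Rle_trans; [apply Cmod_triangle|]. rewrite Cmod_opp. lra.
Qed.

Lemma Cmod_diff_le (a b : C) : Cmod a <= Cmod b + Cmod (a - b).
Proof. replace a with (b + (a - b))%C at 1 by ring. apply Cmod_triangle. Qed.

Lemma Cmod_small_0 (a : C) : (forall e, 0 < e -> Cmod a <= e) -> a = RtoC 0.
Proof.
  intros H. apply Cmod_eq_0. apply Rle_antisym; [|apply Cmod_ge_0].
  apply le_epsilon. intros e He. rewrite Rplus_0_l. now apply H.
Qed.

Lemma Cmod_le_abs (a : C) : Cmod a <= Rabs (fst a) + Rabs (snd a).
Proof.
  assert (Ha : a = (RtoC (fst a) + RtoC (snd a) * Ci)%C)
    by (destruct a; unfold RtoC, Ci, Cplus, Cmult; simpl; f_equal; ring).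
  rewrite Ha at 1.
  eapply Rle_trans; [apply Cmod_triangle|].
  rewrite Cmod_mult, !Cmod_R, Cmod_Ci, Rmult_1_r. apply Rle_refl.
Qed.

Lemma Rabs_fst_le (a : C) : Rabs (fst a) <= Cmod a.
Proof. apply Rle_trans with (2 := Rmax_Cmod a). apply Rmax_l. Qed.

Lemma Rabs_snd_le (a : C) : Rabs (snd a) <= Cmod a.
Proof. apply Rle_trans with (2 := Rmax_Cmod a). apply Rmax_r. Qed.

(** Convergence measured by [Cmod], in which all estimates are made. The uniform structure of C is
    the product one, with componentwise balls; [Clim_filterlim] passes between the two. *)
Definition Clim (F : (R -> Prop) -> Prop) (u : R -> C) (l : C) : Prop :=
  forall e, 0 < e -> F (fun x => Cmod (u x - l)%C < e).

Lemma Clim_filterlim (F : (R -> Prop) -> Prop) {FF : Filter F} (u : R -> C) (l : C) :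
  filterlim u F (locally (T := C_UniformSpace) l) <-> Clim F u l.
Proof.
  rewrite (filterlim_locally (U := C_UniformSpace) u l). split.
  - intros H e He.
    assert (He2 : 0 < e / 2) by lra.
    generalize (H (mkposreal _ He2)). apply filter_imp.
    intros x [H1 H2]. simpl in H1, H2.
    apply Rle_lt_trans with (1 := Cmod_le_abs _).
    unfold ball in H1, H2; simpl in H1, H2. unfold AbsRing_ball, abs, minus, plus, opp in H1, H2.
    simpl in H1, H2. unfold Cminus, Cplus, Copp; simpl. lra.
  - intros H e. generalize (H e (cond_pos e)). apply filter_imp.
    intros x Hx. split; simpl.
    + apply Rle_lt_trans with (2 := Hx). apply (Rabs_fst_le (u x - l)%C).
    + apply Rle_lt_trans with (2 := Hx). apply (Rabs_snd_le (u x - l)%C).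
Qed.

Lemma Clim_const (F : (R -> Prop) -> Prop) {FF : Filter F} (a : C) : Clim F (fun _ => a) a.
Proof.
  intros e He. apply filter_forall. intros _.
  replace (a - a)%C with (RtoC 0) by ring. now rewrite Cmod_0.
Qed.

Lemma Clim_plus (F : (R -> Prop) -> Prop) {FF : Filter F} u v a b :
  Clim F u a -> Clim F v b -> Clim F (fun x => (u x + v x)%C) (a + b)%C.
Proof.
  intros Hu Hv e He. assert (He2 : 0 < e / 2) by lra.
  generalize (filter_and _ _ (Hu _ He2) (Hv _ He2)). apply filter_imp. intros x [H1 H2].
  replace (u x + v x - (a + b))%C with ((u x - a) + (v x - b))%C by ring.
  apply Rle_lt_trans with (1 := Cmod_triangle _ _). lra.
Qed.

Lemma Clim_mult (F : (R -> Prop) -> Prop) {FF : Filter F} u v a b :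
  Clim F u a -> Clim F v b -> Clim F (fun x => (u x * v x)%C) (a * b)%C.
Proof.
  intros Hu Hv e He.
  pose proof (Cmod_ge_0 a) as Ha. pose proof (Cmod_ge_0 b) as Hb.
  set (d := Rmin 1 (e / (2 * (1 + Cmod a + Cmod b)))).
  assert (Hd : 0 < d).
  { unfold d. apply Rmin_glb_lt; [lra|]. apply Rdiv_lt_0_compat; lra. }
  assert (Hd1 : d <= 1) by apply Rmin_l.
  assert (Hd2 : d * (1 + Cmod a + Cmod b) < e).
  { apply Rle_lt_trans with (e / (2 * (1 + Cmod a + Cmod b)) * (1 + Cmod a + Cmod b)).
    - apply Rmult_le_compat_r; [lra|]. apply Rmin_r.
    - replace (e / (2 * (1 + Cmod a + Cmod b)) * (1 + Cmod a + Cmod b)) with (e / 2)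
        by (field; lra). lra. }
  generalize (filter_and _ _ (Hu _ Hd) (Hv _ Hd)). apply filter_imp. intros x [H1 H2].
  replace (u x * v x - a * b)%C
    with ((u x - a) * (v x - b) + ((u x - a) * b + a * (v x - b)))%C by ring.
  eapply Rle_lt_trans; [apply Cmod_triangle|].
  eapply Rle_lt_trans; [apply Rplus_le_compat_l, Cmod_triangle|].
  rewrite !Cmod_mult.
  pose proof (Cmod_ge_0 (u x - a)). pose proof (Cmod_ge_0 (v x - b)).
  nra.
Qed.

Lemma Clim_inv (F : (R -> Prop) -> Prop) {FF : Filter F} u a :
  Clim F u a -> a <> RtoC 0 -> Clim F (fun x => (/ u x)%C) (/ a)%C.
Proof.
  intros Hu Ha e He.
  assert (Ha' : 0 < Cmod a) by now apply Cmod_gt_0.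
  set (d := Rmin (Cmod a / 2) (e * (Cmod a * Cmod a) / 4)).
  assert (Hd : 0 < d).
  { unfold d. apply Rmin_glb_lt; [lra|]. apply Rdiv_lt_0_compat; [|lra].
    apply Rmult_lt_0_compat; [lra|]. nra. }
  assert (Hd1 : d <= Cmod a / 2) by apply Rmin_l.
  assert (Hd2 : d <= e * (Cmod a * Cmod a) / 4) by apply Rmin_r.
  generalize (Hu _ Hd). apply filter_imp. intros x Hx.
  assert (Hux : Cmod a / 2 <= Cmod (u x)).
  { pose proof (Cmod_diff_le a (u x)). rewrite Cmod_sub_sym in H. lra. }
  assert (u x <> RtoC 0) by (apply Cmod_gt_0; lra).
  replace (/ u x - / a)%C with ((a - u x) * / (u x * a))%C by (field; auto).
  rewrite Cmod_mult, Cmod_inv, Cmod_mult, Cmod_sub_sym.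
  apply Rmult_lt_reg_r with (Cmod (u x) * Cmod a); [nra|].
  rewrite Rmult_assoc, Rinv_l by nra.
  rewrite Rmult_1_r. apply Rlt_le_trans with (1 := Hx).
  apply Rle_trans with (1 := Hd2).
  assert (0 < e * Cmod a) by nra. nra.
  now apply Cmult_neq_0.
Qed.

Lemma Clim_ext (F : (R -> Prop) -> Prop) {FF : Filter F} u v l :
  F (fun x => u x = v x) -> Clim F u l -> Clim F v l.
Proof.
  intros Hx Hu e He. generalize (filter_and _ _ Hx (Hu e He)). apply filter_imp.
  intros x [<- H]. exact H.
Qed.

Lemma Clim_unique (F : (R -> Prop) -> Prop) {FF : ProperFilter F} u a b :
  Clim F u a -> Clim F u b -> a = b.
Proof.
  intros Ha Hb.
  assert (H : (a - b)%C = RtoC 0).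
  { apply Cmod_small_0. intros e He. assert (He2 : 0 < e / 2) by lra.
    destruct (filter_ex _ (filter_and _ _ (Ha _ He2) (Hb _ He2))) as [x [H1 H2]].
    apply Rle_trans with (1 := Cmod_sub_triangle a (u x) b).
    rewrite Cmod_sub_sym in H1. lra. }
  replace a with ((a - b) + b)%C by ring. rewrite H. ring.
Qed.

(** Lateral values are defined by the total function [lim]. Convergence makes the image filter
    Cauchy, completeness makes [lim] a limit of it, and uniqueness identifies the two limits. *)
Lemma lim_Clim (F : (R -> Prop) -> Prop) {FF : ProperFilter F} (u : R -> C) l :
  Clim F u l -> lim (T := C_R_CompleteNormedModule) (filtermap u F) = l.
Proof.
  intros Hl.
  assert (Hf : filterlim u F (locally (T := C_UniformSpace) l))
    by now apply (Clim_filterlim F).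
  assert (HP : ProperFilter (filtermap u F)) by now apply filtermap_proper_filter.
  assert (Hc : cauchy (T := C_R_CompleteNormedModule) (filtermap u F)).
  { intros eps. exists l. apply Hf. now exists eps. }
  apply Clim_unique with F u; auto.
  apply (Clim_filterlim F).
  apply (filterlim_locally (U := C_UniformSpace)).
  intros eps. apply (complete_cauchy (T := C_R_CompleteNormedModule) _ HP Hc eps).
Qed.

Lemma Clim_le (F : (R -> Prop) -> Prop) {FF : ProperFilter F} u l M :
  Clim F u l -> F (fun x => Cmod (u x) <= M) -> Cmod l <= M.
Proof.
  intros Hu HM. apply le_epsilon. intros e He.
  destruct (filter_ex _ (filter_and _ _ (Hu e He) HM)) as [x [H1 H2]].
  pose proof (Cmod_diff_le l (u x)). rewrite Cmod_sub_sym in H. lra.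
Qed.

Lemma Clim_ge (F : (R -> Prop) -> Prop) {FF : ProperFilter F} u l M :
  Clim F u l -> F (fun x => M <= Cmod (u x)) -> M <= Cmod l.
Proof.
  intros Hu HM. apply le_epsilon. intros e He.
  destruct (filter_ex _ (filter_and _ _ (Hu e He) HM)) as [x [H1 H2]].
  pose proof (Cmod_diff_le (u x) l). lra.
Qed.

Lemma Clim_locally_iff (u : R -> C) (x : R) (l : C) :
  Clim (locally x) u l <->
  forall e, 0 < e -> exists d, 0 < d /\ forall y, Rabs (y - x) < d -> Cmod (u y - l) < e.
Proof.
  split.
  - intros H e He. destruct (H e He) as [d Hd]. exists d. split; [apply cond_pos|].
    intros y Hy. now apply Hd.
  - intros H e He. destruct (H e He) as [d [Hd0 Hd]]. exists (mkposreal d Hd0).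
    intros y Hy. now apply Hd.
Qed.

Lemma Clim_right_iff (u : R -> C) (x : R) (l : C) :
  Clim (at_right x) u l <->
  forall e, 0 < e -> exists d, 0 < d /\ forall y, x < y < x + d -> Cmod (u y - l) < e.
Proof.
  split.
  - intros H e He. destruct (H e He) as [d Hd]. exists d. split; [apply cond_pos|].
    intros y Hy. apply Hd; [|lra]. unfold ball; simpl; unfold AbsRing_ball, abs, minus, plus, opp; simpl.
    rewrite Rabs_pos_eq; lra.
  - intros H e He. destruct (H e He) as [d [Hd0 Hd]]. exists (mkposreal d Hd0).
    intros y Hy Hxy. apply Hd. unfold ball in Hy; simpl in Hy; unfold AbsRing_ball, abs, minus, plus, opp in Hy; simpl in Hy.
    rewrite Rabs_pos_eq in Hy; lra.
Qed.

Lemma Clim_left_iff (u : R -> C) (x : R) (l : C) :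
  Clim (at_left x) u l <->
  forall e, 0 < e -> exists d, 0 < d /\ forall y, x - d < y < x -> Cmod (u y - l) < e.
Proof.
  split.
  - intros H e He. destruct (H e He) as [d Hd]. exists d. split; [apply cond_pos|].
    intros y Hy. apply Hd; [|lra]. unfold ball; simpl; unfold AbsRing_ball, abs, minus, plus, opp; simpl.
    rewrite Rabs_left1; lra.
  - intros H e He. destruct (H e He) as [d [Hd0 Hd]]. exists (mkposreal d Hd0).
    intros y Hy Hxy. apply Hd. unfold ball in Hy; simpl in Hy; unfold AbsRing_ball, abs, minus, plus, opp in Hy; simpl in Hy.
    rewrite Rabs_left1 in Hy; lra.
Qed.

Lemma Clim_locally_right u x l : Clim (locally x) u l -> Clim (at_right x) u l.
Proof. intros H e He. apply filter_le_within. now apply H. Qed.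

Lemma Clim_locally_left u x l : Clim (locally x) u l -> Clim (at_left x) u l.
Proof. intros H e He. apply filter_le_within. now apply H. Qed.

(** * Bounded, Hoelder and continuous periodic functions of the parameter *)

Definition bnd (u : R -> C) (B : R) : Prop := forall x, Cmod (u x) <= B.

(** With [rpow] the condition is trivially true at [x = y], so no side condition is needed. *)
Definition holder (D : R -> Prop) (s A : R) (u : R -> C) : Prop :=
  forall x y, D x -> D y -> Cmod (u x - u y)%C <= A * rpow (Rabs (x - y)) s.

Definition everywhere (x : R) : Prop := True.

(** Continuous functions on the contour, read in the parameter: the space in which the equation for
    the continuous part and the splines live. *)
Definition CP (u : R -> C) : Prop :=
  (forall x, Clim (locally x) u (u x)) /\ (forall x, u (x + 2 * PI) = u x).

Lemma near_right a b : a < b -> at_right a (fun y => a < y < b).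
Proof.
  intros Hab. assert (H : 0 < b - a) by lra. exists (mkposreal _ H). intros y Hy Hay.
  apply Rabs_lt_between' in Hy. simpl in Hy. lra.
Qed.

Lemma near_left a b : a < b -> at_left b (fun y => a < y < b).
Proof.
  intros Hab. assert (H : 0 < b - a) by lra. exists (mkposreal _ H). intros y Hy Hyb.
  apply Rabs_lt_between' in Hy. simpl in Hy. lra.
Qed.

Lemma near_open a b x : a < x < b -> locally x (fun y => a < y < b).
Proof.
  intros Hx. assert (H : 0 < Rmin (x - a) (b - x)) by (apply Rmin_glb_lt; lra).
  exists (mkposreal _ H). intros y Hy. apply Rabs_lt_between' in Hy. simpl in Hy.
  pose proof (Rmin_l (x - a) (b - x)). pose proof (Rmin_r (x - a) (b - x)). lra.
Qed.

Lemma holder_Clim F {FF : Filter F} (D : R -> Prop) s M u x : 0 < s -> D x -> F D ->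
  filter_le F (locally x) -> holder D s M u -> Clim F u (u x).
Proof.
  intros Hs Hx HD HF H e He.
  destruct (rpow_small_radius s e M Hs He) as [d [Hd0 Hd]].
  generalize (filter_and _ _ HD (HF _ (locally_ball x (mkposreal d Hd0)))).
  apply filter_imp. intros y [Hy Hyx].
  apply Rle_lt_trans with (1 := H y x Hy Hx). apply Hd; [apply Rabs_pos|exact Hyx].
Qed.

Lemma holder_continuous s A u : 0 < s ->
  holder everywhere s A u -> forall x, Clim (locally x) u (u x).
Proof.
  intros Hs H x. apply (holder_Clim (locally x) everywhere s A); auto; try exact I.
  - apply filter_forall. intros; exact I.
  - intros P HP. exact HP.
Qed.

(** Merges finitely many existential constants by adding them up, which is allowed since [P j] is
    monotone in the constant. It replaces maxima over arcs, nodes and matrix entries. *)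
Lemma uniform_constant (D : nat -> Prop) (P : nat -> R -> Prop) n :
  (forall j, D j -> (j <= n)%nat) -> (forall j M M', P j M -> M <= M' -> P j M') ->
  (forall j, D j -> exists M, 0 <= M /\ P j M) ->
  exists M, 0 <= M /\ forall j, D j -> P j M.
Proof.
  intros Hn Hmon H.
  assert (Hk : forall k, exists M, 0 <= M /\ forall j, D j -> (j <= k)%nat -> P j M).
  { assert (Hj : forall j, exists M, 0 <= M /\ (D j -> P j M)).
    { intros j. destruct (classic (D j)) as [Hj|Hj].
      - destruct (H j Hj) as [M HM]. exists M. tauto.
      - exists 0. split; [lra|tauto]. }
    induction k as [|k [M [HM0 HM]]].
    - destruct (Hj 0%nat) as [M [HM0 HM]]. exists M. split; [assumption|].
      intros j Dj Hj0. replace j with 0%nat in * by lia. auto.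
    - destruct (Hj (S k)) as [M' [HM0' HM']]. exists (M + M'). split; [lra|].
      intros j Dj Hjk. destruct (Nat.eq_dec j (S k)) as [->|].
      + apply Hmon with M'; [auto|lra].
      + apply Hmon with M; [apply HM; auto; lia|lra]. }
  destruct (Hk n) as [M [HM0 HM]]. exists M. split; auto.
Qed.

Lemma CP_plus u v : CP u -> CP v -> CP (fun x => (u x + v x)%C).
Proof.
  intros [Hu Pu] [Hv Pv]. split.
  - intros x. apply Clim_plus; auto; apply locally_filter.
  - intros x. now rewrite Pu, Pv.
Qed.

Lemma CP_scal a u : CP u -> CP (fun x => (a * u x)%C).
Proof.
  intros [Hu Pu]. split.
  - intros x. apply Clim_mult; auto; try apply locally_filter.
    apply Clim_const, locally_filter.
  - intros x. now rewrite Pu.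
Qed.

Lemma CP_zero : CP (fun _ => RtoC 0).
Proof. split; auto. intros x. apply Clim_const, locally_filter. Qed.

Lemma CP_ext u v : (forall x, u x = v x) -> CP u -> CP v.
Proof. intros H. now replace v with u by (now apply functional_extensionality). Qed.

Lemma CP_minus u v : CP u -> CP v -> CP (fun x => (u x - v x)%C).
Proof.
  intros Hu Hv. apply CP_ext with (fun x => (u x + (- RtoC 1) * v x)%C).
  - intros x; ring.
  - apply CP_plus; auto. now apply CP_scal.
Qed.

(** * Finite sums of complex numbers *)

Fixpoint csum (n : nat) (f : nat -> C) : C :=
  match n with
  | O => RtoC 0
  | S n => (csum n f + f n)%C
  end.

Lemma csum_ext n f g : (forall i, (i < n)%nat -> f i = g i) -> csum n f = csum n g.
Proof.
  induction n; intros H; simpl; [reflexivity|].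
  rewrite IHn by (intros; apply H; lia). now rewrite H by lia.
Qed.

Lemma csum_plus n f g : csum n (fun i => (f i + g i)%C) = (csum n f + csum n g)%C.
Proof. induction n; simpl; [ring|]. rewrite IHn. ring. Qed.

Lemma csum_scal n a f : csum n (fun i => (a * f i)%C) = (a * csum n f)%C.
Proof. induction n; simpl; [ring|]. rewrite IHn. ring. Qed.

Lemma csum_zero n f : (forall i, (i < n)%nat -> f i = RtoC 0) -> csum n f = RtoC 0.
Proof.
  induction n; intros H; simpl; [reflexivity|].
  rewrite IHn by (intros; apply H; lia). rewrite H by lia. ring.
Qed.

Lemma csum_single n f i : (i < n)%nat ->
  (forall j, (j < n)%nat -> j <> i -> f j = RtoC 0) -> csum n f = f i.
Proof.
  induction n; intros Hi H; [lia|]. simpl.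
  destruct (Nat.eq_dec i n) as [->|Hin].
  - rewrite csum_zero by (intros; apply H; lia). ring.
  - rewrite IHn by (try lia; intros; apply H; lia). rewrite (H n) by lia. ring.
Qed.

Lemma csum_swap n m (f : nat -> nat -> C) :
  csum n (fun i => csum m (fun j => f i j)) = csum m (fun j => csum n (fun i => f i j)).
Proof.
  induction n; simpl.
  - symmetry. now apply csum_zero.
  - now rewrite IHn, csum_plus.
Qed.

Lemma csum_bound n f M : (forall i, (i < n)%nat -> Cmod (f i) <= M) ->
  Cmod (csum n f) <= INR n * M.
Proof.
  induction n; intros H.
  - simpl. rewrite Cmod_0. lra.
  - rewrite S_INR. simpl. eapply Rle_trans; [apply Cmod_triangle|].
    assert (Cmod (csum n f) <= INR n * M) by (apply IHn; intros; apply H; lia).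
    assert (Cmod (f n) <= M) by (apply H; lia). lra.
Qed.

Lemma sum_n_m_csum (f : nat -> C) n :
  sum_n_m (G := C_AbelianMonoid) f 1 n = csum n (fun i => f (S i)).
Proof.
  induction n.
  - now rewrite sum_n_m_zero by lia.
  - rewrite sum_n_Sm by lia. now rewrite IHn.
Qed.

Lemma CP_csum n (a : nat -> C) (b : nat -> R -> C) :
  (forall i, (i < n)%nat -> CP (b i)) -> CP (fun x => csum n (fun i => (a i * b i x)%C)).
Proof.
  induction n; intros H; simpl.
  - apply CP_zero.
  - apply CP_plus.
    + apply IHn. intros; apply H; lia.
    + apply CP_scal, H; lia.
Qed.

(** * Linear systems *)

Lemma C1_neq_0 : RtoC 1 <> RtoC 0.
Proof. intros H. apply RtoC_inj in H. lra. Qed.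

(** Elimination by induction on the number of equations. If the last unknown occurs in no equation,
    it alone is set to 1. Otherwise an equation [p] containing it eliminates it from the others,
    enumerated by [q], which leaves [n] equations in [S n] unknowns. *)
Lemma underdetermined_system (n : nat) : forall (a : nat -> nat -> C),
  exists x : nat -> C,
    (exists j, (j < S n)%nat /\ x j <> RtoC 0) /\
    forall i, (i < n)%nat -> csum (S n) (fun j => (a i j * x j)%C) = RtoC 0.
Proof.
  induction n; intros a.
  - exists (fun _ => RtoC 1). split; [|intros i Hi; lia].
    exists O. split; [lia|]. exact C1_neq_0.
  - destruct (classic (exists p, (p < S n)%nat /\ a p (S n) <> RtoC 0)) as [[p [Hp Ha]]|Hz].
    + (* Eliminate the last unknown using equation [p]. *)
      set (q i := if Nat.ltb i p then i else S i).
      destruct (IHn (fun i j => (a (q i) j - a (q i) (S n) / a p (S n) * a p j)%C))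
        as [x [[j0 [Hj0 Hx0]] Hx]].
      set (y := (- (csum (S n) (fun j => a p j * x j) / a p (S n)))%C).
      exists (fun j => if Nat.eqb j (S n) then y else x j).
      assert (Hs : forall i, csum (S (S n))
          (fun j => (a i j * (if Nat.eqb j (S n) then y else x j))%C) =
          (csum (S n) (fun j => (a i j * x j)%C) + a i (S n) * y)%C).
      { intros i. remember (S n) as m. simpl. rewrite Nat.eqb_refl. f_equal.
        apply csum_ext. intros j Hj. destruct (Nat.eqb_spec j m); [lia|reflexivity]. }
      split.
      * exists j0. split; [lia|]. destruct (Nat.eqb_spec j0 (S n)); [lia|assumption].
      * intros i Hi. rewrite Hs. unfold y.
        destruct (Nat.eq_dec i p) as [->|Hip].
        -- field. assumption.
        -- assert (Hq : exists i', (i' < n)%nat /\ q i' = i).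
           { unfold q. destruct (Nat.lt_ge_cases i p).
             - exists i. split; [lia|]. destruct (Nat.ltb_spec i p); lia.
             - exists (pred i). split; [lia|]. destruct (Nat.ltb_spec (pred i) p); lia. }
           destruct Hq as [i' [Hi' <-]].
           specialize (Hx i' Hi').
           transitivity (csum (S n) (fun j =>
             ((a (q i') j - a (q i') (S n) / a p (S n) * a p j) * x j)%C)); [|exact Hx].
           transitivity (csum (S n) (fun j => (a (q i') j * x j
             + (- (a (q i') (S n) / a p (S n))) * (a p j * x j))%C)).
           ++ rewrite csum_plus, csum_scal. field. assumption.
           ++ apply csum_ext. intros j _. ring.
    + exists (fun j => if Nat.eqb j (S n) then RtoC 1 else RtoC 0). split.
      * exists (S n). split; [lia|]. rewrite Nat.eqb_refl. exact C1_neq_0.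
      * intros i Hi. apply csum_zero. intros j Hj.
        destruct (Nat.eqb_spec j (S n)) as [->|]; [|ring].
        destruct (classic (a i (S n) = RtoC 0)) as [->|H]; [ring|].
        exfalso; apply Hz; eauto.
Qed.

(** The right-hand side becomes an extra column. The enlarged homogeneous system has a nonzero
    solution; its last entry cannot vanish, by injectivity, and dividing by it solves the given
    system. *)
Lemma injective_system_solvable (n : nat) (a : nat -> nat -> C) (e : nat -> C) :
  (forall x, (forall i, (i < n)%nat -> csum n (fun j => (a i j * x j)%C) = RtoC 0) ->
     forall i, (i < n)%nat -> x i = RtoC 0) ->
  exists x, forall i, (i < n)%nat -> csum n (fun j => (a i j * x j)%C) = e i.
Proof.
  intros Hinj.
  destruct (underdetermined_system n (fun i j => if Nat.eqb j n then (- e i)%C else a i j))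
    as [x [[j0 [Hj0 Hx0]] Hx]].
  assert (Hx' : forall i, (i < n)%nat -> csum n (fun j => (a i j * x j)%C) = (x n * e i)%C).
  { intros i Hi. specialize (Hx i Hi). simpl in Hx. rewrite Nat.eqb_refl in Hx.
    rewrite (csum_ext n _ (fun j => (a i j * x j)%C)) in Hx.
    - replace (csum n (fun j => (a i j * x j)%C))
        with ((csum n (fun j => (a i j * x j)%C) + - e i * x n) + x n * e i)%C by ring.
      rewrite Hx. ring.
    - intros j Hj. destruct (Nat.eqb_spec j n); [lia|reflexivity]. }
  assert (Hn : x n <> RtoC 0).
  { intros Hn. apply Hx0. destruct (Nat.eq_dec j0 n) as [->|]; [assumption|].
    apply Hinj; [|lia]. intros i Hi. rewrite Hx' by assumption. rewrite Hn. ring. }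
  exists (fun j => (/ x n * x j)%C). intros i Hi.
  rewrite (csum_ext n _ (fun j => (/ x n * (a i j * x j))%C)) by (intros; ring).
  rewrite csum_scal, Hx' by assumption. field. assumption.
Qed.

(** Solving for the unit vectors gives the columns [X l] of the inverse matrix; the bound is [n]
    times a bound of its entries. *)
Lemma injective_system_bounded_inverse (n : nat) (a : nat -> nat -> C) :
  (forall x, (forall i, (i < n)%nat -> csum n (fun j => (a i j * x j)%C) = RtoC 0) ->
     forall i, (i < n)%nat -> x i = RtoC 0) ->
  exists M, 0 <= M /\ forall e E, (forall i, (i < n)%nat -> Cmod (e i) <= E) ->
    exists x, (forall i, (i < n)%nat -> csum n (fun j => (a i j * x j)%C) = e i) /\
              (forall i, (i < n)%nat -> Cmod (x i) <= M * E).
Proof.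
  intros Hinj.
  assert (HX : forall l, exists x, forall i, (i < n)%nat ->
    csum n (fun j => (a i j * x j)%C) = if Nat.eqb i l then RtoC 1 else RtoC 0).
  { intros l. now apply injective_system_solvable. }
  destruct (choice _ HX) as [X HX'].
  assert (HM : exists M, 0 <= M /\ forall l, (l < n)%nat -> forall i, (i < n)%nat -> Cmod (X l i) <= M).
  { apply (uniform_constant (fun l => (l < n)%nat)
      (fun l M => forall i, (i < n)%nat -> Cmod (X l i) <= M) n); [lia| |].
    - intros l M M' H HMM i Hi. specialize (H i Hi). lra.
    - intros l _. apply (uniform_constant (fun i => (i < n)%nat) (fun i M => Cmod (X l i) <= M) n); [lia| |].
      + intros; lra.
      + intros i _. exists (Cmod (X l i)). split; [apply Cmod_ge_0|lra]. }
  destruct HM as [M [HM0 HM]].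
  exists (INR n * M). split; [apply Rmult_le_pos; [apply pos_INR|assumption]|].
  intros e E He.
  exists (fun j => csum n (fun l => (e l * X l j)%C)). split.
  - intros i Hi.
    rewrite (csum_ext n _ (fun j => csum n (fun l => (e l * (a i j * X l j))%C))).
    + rewrite csum_swap.
      rewrite (csum_ext n _ (fun l => (e l * (if Nat.eqb i l then RtoC 1 else RtoC 0))%C)).
      * rewrite (csum_single n _ i); [rewrite Nat.eqb_refl; ring|assumption|].
        intros l Hl Hli. destruct (Nat.eqb_spec i l); [congruence|ring].
      * intros l Hl. rewrite csum_scal. now rewrite HX'.
    + intros j Hj. rewrite <- csum_scal. apply csum_ext. intros l Hl. ring.
  - intros i Hi. rewrite Rmult_assoc. apply csum_bound. intros l Hl.
    rewrite Cmod_mult, (Rmult_comm M).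
    apply Rmult_le_compat; try apply Cmod_ge_0; auto.
Qed.

(** * The second-kind equation on continuous periodic functions *)

Lemma half_pow_pos n : 0 < (/ 2) ^ n.
Proof. apply pow_lt; lra. Qed.

Lemma half_pow_small (G e : R) : 0 < e -> exists n, G * (/ 2) ^ n < e.
Proof.
  intros He.
  destruct (pow_lt_1_zero (/ 2)) with (y := e / (Rabs G + 1)) as [N HN].
  - rewrite Rabs_pos_eq; lra.
  - pose proof (Rabs_pos G). apply Rdiv_lt_0_compat; lra.
  - exists N. specialize (HN N (le_n _)). rewrite Rabs_pos_eq in HN by (left; apply half_pow_pos).
    pose proof (Rabs_pos G). pose proof (RRle_abs G). pose proof (half_pow_pos N).
    apply Rle_lt_trans with ((Rabs G + 1) * (/ 2) ^ N); [nra|].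
    replace e with ((Rabs G + 1) * (e / (Rabs G + 1))) by (field; lra).
    apply Rmult_lt_compat_l; lra.
Qed.

Lemma real_geometric_limit (z : nat -> R) (G : R) :
  (forall n m, (n <= m)%nat -> Rabs (z m - z n) <= G * (/ 2) ^ n) ->
  exists l, forall n, Rabs (z n - l) <= G * (/ 2) ^ n.
Proof.
  intros H.
  assert (Hc : Cauchy_crit z).
  { intros e He. destruct (half_pow_small (2 * G) e He) as [N HN]. exists N.
    intros n m Hn Hm. unfold Rdist.
    replace (z n - z m) with ((z n - z N) - (z m - z N)) by ring.
    apply Rle_lt_trans with (1 := Rabs_triang _ _). rewrite Rabs_Ropp.
    pose proof (H N n ltac:(lia)). pose proof (H N m ltac:(lia)). lra. }
  destruct (Rcomplete.R_complete z Hc) as [l Hl]. exists l. intros n.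
  apply le_epsilon. intros e He. destruct (Hl e He) as [N HN].
  pose proof (HN (Nat.max n N) ltac:(lia)) as H1. pose proof (H n (Nat.max n N) ltac:(lia)) as H2.
  unfold Rdist in H1. rewrite Rabs_minus_sym in H2.
  replace (z n - l) with ((z n - z (Nat.max n N)) + (z (Nat.max n N) - l)) by ring.
  apply Rle_trans with (1 := Rabs_triang _ _). lra.
Qed.

(** Completeness of C with an explicit rate. The factor 2 comes from bounding the modulus by the sum
    of the absolute values of the two coordinates. *)
Lemma geometric_limit (z : nat -> C) (G : R) :
  (forall n m, (n <= m)%nat -> Cmod (z m - z n)%C <= G * (/ 2) ^ n) ->
  exists l, forall n, Cmod (z n - l)%C <= 2 * G * (/ 2) ^ n.
Proof.
  intros H.
  destruct (real_geometric_limit (fun n => fst (z n)) G) as [l1 H1].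
  { intros n m Hnm. apply Rle_trans with (2 := H n m Hnm). apply (Rabs_fst_le (z m - z n)%C). }
  destruct (real_geometric_limit (fun n => snd (z n)) G) as [l2 H2].
  { intros n m Hnm. apply Rle_trans with (2 := H n m Hnm). apply (Rabs_snd_le (z m - z n)%C). }
  exists (l1, l2). intros n. apply Rle_trans with (1 := Cmod_le_abs _).
  specialize (H1 n). specialize (H2 n).
  simpl. unfold Rminus in *. lra.
Qed.

Lemma CP_uniform_limit u :
  (forall e, 0 < e -> exists v, CP v /\ forall x, Cmod (u x - v x)%C <= e) -> CP u.
Proof.
  intros H. split.
  - intros x. apply Clim_locally_iff. intros e He.
    destruct (H (e / 4) ltac:(lra)) as [v [[Hv _] Huv]].
    destruct (proj1 (Clim_locally_iff _ _ _) (Hv x) (e / 4) ltac:(lra)) as [d [Hd0 Hd]].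
    exists d. split; [assumption|]. intros y Hy.
    replace (u y - u x)%C with ((u y - v y) + ((v y - v x) + (v x - u x)))%C by ring.
    apply Rle_lt_trans with (1 := Cmod_triangle _ _).
    pose proof (Cmod_triangle (v y - v x) (v x - u x)).
    pose proof (Huv y). pose proof (Huv x) as Hx. rewrite Cmod_sub_sym in Hx. specialize (Hd y Hy). lra.
  - intros x.
    assert (Hz : (u (x + 2 * PI)%R - u x)%C = RtoC 0).
    { apply Cmod_small_0. intros e He.
      destruct (H (e / 2) ltac:(lra)) as [v [[_ Pv] Huv]].
      apply Rle_trans with (1 := Cmod_sub_triangle _ (v x) _).
      pose proof (Huv (x + 2 * PI)) as H1. rewrite Pv in H1.
      pose proof (Huv x) as H2. rewrite Cmod_sub_sym in H2. lra. }
    replace (u x) with ((u (x + 2 * PI)%R - u x) + u x)%C at 1 by (rewrite Hz; ring). ring.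
Qed.

(** The [U n] are the partial sums of the Neumann series. Their increments are halved at each step,
    so they converge uniformly; the bound [2 * G] reproduces itself because
    [G + 2 * G / 2 = 2 * G]. *)
Lemma neumann_solution (T : (R -> C) -> R -> C)
  (TCP : forall u, CP u -> CP (T u))
  (Tsub : forall u v, CP u -> CP v -> forall x, T (fun y => (u y - v y)%C) x = (T u x - T v x)%C)
  (Thalf : forall u B, CP u -> bnd u B -> bnd (T u) (B / 2)) :
  forall g G, CP g -> bnd g G ->
    exists u, CP u /\ (forall x, (u x - T u x)%C = g x) /\ bnd u (2 * G).
Proof.
  intros g G Hg HG.
  set (U := fix U n := match n with O => g | S n => fun x => (g x + T (U n) x)%C end).
  assert (UCP : forall n, CP (U n)).
  { induction n; simpl; [assumption|]. apply CP_plus; auto. }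
  assert (G0 : 0 <= G) by (apply Rle_trans with (2 := HG 0); apply Cmod_ge_0).
  assert (Ubnd : forall n, bnd (U n) (2 * G)).
  { induction n; intros x; simpl.
    - apply Rle_trans with (1 := HG x). lra.
    - apply Rle_trans with (1 := Cmod_triangle _ _).
      pose proof (HG x). pose proof (Thalf _ _ (UCP n) IHn x). simpl in *. lra. }
  assert (Dbnd : forall n, bnd (fun x => (U (S n) x - U n x)%C) (G * (/ 2) ^ (S n))).
  { induction n; intros x.
    - simpl. replace (g x + T g x - g x)%C with (T g x) by ring.
      pose proof (Thalf g G Hg HG x). lra.
    - change (U (S (S n)) x) with (g x + T (U (S n)) x)%C.
      change (U (S n) x) with (g x + T (U n) x)%C at 1.
      replace (g x + T (U (S n)) x - (g x + T (U n) x))%C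
        with (T (U (S n)) x - T (U n) x)%C by ring.
      rewrite <- Tsub by auto.
      pose proof (Thalf _ _ (CP_minus _ _ (UCP (S n)) (UCP n)) IHn x) as H.
      simpl in H |- *. simpl. lra. }
  assert (Cau : forall x n m, (n <= m)%nat -> Cmod (U m x - U n x)%C <= G * (/ 2) ^ n).
  { intros x n m Hnm.
    (* The sharper, telescoping bound is the one that survives the induction on [m]. *)
    assert (H : Cmod (U m x - U n x)%C <= G * (/ 2) ^ n - G * (/ 2) ^ m).
    { induction Hnm.
      - replace (U n x - U n x)%C with (RtoC 0) by ring. rewrite Cmod_0. lra.
      - apply Rle_trans with (1 := Cmod_sub_triangle _ (U m x) _).
        pose proof (Dbnd m x). simpl in H |- *. lra. }
    pose proof (half_pow_pos m). nra. }
  destruct (choice _ (fun x => geometric_limit (fun n => U n x) G (Cau x))) as [u Hu].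
  assert (uCP : CP u).
  { apply CP_uniform_limit. intros e He. destruct (half_pow_small (2 * G) e He) as [n Hn].
    exists (U n). split; [apply UCP|]. intros x. rewrite Cmod_sub_sym. specialize (Hu x n). lra. }
  exists u. split; [assumption|]. split.
  - intros x.
    assert (Hz : (u x - T u x - g x)%C = RtoC 0).
    { apply Cmod_small_0. intros e He. destruct (half_pow_small (2 * G) e He) as [n Hn].
      replace (u x - T u x - g x)%C with ((T (U n) x - T u x) - (g x + T (U n) x - u x))%C by ring.
      apply Rle_trans with (1 := Cmod_sub_le _ _).
      rewrite <- Tsub by auto.
      pose proof (Hu x (S n)) as H1. change (U (S n) x) with (g x + T (U n) x)%C in H1.
      assert (H2 : bnd (fun y => (U n y - u y)%C) (2 * G * (/ 2) ^ n)) by (intros y; apply Hu).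
      pose proof (Thalf _ _ (CP_minus _ _ (UCP n) uCP) H2 x) as H3.
      simpl in H1, H3. lra. }
    replace (u x - T u x)%C with ((u x - T u x - g x) + g x)%C by ring. rewrite Hz. ring.
  - intros x. apply le_epsilon. intros e He. destruct (half_pow_small (2 * G) e He) as [n Hn].
    pose proof (Cmod_diff_le (u x) (U n x)) as H. rewrite Cmod_sub_sym in H.
    specialize (Hu x n). pose proof (Ubnd n x). lra.
Qed.

(* A smoothing operator [A] is the sum of a contraction and of the finite rank operator [Q A],
   [Q] being a sampling operator; inverting the contraction reduces the equation to a square
   linear system, which is injective because [ker (I - A)] is trivial. *)
Lemma fredholm_alternative (A : (R -> C) -> R -> C) (M mu : R)
  (Hmu : 0 < mu)
  (Alin : forall u v a, CP u -> CP v ->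
     forall x, A (fun y => (u y + a * v y)%C) x = (A u x + a * A v x)%C)
  (Abnd : forall u B, CP u -> bnd u B -> bnd (A u) (M * B))
  (Ahold : forall u B, CP u -> bnd u B -> holder everywhere mu (M * B) (A u))
  (ACP : forall u, CP u -> CP (A u))
  (Ker : forall u, CP u -> (forall x, u x = A u x) -> forall x, u x = RtoC 0)
  (Samp : forall e, 0 < e -> exists n (X : nat -> R) (b : nat -> R -> C),
     (forall i, (i < n)%nat -> CP (b i) /\ bnd (b i) 1) /\
     forall v H, CP v -> holder everywhere mu H v ->
       forall x, Cmod (v x - csum n (fun i => (v (X i) * b i x)%C))%C <= e * H) :
  exists K, 0 <= K /\ forall g G, CP g -> bnd g G ->
    exists u, CP u /\ (forall x, (u x - A u x)%C = g x) /\ bnd u (K * G).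
Proof.
  (* [Abnd] for the zero function with bound 1 forces the sign of [M]. *)
  assert (M0 : 0 <= M).
  { pose proof (Abnd (fun _ => RtoC 0) 1 CP_zero) as H.
    assert (H1 : bnd (fun _ => RtoC 0) 1) by (intros x; rewrite Cmod_0; lra).
    specialize (H H1 0). pose proof (Cmod_ge_0 (A (fun _ => RtoC 0) 0)). lra. }
  (* This accuracy makes the norm of [T = A - Q A] at most [M / (2 * (M + 1))], hence at most
     1/2. *)
  destruct (Samp (/ (2 * (M + 1)))) as [n [X [b [Hb HQ]]]].
  { apply Rinv_0_lt_compat. lra. }
  set (T := fun u x => (A u x - csum n (fun i => (A u (X i) * b i x)%C))%C).
  assert (TCP : forall u, CP u -> CP (T u)).
  { intros u Hu. apply CP_minus; auto. apply CP_csum. intros i Hi. now apply Hb. }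
  assert (Tlin : forall u v a, CP u -> CP v -> forall x,
    T (fun y => (u y + a * v y)%C) x = (T u x + a * T v x)%C).
  { intros u v a Hu Hv x. unfold T. rewrite Alin by assumption.
    rewrite (csum_ext n _ (fun i => (A u (X i) * b i x + a * (A v (X i) * b i x))%C)).
    - rewrite csum_plus, csum_scal. ring.
    - intros i _. rewrite Alin by assumption. ring. }
  assert (Thalf : forall u B, CP u -> bnd u B -> bnd (T u) (B / 2)).
  { intros u B Hu HB x. unfold T.
    assert (B0 : 0 <= B) by (apply Rle_trans with (2 := HB 0); apply Cmod_ge_0).
    eapply Rle_trans; [apply (HQ (A u) (M * B)); auto|].
    apply Rmult_le_reg_l with (2 * (M + 1)); [lra|].
    rewrite <- Rmult_assoc, Rinv_r by lra. nra. }
  assert (Sol := neumann_solution T TCP).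
  specialize (Sol ltac:(intros u v Hu Hv x;
    replace (fun y => (u y - v y)%C) with (fun y => (u y + (- RtoC 1) * v y)%C)
      by (apply functional_extensionality; intros; ring);
    rewrite Tlin by assumption; ring) Thalf).
  (* [b' i] solves [v - T v = b i]. A solution of the full equation is sought as
     [g' + sum z_j b'_j], where [g' - T g' = g] and the unknowns [z_i] stand for the samples
     [A u (X i)]. *)
  assert (Hb' : forall i, exists v, (i < n)%nat ->
    CP v /\ (forall x, (v x - T v x)%C = b i x) /\ bnd v (2 * 1)).
  { intros i. destruct (Nat.lt_ge_cases i n) as [Hi|Hi].
    - destruct (Sol (b i) 1) as [v Hv]; try apply Hb; auto. exists v; auto.
    - exists (b i). intros; lia. }
  destruct (choice _ Hb') as [b' Hb'2]. clear Hb'.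
  assert (CPs : forall (z : nat -> C) m, (m <= n)%nat -> CP (fun x => csum m (fun j => (z j * b' j x)%C))).
  { intros z m Hm. apply CP_csum. intros i Hi. apply Hb'2. lia. }
  (* Linearity for finite combinations, stated for an arbitrary [L] because both [A] and [T] are
     needed. *)
  assert (Asum : forall L : (R -> C) -> R -> C,
    (forall u v a, CP u -> CP v -> forall x, L (fun y => (u y + a * v y)%C) x = (L u x + a * L v x)%C) ->
    forall g (z : nat -> C), CP g -> forall x m, (m <= n)%nat ->
      L (fun y => (g y + csum m (fun j => z j * b' j y))%C) x
      = (L g x + csum m (fun j => z j * L (b' j) x))%C).
  { intros L Llin g z Hg x. induction m; intros Hm; simpl.
    - replace (fun y => (g y + RtoC 0)%C) with g by (apply functional_extensionality; intros; ring). ring.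
    - replace (fun y => (g y + (csum m (fun j => z j * b' j y) + z m * b' m y))%C)
        with (fun y => ((g y + csum m (fun j => z j * b' j y)) + z m * b' m y)%C)
        by (apply functional_extensionality; intros; ring).
      rewrite Llin.
      + rewrite IHm by lia. ring.
      + apply CP_plus; auto. apply CPs. lia.
      + apply Hb'2. lia. }
  (* By construction [u - T u = g + sum z_j b_j]. The linear system says [z_i = A u (X i)], so the
     sum is exactly the part of [A u] missing from [T u], and [u - A u = g] remains. *)
  assert (Key : forall g g' z, CP g' -> (forall x, (g' x - T g' x)%C = g x) ->
    (forall i, (i < n)%nat ->
       (z i - csum n (fun j => z j * A (b' j) (X i)))%C = A g' (X i)) ->
    let u := fun y => (g' y + csum n (fun j => z j * b' j y))%C in
    CP u /\ (forall i, (i < n)%nat -> A u (X i) = z i) /\ forall x, (u x - A u x)%C = g x).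
  { intros g g' z Hg' Hg Hz u.
    assert (Hu : CP u) by (apply CP_plus; auto).
    assert (HAz : forall i, (i < n)%nat -> A u (X i) = z i).
    { intros i Hi. unfold u. rewrite (Asum A Alin) by auto. rewrite <- Hz by assumption. ring. }
    split; [assumption|]. split; [assumption|]. intros x.
    assert (HT : T u x = (T g' x + csum n (fun j => z j * T (b' j) x))%C)
      by (apply (Asum T Tlin); auto).
    assert (HT' : T u x = (A u x - csum n (fun i => z i * b i x))%C).
    { unfold T. rewrite (csum_ext n (fun i => (A u (X i) * b i x)%C) (fun i => (z i * b i x)%C));
        [reflexivity|]. intros i Hi. now rewrite HAz. }
    assert (Hbs : csum n (fun i => (z i * b i x)%C)
      = (csum n (fun i => (z i * b' i x)%C) + (- RtoC 1) * csum n (fun i => z i * T (b' i) x))%C).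
    { rewrite <- csum_scal, <- csum_plus. apply csum_ext. intros i Hi.
      destruct (Hb'2 i Hi) as [_ [H _]]. rewrite <- H. ring. }
    replace (A u x) with (T u x + csum n (fun i => z i * b i x))%C by (rewrite HT'; ring).
    rewrite HT, Hbs. unfold u. rewrite <- Hg. ring. }
  destruct (injective_system_bounded_inverse n
    (fun i j => ((if Nat.eqb i j then RtoC 1 else RtoC 0) - A (b' j) (X i))%C)) as [Mi [Mi0 HMi]].
  (* A null vector [z] yields, with [g = g' = 0], a function [u = A u]. It vanishes by [Ker], and
     then so do the samples [z_i = A u (X i)]. *)
  { intros z Hz.
    destruct (Key (fun _ => RtoC 0) (fun _ => RtoC 0) z CP_zero) as [Hu [HAz Hu0]].
    - intros x. assert (H : bnd (T (fun _ => RtoC 0)) (0 / 2)).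
      { apply Thalf; [apply CP_zero|]. intros y. rewrite Cmod_0. lra. }
      specialize (H x). assert (H0 : T (fun _ => RtoC 0) x = RtoC 0).
      { apply Cmod_eq_0. pose proof (Cmod_ge_0 (T (fun _ => RtoC 0) x)). lra. }
      rewrite H0. ring.
    - intros i Hi.
      assert (H : bnd (A (fun _ => RtoC 0)) (M * 0)).
      { apply Abnd; [apply CP_zero|]. intros y. rewrite Cmod_0. lra. }
      specialize (H (X i)). rewrite Rmult_0_r in H.
      replace (A (fun _ => RtoC 0) (X i)) with (RtoC 0)
        by (symmetry; apply Cmod_eq_0; pose proof (Cmod_ge_0 (A (fun _ => RtoC 0) (X i))); lra).
      rewrite <- (Hz i Hi).
      rewrite (csum_ext n (fun j => (((if Nat.eqb i j then RtoC 1 else RtoC 0) - A (b' j) (X i)) * z j)%C)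
        (fun j => ((if Nat.eqb i j then RtoC 1 else RtoC 0) * z j + (- RtoC 1) * (z j * A (b' j) (X i)))%C))
        by (intros; ring).
      rewrite csum_plus, csum_scal.
      rewrite (csum_single n (fun j => ((if Nat.eqb i j then RtoC 1 else RtoC 0) * z j)%C) i Hi); [rewrite Nat.eqb_refl; ring|].
      intros j Hj Hij. destruct (Nat.eqb_spec i j); [congruence|ring].
    - set (u := fun y => (RtoC 0 + csum n (fun j => z j * b' j y))%C) in *.
      assert (Hz0 : forall x, u x = RtoC 0).
      { apply Ker; [assumption|]. intros x.
        assert (H0 : (u x - A u x)%C = RtoC 0) by apply Hu0.
        replace (u x) with ((u x - A u x) + A u x)%C by ring. rewrite H0. ring. }
      intros i Hi. rewrite <- (HAz i Hi).
      transitivity (u (X i)); [|apply Hz0].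
      assert (H0 : (u (X i) - A u (X i))%C = RtoC 0) by apply Hu0.
      replace (A u (X i)) with (u (X i) - (u (X i) - A u (X i)))%C by ring. rewrite H0. ring. }
  (* The 2 bounds [g']; each of the [n] terms [z_j b'_j] has [z_j] bounded by [Mi * (M * (2 * G))]
     and [b'_j] by 2. *)
  exists (2 + INR n * (Mi * (M * 2) * 2)). split.
  { pose proof (pos_INR n). assert (0 <= Mi * (M * 2) * 2) by (assert (0 <= Mi * (M * 2)) by nra; lra). nra. }
  intros g G Hg HG.
  assert (G0 : 0 <= G) by (apply Rle_trans with (2 := HG 0); apply Cmod_ge_0).
  destruct (Sol g G Hg HG) as [g' [Hg' [Hgg' Hg'b]]].
  destruct (HMi (fun i => A g' (X i)) (M * (2 * G))) as [z [Hz Hzb]].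
  { intros i Hi. now apply Abnd. }
  destruct (Key g g' z Hg' Hgg') as [Hu [HAz Hu0]].
  - intros i Hi. rewrite <- (Hz i Hi).
    rewrite (csum_ext n (fun j => (((if Nat.eqb i j then RtoC 1 else RtoC 0) - A (b' j) (X i)) * z j)%C)
        (fun j => ((if Nat.eqb i j then RtoC 1 else RtoC 0) * z j + (- RtoC 1) * (z j * A (b' j) (X i)))%C))
        by (intros; ring).
    rewrite csum_plus, csum_scal.
    rewrite (csum_single n (fun j => ((if Nat.eqb i j then RtoC 1 else RtoC 0) * z j)%C) i Hi); [rewrite Nat.eqb_refl; ring|].
    intros j Hj Hij. destruct (Nat.eqb_spec i j); [congruence|ring].
  - exists (fun y => (g' y + csum n (fun j => z j * b' j y))%C).
    split; [assumption|]. split; [assumption|].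
    intros x. apply Rle_trans with (1 := Cmod_triangle _ _).
    assert (H : Cmod (csum n (fun j => (z j * b' j x)%C)) <= INR n * (Mi * (M * (2 * G)) * (2 * 1))).
    { apply csum_bound. intros j Hj. rewrite Cmod_mult.
      apply Rmult_le_compat; try apply Cmod_ge_0; auto. apply (Hb'2 j Hj). }
    specialize (Hg'b x). replace ((2 + INR n * (Mi * (M * 2) * 2)) * G)
      with (2 * G + INR n * (Mi * (M * (2 * G)) * (2 * 1))) by ring. lra.
Qed.

(** * Reduction modulo the period, boundedness and absorption *)

Lemma floor_exists (x : R) : exists p : Z, IZR p <= x < IZR p + 1.
Proof.
  exists (Int_part x). destruct (base_Int_part x) as [H1 H2]. lra.
Qed.

Lemma periodic_IZR (u : R -> C) : (forall x, u (x + 2 * PI) = u x) ->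
  forall (k : Z) x, u (x + 2 * PI * IZR k) = u x.
Proof.
  intros H.
  assert (Hn : forall (n : nat) x, u (x + 2 * PI * INR n) = u x).
  { induction n; intros x; [f_equal; simpl; ring|].
    rewrite S_INR. replace (x + 2 * PI * (INR n + 1)) with ((x + 2 * PI * INR n) + 2 * PI) by ring.
    now rewrite H. }
  intros k x. destruct (Z_le_gt_dec 0 k) as [Hk|Hk].
  - rewrite <- (Z2Nat.id k Hk), <- INR_IZR_INZ. apply Hn.
  - rewrite <- (Hn (Z.to_nat (- k)) (x + 2 * PI * IZR k)). f_equal.
    rewrite INR_IZR_INZ, Z2Nat.id, opp_IZR by lia. ring.
Qed.

Lemma period_reduction (a x : R) : exists k : Z, a <= x + 2 * PI * IZR k < a + 2 * PI.
Proof.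
  pose proof PI_RGT_0 as HP.
  destruct (floor_exists ((x - a) / (2 * PI))) as [p [H1 H2]].
  exists (- p)%Z. rewrite opp_IZR.
  assert (E : x - a = 2 * PI * ((x - a) / (2 * PI))) by (field; lra).
  split; nra.
Qed.

Lemma CP_bounded u : CP u -> exists B, 0 <= B /\ bnd u B.
Proof.
  intros [Hc Hp].
  assert (HP := PI_RGT_0).
  destruct (continuity_ab_maj (fun x => Cmod (u x)) 0 (2 * PI)) as [xm [Hm _]].
  - lra.
  - intros x _. intros e He.
    destruct (proj1 (Clim_locally_iff _ _ _) (Hc x) e He) as [d [Hd0 Hd]].
    exists d. split; [assumption|]. intros y [_ Hy]. simpl in *. unfold Rdist in *.
    apply Rle_lt_trans with (2 := Hd y Hy).
    pose proof (Cmod_diff_le (u y) (u x)). pose proof (Cmod_diff_le (u x) (u y)) as H2.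
    rewrite (Cmod_sub_sym (u x)) in H2. apply Rabs_le. lra.
  - exists (Cmod (u xm)). split; [apply Cmod_ge_0|]. intros x.
    destruct (period_reduction 0 x) as [k Hk].
    rewrite <- (periodic_IZR u Hp k x). apply Hm. lra.
Qed.

(** Iterating the improvement [B] to [B / 2 + K] drives any finite initial bound to its fixed point
    [2 * K]; [B0] leaves no trace in the result. This serves both diagonal dominance and the
    collocation error. *)
Lemma absorb_half {X : Type} (u : X -> R) K B0 : (forall x, u x <= B0) ->
  (forall B, (forall x, u x <= B) -> forall x, u x <= B / 2 + K) -> forall x, u x <= 2 * K.
Proof.
  intros H0 H.
  assert (Hn : forall n x, u x <= B0 * (/ 2) ^ n + 2 * K - 2 * K * (/ 2) ^ n).
  { induction n.
    - intros x. simpl. specialize (H0 x). lra.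
    - intros x. specialize (H _ IHn x). simpl. lra. }
  intros x. apply le_epsilon. intros e He.
  destruct (half_pow_small (B0 - 2 * K) e He) as [n Hn']. specialize (Hn n x). lra.
Qed.

(** * B-splines *)

Fixpoint rsum (n : nat) (f : nat -> R) : R :=
  match n with
  | O => 0
  | S n => rsum n f + f n
  end.

Lemma rsum_ext n f g : (forall i, (i < n)%nat -> f i = g i) -> rsum n f = rsum n g.
Proof.
  induction n; intros H; simpl; [reflexivity|].
  rewrite IHn by (intros; apply H; lia). now rewrite H by lia.
Qed.

Lemma rsum_zero n f : (forall i, (i < n)%nat -> f i = 0) -> rsum n f = 0.
Proof.
  induction n; intros H; simpl; [reflexivity|].
  rewrite IHn by (intros; apply H; lia). rewrite H by lia. ring.
Qed.

Lemma rsum_single n f i : (i < n)%nat ->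
  (forall j, (j < n)%nat -> j <> i -> f j = 0) -> rsum n f = f i.
Proof.
  induction n; intros Hi H; [lia|]. simpl.
  destruct (Nat.eq_dec i n) as [->|Hin].
  - rewrite rsum_zero by (intros; apply H; lia). ring.
  - rewrite IHn by (try lia; intros; apply H; lia). rewrite (H n) by lia. ring.
Qed.

Lemma rsum_RtoC n f : RtoC (rsum n f) = csum n (fun i => RtoC (f i)).
Proof. induction n; simpl; [reflexivity|]. now rewrite RtoC_plus, IHn. Qed.

Definition integrable (f : R -> R) : Prop := forall a b, ex_RInt f a b.

Lemma integrable_shift f (c : R) : integrable f -> integrable (fun t => f (t - c)).
Proof.
  intros H a b.
  apply ex_RInt_ext with (fun t => scal 1 (f (1 * t + - c))).
  - intros t _. unfold scal; simpl; unfold mult; simpl. rewrite Rmult_1_l. f_equal. ring.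
  - apply (ex_RInt_comp_lin f 1 (- c)). apply H.
Qed.

Lemma integrable_rsum n (f : nat -> R -> R) : (forall i, integrable (f i)) ->
  integrable (fun t => rsum n (fun i => f i t)).
Proof.
  intros H. induction n; intros a b; simpl.
  - apply ex_RInt_const.
  - apply (ex_RInt_plus (V := R_NormedModule)); [apply IHn|apply H].
Qed.

Lemma RInt_rsum n (f : nat -> R -> R) a b : (forall i, integrable (f i)) ->
  RInt (fun t => rsum n (fun i => f i t)) a b = rsum n (fun i => RInt (f i) a b).
Proof.
  intros H. induction n; simpl.
  - rewrite RInt_const. unfold scal; simpl; unfold mult; simpl. ring.
  - rewrite (RInt_plus (V := R_CompleteNormedModule)).
    + unfold plus; simpl. now rewrite IHn.
    + now apply integrable_rsum.
    + apply H.
Qed.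

Lemma RInt_translate f (c a b : R) : integrable f ->
  RInt (fun t => f (t - c)) a b = RInt f (a - c) (b - c).
Proof.
  intros H.
  transitivity (RInt (fun t => scal 1 (f (1 * t + - c))) a b).
  - apply RInt_ext. intros t _. unfold scal; simpl; unfold mult; simpl. rewrite Rmult_1_l. f_equal. ring.
  - rewrite (RInt_comp_lin f 1 (- c)) by apply H. f_equal; ring.
Qed.

Lemma RInt_piece (f : R -> R) a b v : a <= b -> (forall t, a < t < b -> f t = v) ->
  is_RInt f a b (v * (b - a)).
Proof.
  intros Hab H. replace (v * (b - a)) with (scal (V := R_NormedModule) (b - a) v)
    by (unfold scal; simpl; unfold mult; simpl; ring).
  apply is_RInt_ext with (fun _ => v).
  - intros t. rewrite Rmin_left, Rmax_right by assumption. intros Ht. symmetry; auto.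
  - apply is_RInt_const.
Qed.

Lemma is_RInt_Chasles_real (f : R -> R) a b c l1 l2 :
  is_RInt f a b l1 -> is_RInt f b c l2 -> is_RInt f a c (l1 + l2).
Proof. exact (is_RInt_Chasles (V := R_NormedModule) f a b c l1 l2). Qed.

Lemma Nspline_1_in x : - (1 / 2) <= x < 1 / 2 -> Nspline 1 x = 1.
Proof.
  intros H. simpl. destruct (Rle_dec (- (1 / 2)) x); [|lra].
  destruct (Rlt_dec x (1 / 2)); lra.
Qed.

Lemma Nspline_1_out x : x < - (1 / 2) \/ 1 / 2 <= x -> Nspline 1 x = 0.
Proof.
  intros H. simpl. destruct (Rle_dec (- (1 / 2)) x); [|lra].
  destruct (Rlt_dec x (1 / 2)); lra.
Qed.

Lemma Nspline_1_integrable : integrable (Nspline 1).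
Proof.
  intros a b.
  (* A symmetric interval containing [a], [b] and the whole support, on which three constant pieces
     suffice. *)
  set (K := Rmax 1 (Rmax (Rabs a) (Rabs b))).
  assert (H1 : 1 <= K) by apply Rmax_l.
  assert (Ha : Rabs a <= K) by (eapply Rle_trans; [|apply Rmax_r]; apply Rmax_l).
  assert (Hb : Rabs b <= K) by (eapply Rle_trans; [|apply Rmax_r]; apply Rmax_r).
  assert (HK : ex_RInt (Nspline 1) (- K) K).
  { apply ex_RInt_Chasles with (- (1 / 2)).
    - eexists. apply RInt_piece with (v := 0); [lra|]. intros t Ht. apply Nspline_1_out. lra.
    - apply ex_RInt_Chasles with (1 / 2).
      + eexists. apply RInt_piece with (v := 1); [lra|]. intros t Ht. apply Nspline_1_in. lra.
      + eexists. apply RInt_piece with (v := 0); [lra|]. intros t Ht. apply Nspline_1_out. lra. }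
  assert (Hg : forall x y, - K <= x -> x <= y -> y <= K -> ex_RInt (Nspline 1) x y).
  { intros x y Hx Hxy Hy.
    apply (ex_RInt_Chasles_2 (Nspline 1) (- K)); [lra|].
    apply (ex_RInt_Chasles_1 (Nspline 1) _ _ K); [lra|assumption]. }
  apply Rabs_le_between in Ha. apply Rabs_le_between in Hb.
  destruct (Rle_dec a b).
  - apply Hg; lra.
  - apply ex_RInt_swap. apply Hg; lra.
Qed.

Lemma Nspline_S m x : (1 <= m)%nat -> Nspline (S m) x = RInt (Nspline m) (x - 1 / 2) (x + 1 / 2).
Proof. intros H. destruct m; [lia|]. reflexivity. Qed.

Lemma RInt_unit_interval_bounds f a b : integrable f -> (forall x, 0 <= f x <= 1) -> a <= b ->
  0 <= RInt f a b <= b - a.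
Proof.
  intros Hi Hf Hab. split.
  - apply RInt_ge_0; auto. intros; apply Hf.
  - replace (b - a) with (RInt (fun _ => 1) a b)
      by (rewrite RInt_const; unfold scal; simpl; unfold mult; simpl; ring).
    apply RInt_le; auto.
    + apply ex_RInt_const.
    + intros; apply Hf.
Qed.

(** The two windows differ by two intervals of length [Rabs (x - y)], over each of which the
    integral lies between 0 and that length. *)
Lemma moving_average_lipschitz f x y : integrable f -> (forall x, 0 <= f x <= 1) ->
  Rabs (RInt f (x - 1 / 2) (x + 1 / 2) - RInt f (y - 1 / 2) (y + 1 / 2)) <= 2 * Rabs (x - y).
Proof.
  intros Hi Hf.
  assert (Hw : forall x y, x <= y ->
    Rabs (RInt f (x - 1 / 2) (x + 1 / 2) - RInt f (y - 1 / 2) (y + 1 / 2)) <= 2 * (y - x)).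
  { intros u v Huv.
    pose proof (RInt_Chasles f (u - 1 / 2) (v - 1 / 2) (v + 1 / 2) (Hi _ _) (Hi _ _)) as H1.
    pose proof (RInt_Chasles f (u - 1 / 2) (u + 1 / 2) (v + 1 / 2) (Hi _ _) (Hi _ _)) as H2.
    unfold plus in H1, H2; simpl in H1, H2.
    pose proof (RInt_unit_interval_bounds f (u - 1 / 2) (v - 1 / 2) Hi Hf ltac:(lra)).
    pose proof (RInt_unit_interval_bounds f (u + 1 / 2) (v + 1 / 2) Hi Hf ltac:(lra)).
    apply Rabs_le. lra. }
  destruct (Rle_dec x y).
  - rewrite (Rabs_left1 (x - y)) by lra. specialize (Hw x y r). lra.
  - rewrite (Rabs_pos_eq (x - y)) by lra. rewrite Rabs_minus_sym.
    specialize (Hw y x ltac:(lra)). lra.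
Qed.

Lemma lipschitz_integrable f : (forall x y, Rabs (f x - f y) <= 2 * Rabs (x - y)) -> integrable f.
Proof.
  intros H a b. apply (ex_RInt_continuous (V := R_CompleteNormedModule)). intros x _.
  apply (filterlim_locally (U := R_UniformSpace)). intros e.
  assert (He : 0 < e / 2) by (pose proof (cond_pos e); lra).
  exists (mkposreal _ He). intros y Hy.
  unfold ball in *; simpl in *; unfold AbsRing_ball, abs, minus, plus, opp in *; simpl in *.
  apply Rle_lt_trans with (1 := H y x). unfold Rminus. lra.
Qed.

Lemma Nspline_basic m : (1 <= m)%nat ->
  integrable (Nspline m) /\ forall x, 0 <= Nspline m x <= 1.
Proof.
  induction 1 as [|m Hm [IHi IHb]].
  - split; [apply Nspline_1_integrable|]. intros x. simpl.
    destruct (Rle_dec (- (1 / 2)) x); [|lra]. destruct (Rlt_dec x (1 / 2)); lra.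
  - split.
    + apply lipschitz_integrable. intros x y. rewrite !Nspline_S by assumption.
      now apply moving_average_lipschitz.
    + intros x. rewrite Nspline_S by assumption.
      pose proof (RInt_unit_interval_bounds _ (x - 1 / 2) (x + 1 / 2) IHi IHb ltac:(lra)). lra.
Qed.

Lemma Nspline_lipschitz m x y : (2 <= m)%nat ->
  Rabs (Nspline m x - Nspline m y) <= 2 * Rabs (x - y).
Proof.
  intros Hm. destruct m as [|m]; [lia|]. rewrite !Nspline_S by lia.
  apply moving_average_lipschitz; now apply Nspline_basic; lia.
Qed.

Lemma Nspline_support_open m : (1 <= m)%nat -> forall x, INR m / 2 < Rabs x -> Nspline m x = 0.
Proof.
  induction 1 as [|m Hm IH]; intros x Hx.
  - apply Nspline_1_out. simpl in Hx. destruct (Rle_dec 0 x).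
    + right. rewrite Rabs_pos_eq in Hx; lra.
    + left. rewrite Rabs_left1 in Hx; lra.
  - rewrite Nspline_S by assumption. rewrite S_INR in Hx.
    pose proof (pos_INR m) as Hm0.
    transitivity (RInt (fun _ => 0) (x - 1 / 2) (x + 1 / 2)).
    + apply RInt_ext. intros t. rewrite Rmin_left, Rmax_right by lra. intros Ht.
      apply IH. destruct (Rle_dec 0 x).
      * rewrite (Rabs_pos_eq x) in Hx by lra. rewrite (Rabs_pos_eq t); lra.
      * rewrite (Rabs_left1 x) in Hx by lra. rewrite (Rabs_left1 t); lra.
    + rewrite RInt_const. unfold scal; simpl; unfold mult; simpl. ring.
Qed.

(** The endpoint is included from order 2 on, since the averaging integral ignores single points.
    For order 1 it is not: the half-open indicator equals 1 at - 1/2. *)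
Lemma Nspline_support m x : (2 <= m)%nat -> INR m / 2 <= Rabs x -> Nspline m x = 0.
Proof.
  intros Hm Hx. destruct m as [|m]; [lia|].
  rewrite Nspline_S by lia. rewrite S_INR in Hx.
  pose proof (pos_INR m) as Hm0.
  transitivity (RInt (fun _ => 0) (x - 1 / 2) (x + 1 / 2)).
  - apply RInt_ext. intros t. rewrite Rmin_left, Rmax_right by lra. intros Ht.
    apply Nspline_support_open; [lia|]. destruct (Rle_dec 0 x).
    + rewrite (Rabs_pos_eq x) in Hx by lra. rewrite (Rabs_pos_eq t); lra.
    + rewrite (Rabs_left1 x) in Hx by lra. rewrite (Rabs_left1 t); lra.
  - rewrite RInt_const. unfold scal; simpl; unfold mult; simpl. ring.
Qed.

(** The condition on [x] ensures that the translates by 4 or more vanish at [x]. It is stable under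
    induction: raising the order costs 1/2, exactly the radius of the averaging window. *)
Lemma Nspline_partition m : (1 <= m)%nat -> forall x, Rabs x + INR m / 2 < 4 ->
  rsum 7 (fun i => Nspline m (x - IZR (Z.of_nat i - 3))) = 1.
Proof.
  induction 1 as [|m Hm IH]; intros x Hx.
  - simpl INR in Hx.
    destruct (floor_exists (x + 1 / 2)) as [p [H1 H2]].
    assert (Hx' : Rabs x < 7 / 2) by lra. apply Rabs_lt_between in Hx'.
    assert (Hp : (-4 < p < 4)%Z).
    { split; apply lt_IZR; lra. }
    rewrite (rsum_single 7 _ (Z.to_nat (p + 3))).
    + apply Nspline_1_in. rewrite Z2Nat.id by lia.
      replace (p + 3 - 3)%Z with p by ring. lra.
    + lia.
    + intros j Hj Hjp. apply Nspline_1_out.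
      destruct (Z_lt_le_dec (Z.of_nat j - 3) p) as [Hl|Hl].
      * right. assert (IZR (Z.of_nat j - 3) <= IZR p - 1).
        { rewrite <- minus_IZR. apply IZR_le. lia. } lra.
      * left. assert (IZR p + 1 <= IZR (Z.of_nat j - 3)).
        { rewrite <- plus_IZR. apply IZR_le. lia. } lra.
  - destruct (Nspline_basic m Hm) as [Hi _]. rewrite S_INR in Hx.
    rewrite (rsum_ext 7 _ (fun i => RInt (fun t => Nspline m (t - IZR (Z.of_nat i - 3))) (x - 1 / 2) (x + 1 / 2))).
    + rewrite <- RInt_rsum by (intros; now apply integrable_shift).
      transitivity (RInt (fun _ => 1) (x - 1 / 2) (x + 1 / 2)).
      * apply RInt_ext. intros t. rewrite Rmin_left, Rmax_right by lra. intros Ht.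
        apply IH. assert (Rabs t <= Rabs x + 1 / 2).
        { replace t with (x + (t - x)) by ring. eapply Rle_trans; [apply Rabs_triang|].
          assert (Rabs (t - x) <= 1 / 2) by (apply Rabs_le; lra). lra. }
        lra.
      * rewrite RInt_const. unfold scal; simpl; unfold mult; simpl. field.
    + intros i _. rewrite Nspline_S by assumption. rewrite RInt_translate by assumption.
      f_equal; ring.
Qed.

Lemma Nspline_2_0 : forall y, -1 <= y <= 1 -> Nspline 2 y = 1 - Rabs y.
Proof.
  intros y Hy. rewrite Nspline_S by lia. apply is_RInt_unique.
  destruct (Rle_dec 0 y).
  - rewrite Rabs_pos_eq by lra.
    replace (1 - y) with (1 * (1 / 2 - (y - 1 / 2)) + 0 * (y + 1 / 2 - 1 / 2))
      by (field).
    apply is_RInt_Chasles_real with (1 / 2).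
    + apply RInt_piece; [lra|]. intros t Ht. apply Nspline_1_in. lra.
    + apply RInt_piece; [lra|]. intros t Ht. apply Nspline_1_out. lra.
  - rewrite Rabs_left1 by lra.
    replace (1 - - y) with (0 * (- (1 / 2) - (y - 1 / 2)) + 1 * (y + 1 / 2 - - (1 / 2)))
      by (field).
    apply is_RInt_Chasles_real with (- (1 / 2)).
    + apply RInt_piece; [lra|]. intros t Ht. apply Nspline_1_out. lra.
    + apply RInt_piece; [lra|]. intros t Ht. apply Nspline_1_in. lra.
Qed.

Lemma is_RInt_quadratic (p q r a b : R) :
  is_RInt (fun t => p + q * t + r * t ^ 2) a b
    ((p * b + q * b ^ 2 / 2 + r * b ^ 3 / 3) - (p * a + q * a ^ 2 / 2 + r * a ^ 3 / 3)).
Proof.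
  apply (is_RInt_derive (fun t => p * t + q * t ^ 2 / 2 + r * t ^ 3 / 3)).
  - intros x _. auto_derive; [exact I|]. field.
  - intros x _. apply (ex_derive_continuous (fun t => p + q * t + r * t ^ 2)). auto_derive. exact I.
Qed.

Lemma is_RInt_quadratic_ext (f : R -> R) (p q r a b : R) : a <= b ->
  (forall t, a < t < b -> f t = p + q * t + r * t ^ 2) ->
  is_RInt f a b
    ((p * b + q * b ^ 2 / 2 + r * b ^ 3 / 3) - (p * a + q * a ^ 2 / 2 + r * a ^ 3 / 3)).
Proof.
  intros Hab H. eapply is_RInt_ext; [|apply is_RInt_quadratic]. intros t.
  rewrite Rmin_left, Rmax_right by lra. intros Ht. now rewrite H.
Qed.

Lemma Nspline_3_center x : - (1 / 2) <= x <= 1 / 2 -> Nspline 3 x = 3 / 4 - x ^ 2.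
Proof.
  intros Hx. rewrite Nspline_S by lia. apply is_RInt_unique.
  replace (3 / 4 - x ^ 2) with
    (((1 * 0 + 1 * 0 ^ 2 / 2 + 0 * 0 ^ 3 / 3)
            - (1 * (x - 1 / 2) + 1 * (x - 1 / 2) ^ 2 / 2 + 0 * (x - 1 / 2) ^ 3 / 3)) +
          ((1 * (x + 1 / 2) + (-1) * (x + 1 / 2) ^ 2 / 2 + 0 * (x + 1 / 2) ^ 3 / 3)
            - (1 * 0 + (-1) * 0 ^ 2 / 2 + 0 * 0 ^ 3 / 3)))
    by (field).
  apply is_RInt_Chasles_real with 0.
  - apply is_RInt_quadratic_ext; [lra|]. intros t Ht.
    rewrite (Nspline_2_0 t) by lra. rewrite Rabs_left1 by lra. ring.
  - apply is_RInt_quadratic_ext; [lra|]. intros t Ht.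
    rewrite (Nspline_2_0 t) by lra. rewrite Rabs_pos_eq by lra. ring.
Qed.

(* This makes the spline collocation matrix strictly diagonally dominant. *)
Lemma Nspline_0_ge m : (m = 2 \/ m = 3 \/ m = 4)%nat -> 2 / 3 <= Nspline m 0.
Proof.
  intros [->|[->| ->]].
  - rewrite Nspline_2_0 by lra. rewrite Rabs_R0. lra.
  - rewrite Nspline_3_center by lra. simpl. lra.
  (* The cubic case attains the bound: [3/4 - t^2] has integral 2/3 over [[-1/2, 1/2]]. *)
  - rewrite Nspline_S by lia. right. symmetry. apply is_RInt_unique.
    replace (2 / 3) with
      ((3 / 4 * (0 + 1 / 2) + 0 * (0 + 1 / 2) ^ 2 / 2 + (-1) * (0 + 1 / 2) ^ 3 / 3)
       - (3 / 4 * (0 - 1 / 2) + 0 * (0 - 1 / 2) ^ 2 / 2 + (-1) * (0 - 1 / 2) ^ 3 / 3)) by field.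
    apply is_RInt_quadratic_ext; [lra|]. intros t Ht.
    rewrite Nspline_3_center by lra. ring.
Qed.

Lemma spline_order_bounds m : (m = 2 \/ m = 3 \/ m = 4)%nat -> (2 <= m)%nat /\ INR m <= 4.
Proof. intros [->|[->| ->]]; (split; [lia|simpl; lra]). Qed.

(** A centre at distance 3 from [q] is at distance at least 2, hence at least [m / 2], from [x], so
    five translates remain. The integer [q] is only required within distance 1, not nearest, so that
    one window can serve two points up to a mesh width apart. *)
Lemma window_partition m x (q : Z) : (m = 2 \/ m = 3 \/ m = 4)%nat -> Rabs (x - IZR q) <= 1 ->
  rsum 5 (fun i => Nspline m (x - IZR (q - 2 + Z.of_nat i))) = 1.
Proof.
  intros Hm Hx. destruct (spline_order_bounds m Hm) as [Hm2 Hm4].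
  pose proof (Nspline_partition m ltac:(lia) (x - IZR q) ltac:(lra)) as H.
  assert (E0 : Nspline m (x - IZR q - IZR (Z.of_nat 0 - 3)) = 0).
  { apply Nspline_support; [lia|]. simpl. apply Rabs_le_between in Hx.
    rewrite Rabs_pos_eq; lra. }
  assert (E6 : Nspline m (x - IZR q - IZR (Z.of_nat 6 - 3)) = 0).
  { apply Nspline_support; [lia|]. simpl. apply Rabs_le_between in Hx.
    rewrite Rabs_left1; lra. }
  rewrite <- H. change (rsum 7 ?f) with (0 + f 0%nat + f 1%nat + f 2%nat + f 3%nat + f 4%nat + f 5%nat + f 6%nat).
  cbv beta. rewrite E0, E6.
  change (rsum 5 ?f) with (0 + f 0%nat + f 1%nat + f 2%nat + f 3%nat + f 4%nat).
  cbv beta.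
  assert (Hi : forall z z', (z' - 2 = z)%Z -> Nspline m (x - IZR (q - 2 + z')) = Nspline m (x - IZR q - IZR z)).
  { intros z z' <-. f_equal. rewrite !plus_IZR, !minus_IZR. ring. }
  rewrite (Hi (Z.of_nat 1 - 3)%Z (Z.of_nat 0)) by lia.
  rewrite (Hi (Z.of_nat 2 - 3)%Z (Z.of_nat 1)) by lia.
  rewrite (Hi (Z.of_nat 3 - 3)%Z (Z.of_nat 2)) by lia.
  rewrite (Hi (Z.of_nat 4 - 3)%Z (Z.of_nat 3)) by lia.
  rewrite (Hi (Z.of_nat 5 - 3)%Z (Z.of_nat 4)) by lia.
  ring.
Qed.

Lemma Series_single (a : nat -> R) l0 : (forall l, l <> l0 -> a l = 0) -> Series a = a l0.
Proof.
  intros H. unfold Series.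
  assert (Hs : forall N, (l0 <= N)%nat -> sum_n a N = a l0).
  { assert (Hz : forall N, (N < l0)%nat -> sum_n a N = 0).
    { induction N; intros HN.
      - rewrite sum_O. apply H. lia.
      - rewrite sum_Sn, IHN, H by lia. unfold plus; simpl; ring. }
    induction N; intros HN.
    - rewrite sum_O. f_equal. lia.
    - rewrite sum_Sn. destruct (Nat.eq_dec l0 (S N)) as [->|Hn].
      + rewrite Hz by lia. unfold plus; simpl; ring.
      + rewrite IHN, (H (S N)) by lia. unfold plus; simpl; ring. }
  rewrite (Lim_seq_ext_loc _ (fun _ => a l0)).
  - now rewrite Lim_seq_const.
  - exists l0. exact Hs.
Qed.

Lemma Zsum_single (a : Z -> R) l0 : (forall l, l <> l0 -> a l = 0) -> Zsum a = a l0.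
Proof.
  intros H. unfold Zsum. destruct (Z_le_gt_dec 0 l0) as [Hl|Hl].
  - rewrite (Series_single (fun l => a (Z.of_nat l)) (Z.to_nat l0)).
    + rewrite (Series_single (fun l => a (- Z.of_nat (S l))%Z) 0%nat).
      * rewrite Z2Nat.id by lia. rewrite (H (- Z.of_nat 1)%Z) by lia. ring.
      * intros l _. apply H. lia.
    + intros l Hn. apply H. lia.
  - rewrite (Series_single (fun l => a (Z.of_nat l)) 0%nat).
    + rewrite (Series_single (fun l => a (- Z.of_nat (S l))%Z) (Z.to_nat (- l0 - 1))).
      * rewrite (H (Z.of_nat 0)) by lia.
        replace (- Z.of_nat (S (Z.to_nat (- l0 - 1))))%Z with l0 by lia. ring.
      * intros l Hn. apply H. lia.
    + intros l _. apply H. lia.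
Qed.

(* The [j]-th periodic B-spline in the grid variable, counting [j] from 0. *)
Definition bs (m n j : nat) (x : R) : R :=
  Zsum (fun l => Nspline m (x - INR j - IZR l * INR n)).

(** Since [n] is at least 5, the five indices of the window are distinct modulo [n]. At most one of
    them is congruent to [j], and the periodization series has at most one nonzero term. *)
Lemma bs_window m n j x (q : Z) : (m = 2 \/ m = 3 \/ m = 4)%nat -> (5 <= n)%nat -> (j < n)%nat ->
  Rabs (x - IZR q) <= 1 ->
  bs m n j x = rsum 5 (fun i => if Z.eqb ((q - 2 + Z.of_nat i) mod Z.of_nat n) (Z.of_nat j)
                               then Nspline m (x - IZR (q - 2 + Z.of_nat i)) else 0).
Proof.
  intros Hm Hn Hj Hx. destruct (spline_order_bounds m Hm) as [Hm2 Hm4].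
  apply Rabs_le_between in Hx.
  assert (Hout : forall r : Z, (r < q - 2 \/ q + 2 < r)%Z -> Nspline m (x - IZR r) = 0).
  { intros r Hr. apply Nspline_support; [assumption|].
    destruct Hr as [Hr|Hr].
    - assert (IZR r <= IZR q - 3) by (rewrite <- minus_IZR; apply IZR_le; lia).
      rewrite Rabs_pos_eq; lra.
    - assert (IZR q + 3 <= IZR r) by (rewrite <- plus_IZR; apply IZR_le; lia).
      rewrite Rabs_left1; lra. }
  assert (Hr : forall l, x - INR j - IZR l * INR n = x - IZR (Z.of_nat j + l * Z.of_nat n)).
  { intros l. rewrite plus_IZR, mult_IZR, <- !INR_IZR_INZ. ring. }
  unfold bs.
  destruct (classic (exists i, (i < 5)%nat /\ ((q - 2 + Z.of_nat i) mod Z.of_nat n = Z.of_nat j)%Z))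
    as [[i [Hi Hmod]]|Hno].
  - set (r := (q - 2 + Z.of_nat i)%Z) in *.
    assert (Hrr : (Z.of_nat j + (r / Z.of_nat n) * Z.of_nat n = r)%Z).
    { rewrite <- Hmod. pose proof (Z.div_mod r (Z.of_nat n) ltac:(lia)). lia. }
    rewrite (Zsum_single _ (r / Z.of_nat n)%Z).
    + rewrite Hr, Hrr. rewrite (rsum_single 5 _ i Hi).
      * fold r. rewrite Hmod, Z.eqb_refl. reflexivity.
      * intros i' Hi' Hii. destruct (Z.eqb_spec ((q - 2 + Z.of_nat i') mod Z.of_nat n) (Z.of_nat j)) as [He|]; [|reflexivity].
        exfalso. pose proof (Z.div_mod (q - 2 + Z.of_nat i') (Z.of_nat n) ltac:(lia)) as Hd.
        rewrite He in Hd. unfold r in Hrr.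
        assert (Hdiff : (Z.of_nat i' - Z.of_nat i = Z.of_nat n *
           ((q - 2 + Z.of_nat i') / Z.of_nat n - (q - 2 + Z.of_nat i) / Z.of_nat n))%Z) by lia.
        set (k := ((q - 2 + Z.of_nat i') / Z.of_nat n - (q - 2 + Z.of_nat i) / Z.of_nat n)%Z) in *.
        assert (k = 0%Z) by nia. nia.
    + intros l Hl. rewrite Hr. apply Hout.
      assert (Z.of_nat j + l * Z.of_nat n = r + (l - r / Z.of_nat n) * Z.of_nat n)%Z by lia.
      set (k := (l - r / Z.of_nat n)%Z) in *. assert (k <> 0)%Z by lia.
      unfold r in H. nia.
  - rewrite (Zsum_single _ 0%Z).
    + rewrite Hr. rewrite rsum_zero.
      * apply Hout. apply NNPP. intros Hc. apply Hno.
        exists (Z.to_nat (Z.of_nat j + 0 * Z.of_nat n - (q - 2))). split; [lia|].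
        rewrite Z2Nat.id by lia.
        replace (q - 2 + (Z.of_nat j + 0 * Z.of_nat n - (q - 2)))%Z with (Z.of_nat j) by ring.
        apply Z.mod_small. lia.
      * intros i Hi. destruct (Z.eqb_spec ((q - 2 + Z.of_nat i) mod Z.of_nat n) (Z.of_nat j)) as [He|]; [|reflexivity].
        exfalso; apply Hno; eauto.
    + intros l _. rewrite Hr. apply Hout. apply NNPP. intros Hc. apply Hno.
      exists (Z.to_nat (Z.of_nat j + l * Z.of_nat n - (q - 2))). split; [lia|].
      rewrite Z2Nat.id by lia.
      replace (q - 2 + (Z.of_nat j + l * Z.of_nat n - (q - 2)))%Z with (Z.of_nat j + l * Z.of_nat n)%Z by ring.
      rewrite Z_mod_plus_full. apply Z.mod_small. lia.
Qed.

Lemma nearest_integer (x : R) : exists q : Z, Rabs (x - IZR q) <= 1.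
Proof.
  destruct (floor_exists x) as [q Hq]. exists q. apply Rabs_le. lra.
Qed.

Lemma bs_periodic m n j x (k : Z) : (m = 2 \/ m = 3 \/ m = 4)%nat -> (5 <= n)%nat -> (j < n)%nat ->
  bs m n j (x + INR n * IZR k) = bs m n j x.
Proof.
  intros Hm Hn Hj. destruct (nearest_integer x) as [q Hq].
  rewrite (bs_window m n j x q) by assumption.
  rewrite (bs_window m n j _ (q + k * Z.of_nat n)) by
    (try assumption; rewrite plus_IZR, mult_IZR, <- INR_IZR_INZ;
     replace (x + INR n * IZR k - (IZR q + IZR k * INR n)) with (x - IZR q) by ring; assumption).
  apply rsum_ext. intros i _.
  replace (q + k * Z.of_nat n - 2 + Z.of_nat i)%Z with (q - 2 + Z.of_nat i + k * Z.of_nat n)%Z by ring.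
  rewrite Z_mod_plus_full. destruct (Z.eqb _ _); [|reflexivity].
  f_equal. rewrite (plus_IZR _ (k * _)), mult_IZR, <- INR_IZR_INZ. ring.
Qed.

(** Coefficients read modulo [n]: locally a periodic spline becomes an ordinary sum over five
    consecutive integers ([spline_window]). *)
Definition zext (n : nat) (a : nat -> C) (r : Z) : C := a (Z.to_nat (r mod Z.of_nat n)).

Lemma spline_window m n a x (q : Z) : (m = 2 \/ m = 3 \/ m = 4)%nat -> (5 <= n)%nat ->
  Rabs (x - IZR q) <= 1 ->
  csum n (fun j => (a j * RtoC (bs m n j x))%C) =
  csum 5 (fun i => (zext n a (q - 2 + Z.of_nat i) * RtoC (Nspline m (x - IZR (q - 2 + Z.of_nat i))))%C).
Proof.
  intros Hm Hn Hx.
  rewrite (csum_ext n _ (fun j => csum 5 (fun i => (a j *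
     RtoC (if Z.eqb ((q - 2 + Z.of_nat i) mod Z.of_nat n) (Z.of_nat j)
                               then Nspline m (x - IZR (q - 2 + Z.of_nat i)) else 0))%C))).
  - rewrite csum_swap. apply csum_ext. intros i Hi.
    pose proof (Z.mod_pos_bound (q - 2 + Z.of_nat i) (Z.of_nat n) ltac:(lia)) as Hb.
    rewrite (csum_single n _ (Z.to_nat ((q - 2 + Z.of_nat i) mod Z.of_nat n))).
    + rewrite Z2Nat.id by lia. now rewrite Z.eqb_refl.
    + lia.
    + intros j Hj Hne. destruct (Z.eqb_spec ((q - 2 + Z.of_nat i) mod Z.of_nat n) (Z.of_nat j)); [lia|]. ring.
  - intros j Hj. rewrite (bs_window m n j x q) by assumption.
    now rewrite rsum_RtoC, csum_scal.
Qed.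

(** * Spline interpolation *)

Lemma csum_weighted_bound n (e : nat -> C) (w : nat -> R) D :
  (forall i, (i < n)%nat -> Cmod (e i) <= D) -> (forall i, (i < n)%nat -> 0 <= w i) ->
  Cmod (csum n (fun i => (e i * RtoC (w i))%C)) <= D * rsum n w.
Proof.
  induction n; intros He Hw; simpl.
  - rewrite Cmod_0. lra.
  - eapply Rle_trans; [apply Cmod_triangle|].
    rewrite Cmod_mult, Cmod_R, Rabs_pos_eq by (apply Hw; lia).
    assert (Cmod (csum n (fun i => (e i * RtoC (w i))%C)) <= D * rsum n w)
      by (apply IHn; intros; [apply He|apply Hw]; lia).
    assert (Cmod (e n) * w n <= D * w n)
      by (apply Rmult_le_compat_r; [apply Hw|apply He]; lia).
    lra.
Qed.

(** Weights of sum 1 reproduce constants, so only the deviations of the coefficients from a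
    reference value [v] matter. *)
Lemma csum_center n (d : nat -> C) (w : nat -> R) v : rsum n w = 1 ->
  csum n (fun i => (d i * RtoC (w i))%C) =
  (csum n (fun i => ((d i - v) * RtoC (w i))%C) + v)%C.
Proof.
  intros Hw.
  rewrite (csum_ext n (fun i => ((d i - v) * RtoC (w i))%C)
    (fun i => (d i * RtoC (w i) + (- v) * RtoC (w i))%C)) by (intros; ring).
  rewrite csum_plus, csum_scal, <- rsum_RtoC, Hw. ring.
Qed.

Section Splines.

Variables (m n : nat).
Hypothesis Hm : (m = 2 \/ m = 3 \/ m = 4)%nat.
Hypothesis Hn : (5 <= n)%nat.
Variable rho : R.

Let h := mesh n.

Definition node (j : nat) : R := rho + INR j * mesh n.

Definition spl (a : nat -> C) (x : R) : C :=
  csum n (fun j => (a j * RtoC (bs m n j ((x - rho) / mesh n)))%C).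

Lemma mesh_pos : 0 < h.
Proof using Hn.
  clear Hm. unfold h, mesh. pose proof PI_RGT_0.
  apply Rdiv_lt_0_compat; [lra|]. apply lt_0_INR. lia.
Qed.

Lemma mesh_period : INR n * h = 2 * PI.
Proof using Hn. clear Hm. unfold h, mesh. field. apply not_0_INR. lia. Qed.

Lemma grid_period x : (x + 2 * PI - rho) / h = (x - rho) / h + INR n * IZR 1.
Proof.
  rewrite <- mesh_period. pose proof mesh_pos. field. lra.
Qed.

Lemma spl_periodic a x : spl a (x + 2 * PI) = spl a x.
Proof.
  unfold spl. apply csum_ext. intros j Hj. fold h. rewrite grid_period.
  now rewrite bs_periodic.
Qed.

Lemma zext_bound (a : nat -> C) D v : (forall j, (j < n)%nat -> Cmod (a j - v) <= D) ->
  forall r, Cmod (zext n a r - v) <= D.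
Proof.
  intros H r. unfold zext. apply H.
  pose proof (Z.mod_pos_bound r (Z.of_nat n) ltac:(lia)). lia.
Qed.

Lemma weight_nonneg x (q : Z) i : 0 <= Nspline m (x - IZR (q - 2 + Z.of_nat i)).
Proof. destruct (spline_order_bounds m Hm). apply Nspline_basic. lia. Qed.

(** The value of a spline is a convex combination of the five coefficients of the window. *)
Lemma spl_near a x (q : Z) v D : Rabs ((x - rho) / h - IZR q) <= 1 ->
  (forall i, (i < 5)%nat -> Cmod (zext n a (q - 2 + Z.of_nat i) - v)%C <= D) ->
  Cmod (spl a x - v)%C <= D.
Proof.
  intros Hq HD. unfold spl. fold h. rewrite (spline_window m n a _ q) by assumption.
  rewrite (csum_center 5 _ _ v) by now apply window_partition.
  replace (csum 5 _ + v - v)%C with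
    (csum 5 (fun i => ((zext n a (q - 2 + Z.of_nat i) - v)
        * RtoC (Nspline m ((x - rho) / h - IZR (q - 2 + Z.of_nat i))))%C)) by ring.
  eapply Rle_trans.
  - apply (csum_weighted_bound 5 _ _ D HD). intros; apply weight_nonneg.
  - rewrite window_partition by assumption. lra.
Qed.

(** Over a common window both values use the same five coefficients, and centring at [v] cancels in
    the difference. The 10 is five terms times the Lipschitz constant 2 of [Nspline m]. *)
Lemma spl_increment a x y (q : Z) v D :
  Rabs ((x - rho) / h - IZR q) <= 1 -> Rabs ((y - rho) / h - IZR q) <= 1 ->
  (forall i, (i < 5)%nat -> Cmod (zext n a (q - 2 + Z.of_nat i) - v)%C <= D) ->
  Cmod (spl a x - spl a y)%C <= 10 * D * (Rabs (x - y) / h).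
Proof.
  intros Hx Hy HD. pose proof mesh_pos as Hh.
  destruct (spline_order_bounds m Hm) as [Hm2 _].
  unfold spl. fold h. rewrite !(spline_window m n a _ q) by assumption.
  rewrite (csum_center 5 _ (fun i => Nspline m ((x - rho) / h - IZR (q - 2 + Z.of_nat i))) v)
    by now apply window_partition.
  rewrite (csum_center 5 _ (fun i => Nspline m ((y - rho) / h - IZR (q - 2 + Z.of_nat i))) v)
    by now apply window_partition.
  set (wx := fun i => Nspline m ((x - rho) / h - IZR (q - 2 + Z.of_nat i))).
  set (wy := fun i => Nspline m ((y - rho) / h - IZR (q - 2 + Z.of_nat i))).
  set (d := fun i => (zext n a (q - 2 + Z.of_nat i) - v)%C).
  replace (csum 5 _ + v - (csum 5 _ + v))%C with
    (csum 5 (fun i => (d i * RtoC (wx i))%C) + (- RtoC 1) * csum 5 (fun i => (d i * RtoC (wy i))%C))%C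
    by (unfold d, wx, wy; ring).
  rewrite <- csum_scal, <- csum_plus.
  replace (10 * D * (Rabs (x - y) / h)) with (INR 5 * (D * (2 * (Rabs (x - y) / h)))) by (simpl; ring).
  apply csum_bound. intros i Hi.
  replace (d i * RtoC (wx i) + - RtoC 1 * (d i * RtoC (wy i)))%C with (d i * RtoC (wx i - wy i))%C
    by (rewrite RtoC_minus; ring).
  rewrite Cmod_mult, Cmod_R.
  apply Rmult_le_compat; try apply Cmod_ge_0; try apply Rabs_pos.
  - now apply HD.
  - unfold wx, wy. eapply Rle_trans; [now apply Nspline_lipschitz|].
    right. f_equal.
    replace ((x - rho) / h - IZR (q - 2 + Z.of_nat i) - ((y - rho) / h - IZR (q - 2 + Z.of_nat i)))
      with ((x - y) / h) by (field; lra).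
    unfold Rdiv. rewrite Rabs_mult. f_equal. apply Rabs_pos_eq. left. now apply Rinv_0_lt_compat.
Qed.

Lemma common_center x y : Rabs (x - y) <= h ->
  exists q : Z, Rabs ((x - rho) / h - IZR q) <= 1 /\ Rabs ((y - rho) / h - IZR q) <= 1.
Proof.
  pose proof mesh_pos as Hh.
  assert (Hw : forall x y, x <= y <= x + h ->
    exists q : Z, Rabs ((x - rho) / h - IZR q) <= 1 /\ Rabs ((y - rho) / h - IZR q) <= 1).
  { intros u v [H1 H2]. destruct (floor_exists ((u - rho) / h)) as [p [Hp1 Hp2]].
    (* The right end of the cell of [u] is within one grid unit of both points, [v] lying at most
       one unit to the right of [u]. *)
    exists (p + 1)%Z. rewrite plus_IZR.
    assert ((u - rho) / h <= (v - rho) / h <= (u - rho) / h + 1).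
    { replace ((u - rho) / h + 1) with ((u + h - rho) / h) by (field; lra).
      split; apply Rmult_le_compat_r; try lra; left; now apply Rinv_0_lt_compat. }
    split; apply Rabs_le; lra. }
  intros H. apply Rabs_le_between in H. destruct (Rle_dec x y).
  - apply Hw. lra.
  - destruct (Hw y x ltac:(lra)) as [q [H1 H2]]. exists q; auto.
Qed.

Lemma spl_CP a : CP (spl a).
Proof.
  split; [|apply spl_periodic]. pose proof mesh_pos as Hh.
  assert (HD : exists D, 0 <= D /\ forall r, Cmod (zext n a r - RtoC 0)%C <= D).
  { destruct (uniform_constant (fun j => (j < n)%nat) (fun j D => Cmod (a j - RtoC 0)%C <= D) n)
      as [D [HD0 HD]]; [lia|intros; lra| |].
    - intros j _. eexists. split; [apply Cmod_ge_0|apply Rle_refl].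
    - exists D. split; [assumption|]. now apply zext_bound. }
  destruct HD as [D [HD0 HD]].
  intros x. apply Clim_locally_iff. intros e He.
  exists (Rmin h (e * h / (10 * D + 1))). split.
  - apply Rmin_glb_lt; [assumption|]. apply Rdiv_lt_0_compat; [nra|lra].
  - intros y Hy. pose proof (Rlt_le_trans _ _ _ Hy (Rmin_l _ _)) as H1.
    pose proof (Rlt_le_trans _ _ _ Hy (Rmin_r _ _)) as H2.
    destruct (common_center y x ltac:(lra)) as [q [Hq1 Hq2]].
    apply Rle_lt_trans with (10 * D * (Rabs (y - x) / h)).
    { apply (spl_increment a y x q (RtoC 0)); auto. }
    assert (H3 : Rabs (y - x) * (10 * D + 1) < e * h).
    { apply Rmult_lt_reg_r with (/ (10 * D + 1)); [apply Rinv_0_lt_compat; lra|].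
      rewrite Rmult_assoc, Rinv_r, Rmult_1_r by lra. exact H2. }
    apply Rmult_lt_reg_r with h; [assumption|].
    replace (10 * D * (Rabs (y - x) / h) * h) with (10 * D * Rabs (y - x)) by (field; lra).
    pose proof (Rabs_pos (y - x)). lra.
Qed.

Lemma spl_bound a D : (forall j, (j < n)%nat -> Cmod (a j) <= D) -> bnd (spl a) D.
Proof.
  intros H x. destruct (nearest_integer ((x - rho) / h)) as [q Hq].
  replace (spl a x) with (spl a x - RtoC 0)%C by ring.
  apply (spl_near a x q); [assumption|]. intros i _. apply zext_bound.
  intros j Hj. replace (a j - RtoC 0)%C with (a j) by ring. auto.
Qed.

Lemma spl_linear a b z x : spl (fun j => (a j + z * b j)%C) x = (spl a x + z * spl b x)%C.
Proof.
  unfold spl. rewrite <- csum_scal, <- csum_plus. apply csum_ext. intros; ring.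
Qed.

Lemma zext_samples v (r : Z) : (forall x, v (x + 2 * PI) = v x) ->
  zext n (fun j => v (node j)) r = v (rho + IZR r * h).
Proof.
  intros Hv. unfold zext, node.
  pose proof (Z.mod_pos_bound r (Z.of_nat n) ltac:(lia)) as Hb.
  rewrite <- (periodic_IZR v Hv (r / Z.of_nat n)).
  f_equal. rewrite INR_IZR_INZ, Z2Nat.id by lia. fold h.
  rewrite <- mesh_period, INR_IZR_INZ.
  pose proof (Z.div_mod r (Z.of_nat n) ltac:(lia)) as Hd. rewrite Hd at 3.
  rewrite plus_IZR, mult_IZR. ring.
Qed.

(** The nodes of the window lie within [2 * h] of node [q], and [x] within [h] of it, whence
    [3 * h]. *)
Lemma sample_near v s H x (q : Z) i : 0 < s -> 0 <= H -> (forall x, v (x + 2 * PI) = v x) ->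
  holder everywhere s H v -> Rabs ((x - rho) / h - IZR q) <= 1 -> (i < 5)%nat ->
  Cmod (zext n (fun j => v (node j)) (q - 2 + Z.of_nat i) - v x)%C <= H * rpow (3 * h) s.
Proof.
  intros Hs H0 Hp Hh Hq Hi. pose proof mesh_pos as Hh0.
  rewrite zext_samples by assumption.
  eapply Rle_trans; [apply Hh; exact I|].
  apply Rmult_le_compat_l; [assumption|]. apply rpow_mono; [assumption|apply Rabs_pos|].
  replace (rho + IZR (q - 2 + Z.of_nat i) * h - x)
    with (h * ((IZR (Z.of_nat i) - 2) - ((x - rho) / h - IZR q)))
    by (rewrite plus_IZR, minus_IZR; field; lra).
  rewrite Rabs_mult, (Rabs_pos_eq h) by lra. rewrite (Rmult_comm 3).
  apply Rmult_le_compat_l; [lra|].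
  apply Rabs_le_between in Hq.
  assert (IZR 0 <= IZR (Z.of_nat i) <= IZR 4) by (split; apply IZR_le; lia).
  apply Rabs_le. lra.
Qed.

(** Quasi-interpolation: the samples themselves are used as coefficients. It is the object of
    comparison for the true interpolant, and it also provides the sampling operators of the Fredholm
    argument. *)
Lemma spl_samples_error v s H : 0 < s -> 0 <= H -> (forall x, v (x + 2 * PI) = v x) ->
  holder everywhere s H v ->
  forall x, Cmod (spl (fun j => v (node j)) x - v x)%C <= H * rpow (3 * h) s.
Proof.
  intros Hs H0 Hp Hh x. destruct (nearest_integer ((x - rho) / h)) as [q Hq].
  apply (spl_near _ x q); [assumption|]. intros i Hi. now apply sample_near.
Qed.

(** If all coefficients are bounded by [B], isolating the central term at node [i] gives
    [|d_i| N_m(0) <= D + B (1 - N_m(0))]. With [N_m(0) >= 2/3] this is [|d_i| <= 3/2 D + B / 2], and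
    absorption yields [3 * D]. *)
Lemma spl_coefficients_bound d D : (forall i, (i < n)%nat -> Cmod (spl d (node i)) <= D) ->
  forall i, (i < n)%nat -> Cmod (d i) <= 3 * D.
Proof.
  intros HD i0 Hi0.
  assert (D0 : 0 <= D) by (apply Rle_trans with (2 := HD i0 Hi0); apply Cmod_ge_0).
  pose proof mesh_pos as Hh. pose proof (Nspline_0_ge m Hm) as HN.
  (* The extension by 0 makes [absorb_half] applicable to all indices and shows, at index [n], that
     every upper bound is nonnegative. *)
  set (u := fun i => if Nat.ltb i n then Cmod (d i) else 0).
  assert (HB0 : exists B0, forall i, u i <= B0).
  { destruct (uniform_constant (fun i => (i < n)%nat) (fun i B => Cmod (d i) <= B) n)
      as [B [HB0 HB]]; [lia|intros; lra| |].
    - intros j _. eexists. split; [apply Cmod_ge_0|apply Rle_refl].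
    - exists B. intros i. unfold u. destruct (Nat.ltb_spec i n); auto. }
  destruct HB0 as [B0 HB0].
  assert (Hu : u i0 <= 2 * (3 / 2 * D)).
  { apply absorb_half with (1 := HB0). clear i0 Hi0. intros B HB i.
    assert (B0' : 0 <= B).
    { specialize (HB n). unfold u in HB. now rewrite Nat.ltb_irrefl in HB. }
    assert (HdB : forall j, (j < n)%nat -> Cmod (d j) <= B).
    { intros j Hj. specialize (HB j). unfold u in HB. destruct (Nat.ltb_spec j n); [assumption|lia]. }
    unfold u. destruct (Nat.ltb_spec i n) as [Hi|]; [|lra].
    specialize (HD i Hi). unfold spl, node in HD.
    replace ((rho + INR i * mesh n - rho) / mesh n) with (INR i) in HD by (fold h; field; lra).
    assert (Hx : Rabs (INR i - IZR (Z.of_nat i)) <= 1).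
    { rewrite <- INR_IZR_INZ. replace (INR i - INR i) with 0 by ring. rewrite Rabs_R0. lra. }
    rewrite (spline_window m n d _ (Z.of_nat i)) in HD by assumption.
    pose proof (window_partition m _ _ Hm Hx) as Hp.
    set (w := fun k => Nspline m (INR i - IZR (Z.of_nat i - 2 + Z.of_nat k))) in *.
    assert (Hw0 : forall k, 0 <= w k) by (intros; apply weight_nonneg).
    assert (Hw2 : w 2%nat = Nspline m 0).
    { unfold w. f_equal. rewrite INR_IZR_INZ, plus_IZR, minus_IZR. simpl (IZR (Z.of_nat 2)). ring. }
    assert (Hz2 : zext n d (Z.of_nat i - 2 + Z.of_nat 2) = d i).
    { unfold zext. f_equal. replace (Z.of_nat i - 2 + Z.of_nat 2)%Z with (Z.of_nat i) by lia.
      rewrite Z.mod_small by lia. lia. }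
    assert (Hz : forall r, Cmod (zext n d r) <= B).
    { intros r. replace (zext n d r) with (zext n d r - RtoC 0)%C by ring. apply zext_bound.
      intros j Hj. replace (d j - RtoC 0)%C with (d j) by ring. auto. }
    change (rsum 5 w) with (0 + w 0%nat + w 1%nat + w 2%nat + w 3%nat + w 4%nat) in Hp.
    set (t := fun k => (zext n d (Z.of_nat i - 2 + Z.of_nat k) * RtoC (w k))%C).
    assert (HD' : Cmod (csum 5 t) <= D) by exact HD. clear HD.
    assert (Ht : forall k, Cmod (t k) <= B * w k).
    { intros k. unfold t. rewrite Cmod_mult, Cmod_R, Rabs_pos_eq by apply Hw0.
      apply Rmult_le_compat_r; [apply Hw0|apply Hz]. }
    assert (Ht2 : Cmod (t 2%nat) = Cmod (d i) * Nspline m 0).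
    { unfold t. rewrite Hz2, Hw2, Cmod_mult, Cmod_R, Rabs_pos_eq by lra. reflexivity. }
    assert (Hsplit : t 2%nat = (csum 5 t - (t 0%nat + (t 1%nat + (t 3%nat + t 4%nat))))%C)
      by (simpl; ring).
    assert (H2 : Cmod (t 2%nat) <= D + B * (1 - Nspline m 0)).
    { rewrite Hsplit. eapply Rle_trans; [apply Cmod_sub_le|].
      pose proof (Cmod_triangle (t 0%nat) (t 1%nat + (t 3%nat + t 4%nat))).
      pose proof (Cmod_triangle (t 1%nat) (t 3%nat + t 4%nat)).
      pose proof (Cmod_triangle (t 3%nat) (t 4%nat)).
      pose proof (Ht 0%nat). pose proof (Ht 1%nat). pose proof (Ht 3%nat). pose proof (Ht 4%nat).
      rewrite <- Hp at 1. rewrite <- Hw2. nra. }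
    rewrite Ht2 in H2. pose proof (Cmod_ge_0 (d i)). nra. }
  unfold u in Hu. destruct (Nat.ltb_spec i0 n); [lra|lia].
Qed.

(** At the nodes the interpolant differs from the quasi-interpolant by at most [H (3h)^s], so their
    coefficients differ by three times that. Adding the distance of samples to values gives
    [4 H (3h)^s <= 12 H h^s], as [s <= 1]. Increments over distances above [h] use this sup bound
    twice; shorter ones use 1 for [v] and [10 * 12] for the spline, whence 121. *)
Lemma spl_interpolation_error v a s t H :
  0 < t -> t < s -> s <= 1 -> 0 <= H -> (forall x, v (x + 2 * PI) = v x) ->
  holder everywhere s H v ->
  (forall i, (i < n)%nat -> spl a (node i) = v (node i)) ->
  (forall x, Cmod (v x - spl a x)%C <= 12 * H * rpow h s) /\
  holder everywhere t (121 * H * rpow h (s - t)) (fun x => (v x - spl a x)%C).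
Proof.
  intros Ht Hts Hs1 H0 Hp Hv Hint. pose proof mesh_pos as Hh.
  assert (H3 : rpow (3 * h) s <= 3 * rpow h s).
  { rewrite rpow_mult by lra. apply Rmult_le_compat_r; [apply rpow_ge_0|].
    rewrite rpow_pos_eq by lra. rewrite <- (Rpower_1 3) at 2 by lra. apply Rle_Rpower; lra. }
  pose proof (rpow_ge_0 h s) as Hr0.
  assert (Hcoef : forall j, (j < n)%nat ->
    Cmod (a j - v (node j))%C <= 3 * (H * rpow (3 * h) s)).
  { apply (spl_coefficients_bound (fun j => (a j - v (node j))%C)).
    intros i Hi.
    replace (fun j => (a j - v (node j))%C) with (fun j => (a j + (- RtoC 1) * v (node j))%C)
      by (apply functional_extensionality; intros; ring).
    rewrite spl_linear, Hint by assumption.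
    replace (v (node i) + - RtoC 1 * spl (fun j => v (node j)) (node i))%C
      with (- (spl (fun j => v (node j)) (node i) - v (node i)))%C by ring.
    rewrite Cmod_opp. apply spl_samples_error; auto; lra. }
  assert (Hnear : forall x q i, Rabs ((x - rho) / h - IZR q) <= 1 -> (i < 5)%nat ->
    Cmod (zext n a (q - 2 + Z.of_nat i) - v x)%C <= 12 * H * rpow h s).
  { intros x q i Hq Hi.
    apply Rle_trans with (1 := Cmod_sub_triangle _ (zext n (fun j => v (node j)) (q - 2 + Z.of_nat i)) _).
    pose proof (sample_near v s H x q i ltac:(lra) H0 Hp Hv Hq Hi) as H1.
    assert (H2 : Cmod (zext n a (q - 2 + Z.of_nat i) - zext n (fun j => v (node j)) (q - 2 + Z.of_nat i))%C
      <= 3 * (H * rpow (3 * h) s)).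
    { unfold zext. apply Hcoef.
      pose proof (Z.mod_pos_bound (q - 2 + Z.of_nat i) (Z.of_nat n) ltac:(lia)). lia. }
    assert (H * rpow (3 * h) s <= H * (3 * rpow h s)) by (apply Rmult_le_compat_l; assumption).
    lra. }
  assert (Hsup : forall x, Cmod (v x - spl a x)%C <= 12 * H * rpow h s).
  { intros x. rewrite Cmod_sub_sym. destruct (nearest_integer ((x - rho) / h)) as [q Hq].
    apply (spl_near a x q); auto. }
  split; [assumption|].
  intros x y _ _.
  set (d := Rabs (x - y)). assert (Hd : 0 <= d) by apply Rabs_pos.
  assert (Hst : forall e, 0 <= e -> rpow e s = rpow e (s - t) * rpow e t).
  { intros e He. rewrite <- rpow_plus by assumption. f_equal. ring. }
  pose proof (rpow_ge_0 h (s - t)) as Hr1. pose proof (rpow_ge_0 d t) as Hr2.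
  assert (HQ : 0 <= H * rpow h (s - t) * rpow d t) by (repeat apply Rmult_le_pos; assumption).
  destruct (Rle_dec h d) as [Hhd|Hhd].
  - apply Rle_trans with (1 := Cmod_sub_le _ _).
    pose proof (Hsup x). pose proof (Hsup y).
    assert (rpow h s <= rpow h (s - t) * rpow d t).
    { rewrite (Hst h) by lra. apply Rmult_le_compat_l; [assumption|]. apply rpow_mono; lra. }
    assert (H * rpow h s <= H * (rpow h (s - t) * rpow d t)) by (apply Rmult_le_compat_l; assumption).
    lra.
  - replace (v x - spl a x - (v y - spl a y))%C with ((v x - v y) - (spl a x - spl a y))%C by ring.
    apply Rle_trans with (1 := Cmod_sub_le _ _).
    assert (H1 : Cmod (v x - v y)%C <= H * rpow h (s - t) * rpow d t).
    { eapply Rle_trans; [apply Hv; exact I|]. fold d. rewrite (Hst d) by assumption.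
      rewrite Rmult_assoc. apply Rmult_le_compat_l; [assumption|].
      apply Rmult_le_compat_r; [assumption|]. apply rpow_mono; lra. }
    assert (H2 : Cmod (spl a x - spl a y)%C <= 120 * (H * rpow h (s - t) * rpow d t)).
    { destruct (common_center x y ltac:(fold d; lra)) as [q [Hq1 Hq2]].
      eapply Rle_trans; [apply (spl_increment a x y q (v x) (12 * H * rpow h s)); auto|].
      fold d.
      assert (Hdh : 0 <= d / h <= 1).
      { split; [apply Rdiv_le_0_compat; lra|]. apply Rmult_le_reg_r with h; [lra|].
        unfold Rdiv. rewrite Rmult_assoc, Rinv_l; lra. }
      (* Below the mesh width the Lipschitz factor [d / h] is weakened to the power [t], after which
         [h^t] times it is [d^t]. *)
      assert (H3' : d / h <= rpow (d / h) t).
      { rewrite <- (rpow_1 (d / h)) at 1 by lra. apply rpow_small; lra. }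
      assert (H4 : rpow h t * rpow (d / h) t = rpow d t).
      { rewrite <- rpow_mult by lra. f_equal. field. lra. }
      rewrite (Hst h) by lra. rewrite <- H4.
      pose proof (rpow_ge_0 h t) as Hr3.
      replace (10 * (12 * H * (rpow h (s - t) * rpow h t)) * (d / h))
        with (120 * (H * rpow h (s - t)) * (rpow h t * (d / h))) by ring.
      replace (120 * (H * rpow h (s - t) * (rpow h t * rpow (d / h) t)))
        with (120 * (H * rpow h (s - t)) * (rpow h t * rpow (d / h) t)) by ring.
      apply Rmult_le_compat_l.
      - apply Rmult_le_pos; [lra|]. apply Rmult_le_pos; assumption.
      - apply Rmult_le_compat_l; assumption. }
    lra.
Qed.

End Splines.

Lemma large_mesh_index e : 0 < e -> exists n, (5 <= n)%nat /\ mesh n < e.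
Proof.
  intros He. pose proof PI_RGT_0 as HP.
  destruct (INR_unbounded (2 * PI / e)) as [N HN].
  exists (N + 5)%nat. split; [lia|]. unfold mesh.
  assert (HN' : 2 * PI / e < INR (N + 5)) by (rewrite plus_INR; simpl; lra).
  assert (0 < 2 * PI / e) by (apply Rdiv_lt_0_compat; lra).
  apply Rmult_lt_reg_r with (INR (N + 5)); [lra|].
  unfold Rdiv. rewrite Rmult_assoc, Rinv_l by lra. rewrite Rmult_1_r.
  apply Rmult_lt_reg_r with (/ e); [now apply Rinv_0_lt_compat|].
  replace (e * INR (N + 5) * / e) with (INR (N + 5)) by (field; lra). exact HN'.
Qed.

(** Hat functions, of order 2 and phase 0, on a mesh with [(3 h)^mu <= e]. The unit coefficient
    vectors give the functions [b i], and the sampled sum is then the quasi-interpolant. *)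
Lemma sampling_operators mu : 0 < mu -> forall e, 0 < e ->
  exists n (X : nat -> R) (b : nat -> R -> C),
     (forall i, (i < n)%nat -> CP (b i) /\ bnd (b i) 1) /\
     forall v H, CP v -> holder everywhere mu H v ->
       forall x, Cmod (v x - csum n (fun i => (v (X i) * b i x)%C))%C <= e * H.
Proof.
  intros Hmu e He.
  destruct (rpow_small_radius mu e 1 Hmu He) as [d [Hd0 Hd]].
  destruct (large_mesh_index (d / 3) ltac:(lra)) as [n [Hn Hnd]].
  exists n, (node n 0), (fun i => spl 2 n 0 (fun j => if Nat.eqb j i then RtoC 1 else RtoC 0)).
  assert (Hm : (2 = 2 \/ 2 = 3 \/ 2 = 4)%nat) by auto.
  split.
  - intros i Hi. split; [now apply spl_CP|]. apply spl_bound; auto.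
    intros j Hj. destruct (Nat.eqb j i); [rewrite Cmod_1|rewrite Cmod_0]; lra.
  - intros v H [_ Hp] Hv x.
    (* The Hoelder condition at two points at distance 1 forces the sign of [H]. *)
    assert (H0 : 0 <= H).
    { assert (H1 := Hv 1 0 I I). replace (1 - 0) with 1 in H1 by ring.
      rewrite Rabs_R1 in H1. pose proof (Cmod_ge_0 (v 1 - v 0)%C).
      rewrite rpow_pos_eq in H1 by lra. unfold Rpower in H1. rewrite ln_1, Rmult_0_r, exp_0 in H1. lra. }
    replace (csum n (fun i => v (node n 0 i) * spl 2 n 0 (fun j => if Nat.eqb j i then RtoC 1 else RtoC 0) x)%C)
      with (spl 2 n 0 (fun j => v (node n 0 j)) x).
    + rewrite Cmod_sub_sym. eapply Rle_trans; [apply spl_samples_error with (s := mu) (H := H); auto|].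
      rewrite (Rmult_comm e). apply Rmult_le_compat_l; [assumption|].
      pose proof (mesh_pos n Hn).
      pose proof (Hd (3 * mesh n) ltac:(lra) ltac:(lra)). lra.
    + unfold spl at 1. apply csum_ext. intros i Hi. f_equal. unfold spl.
      rewrite (csum_single n _ i Hi).
      * rewrite Nat.eqb_refl. ring.
      * intros j Hj Hji. destruct (Nat.eqb_spec j i); [congruence|ring].
Qed.

(** * Integral operators *)

Definition Cint (u : R -> C) : C := RInt (V := C_R_CompleteNormedModule) u 0 (2 * PI).

Definition ex_Cint (u : R -> C) : Prop := ex_RInt (V := C_R_CompleteNormedModule) u 0 (2 * PI).

Lemma ex_RInt_components (u : R -> C) a b : ex_RInt (V := C_R_CompleteNormedModule) u a b ->
  ex_RInt (fun x => fst (u x)) a b /\ ex_RInt (fun x => snd (u x)) a b.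
Proof.
  intros [l Hl]. split.
  - exists (fst l). apply (is_RInt_fct_extend_fst (U := R_NormedModule) (V := R_NormedModule)). exact Hl.
  - exists (snd l). apply (is_RInt_fct_extend_snd (U := R_NormedModule) (V := R_NormedModule)). exact Hl.
Qed.

Lemma Cint_components u : ex_Cint u ->
  Cint u = (RInt (fun x => fst (u x)) 0 (2 * PI), RInt (fun x => snd (u x)) 0 (2 * PI)).
Proof.
  intros H. destruct (ex_RInt_components _ _ _ H) as [H1 H2].
  unfold Cint. apply (is_RInt_unique (V := C_R_CompleteNormedModule)).
  apply (is_RInt_fct_extend_pair (U := R_NormedModule) (V := R_NormedModule)).
  - apply (RInt_correct _ _ _ H1).
  - apply (RInt_correct _ _ _ H2).
Qed.

Lemma ex_RInt_of_components (u : R -> C) a b :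
  ex_RInt (fun x => fst (u x)) a b -> ex_RInt (fun x => snd (u x)) a b ->
  ex_RInt (V := C_R_CompleteNormedModule) u a b.
Proof.
  intros H1 H2.
  exact (ex_RInt_fct_extend_pair (U := R_NormedModule) (V := R_NormedModule) u a b H1 H2).
Qed.

Lemma ex_RInt_real_combination (f g : R -> R) p q a b : ex_RInt f a b -> ex_RInt g a b ->
  ex_RInt (fun x => p * f x + q * g x) a b.
Proof.
  intros Hf Hg. apply (ex_RInt_plus (V := R_NormedModule)).
  - now apply (ex_RInt_scal (V := R_NormedModule)).
  - now apply (ex_RInt_scal (V := R_NormedModule)).
Qed.

Lemma RInt_real_combination (f g : R -> R) p q a b : ex_RInt f a b -> ex_RInt g a b ->
  RInt (fun x => p * f x + q * g x) a b = p * RInt f a b + q * RInt g a b.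
Proof.
  intros Hf Hg.
  rewrite (RInt_plus (V := R_CompleteNormedModule) (fun x => p * f x) (fun x => q * g x)).
  - rewrite (RInt_scal (V := R_CompleteNormedModule) f) by assumption.
    rewrite (RInt_scal (V := R_CompleteNormedModule) g) by assumption. reflexivity.
  - now apply (ex_RInt_scal (V := R_NormedModule)).
  - now apply (ex_RInt_scal (V := R_NormedModule)).
Qed.

(** The integral is taken in C as a normed module over the reals, so a complex factor has to be
    handled through real and imaginary parts. *)
Lemma ex_Cint_scal a u : ex_Cint u -> ex_Cint (fun x => (a * u x)%C).
Proof.
  intros H. destruct (ex_RInt_components _ _ _ H) as [H1 H2].
  apply ex_RInt_of_components.
  - apply ex_RInt_ext with (fun x => fst a * fst (u x) + (- snd a) * snd (u x)).
    + intros x _. simpl. ring.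
    + now apply ex_RInt_real_combination.
  - apply ex_RInt_ext with (fun x => fst a * snd (u x) + snd a * fst (u x)).
    + intros x _. simpl. ring.
    + now apply ex_RInt_real_combination.
Qed.

Lemma Cint_scal a u : ex_Cint u -> Cint (fun x => (a * u x)%C) = (a * Cint u)%C.
Proof.
  intros H. destruct (ex_RInt_components _ _ _ H) as [H1 H2].
  rewrite (Cint_components _ (ex_Cint_scal a u H)), (Cint_components _ H).
  unfold Cmult. simpl. f_equal.
  - transitivity (RInt (fun x => fst a * fst (u x) + (- snd a) * snd (u x)) 0 (2 * PI)).
    + f_equal. apply functional_extensionality. intros x.
      match goal with |- @eq _ ?y ?z => change (@eq R y z) end. ring.
    + rewrite RInt_real_combination by assumption.
      match goal with |- @eq _ ?y ?z => change (@eq R y z) end. ring.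
  - transitivity (RInt (fun x => fst a * snd (u x) + snd a * fst (u x)) 0 (2 * PI)).
    + f_equal.
    + now rewrite RInt_real_combination by assumption.
Qed.

Lemma Cint_plus u v : ex_Cint u -> ex_Cint v -> Cint (fun x => (u x + v x)%C) = (Cint u + Cint v)%C.
Proof. apply (RInt_plus (V := C_R_CompleteNormedModule)). Qed.

Lemma Cint_ext u v : (forall x, u x = v x) -> Cint u = Cint v.
Proof. intros H. unfold Cint. apply (RInt_ext (V := C_R_CompleteNormedModule)). auto. Qed.

Lemma Cint_minus u v : ex_Cint u -> ex_Cint v -> Cint (fun x => (u x - v x)%C) = (Cint u - Cint v)%C.
Proof.
  intros Hu Hv.
  rewrite (Cint_ext _ (fun x => (u x + (- RtoC 1) * v x)%C)) by (intros; ring).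
  rewrite Cint_plus, Cint_scal; [ring| | |]; auto. now apply ex_Cint_scal.
Qed.

Lemma Cint_bound u M : ex_Cint u -> (forall x, 0 <= x <= 2 * PI -> Cmod (u x) <= M) ->
  Cmod (Cint u) <= 2 * PI * M.
Proof.
  intros H HM. pose proof PI_RGT_0.
  (* The norm of the product module is the Euclidean one, so no constant is lost. *)
  assert (Hnorm : forall z : C, norm (V := C_R_NormedModule) z = Cmod z).
  { intros z. unfold norm; simpl. unfold prod_norm, Cmod. f_equal.
    unfold norm; simpl. unfold abs; simpl.
    rewrite !Rmult_1_r, <- !Rabs_mult, !Rabs_pos_eq by nra. reflexivity. }
  rewrite <- Hnorm. replace (2 * PI * M) with ((2 * PI - 0) * M) by ring.
  apply (norm_RInt_le_const (V := C_R_NormedModule) u).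
  - lra.
  - intros x Hx. rewrite Hnorm. auto.
  - apply (RInt_correct (V := C_R_CompleteNormedModule)). exact H.
Qed.

(** Extending [u] by its one-sided limits at and beyond the endpoints gives a continuous function
    with the same values in the open interval. *)
Lemma ex_RInt_continuous_limits (u : R -> C) a b l l' : a < b ->
  (forall x, a < x < b -> Clim (locally x) u (u x)) ->
  Clim (at_right a) u l -> Clim (at_left b) u l' ->
  ex_RInt (V := C_R_CompleteNormedModule) u a b.
Proof.
  intros Hab Hc Hl Hl'.
  set (w := fun x => if Rle_dec x a then l else if Rle_dec b x then l' else u x).
  assert (Hw : forall x, a < x < b -> w x = u x).
  { intros x Hx. unfold w. destruct (Rle_dec x a); [lra|]. destruct (Rle_dec b x); [lra|reflexivity]. }
  assert (Hwl : forall x, x <= a -> w x = l).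
  { intros x Hx. unfold w. destruct (Rle_dec x a); [reflexivity|lra]. }
  assert (Hwr : forall x, b <= x -> w x = l').
  { intros x Hx. unfold w. destruct (Rle_dec x a); [lra|]. destruct (Rle_dec b x); [reflexivity|lra]. }
  apply (ex_RInt_ext (V := C_R_NormedModule) w).
  { intros x. rewrite Rmin_left, Rmax_right by lra. apply Hw. }
  apply (ex_RInt_continuous (V := C_R_CompleteNormedModule)).
  intros x. rewrite Rmin_left, Rmax_right by lra. intros Hx.
  apply (Clim_filterlim (locally x)). apply Clim_locally_iff. intros e He.
  assert (Hz : forall z : C, Cmod (z - z) < e).
  { intros z. replace (z - z)%C with (RtoC 0) by ring. now rewrite Cmod_0. }
  destruct (Req_dec x a) as [->|Hxa].
  - destruct (proj1 (Clim_right_iff _ _ _) Hl e He) as [d [Hd0 Hd]].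
    exists (Rmin d (b - a)). split; [apply Rmin_glb_lt; lra|]. intros y Hy.
    pose proof (Rlt_le_trans _ _ _ Hy (Rmin_l _ _)) as H1.
    pose proof (Rlt_le_trans _ _ _ Hy (Rmin_r _ _)) as H2.
    apply Rabs_lt_between in H1. apply Rabs_lt_between in H2.
    rewrite (Hwl a) by lra. destruct (Rle_dec y a).
    + rewrite Hwl by lra. apply Hz.
    + rewrite Hw by lra. apply Hd. lra.
  - destruct (Req_dec x b) as [->|Hxb].
    + destruct (proj1 (Clim_left_iff _ _ _) Hl' e He) as [d [Hd0 Hd]].
      exists (Rmin d (b - a)). split; [apply Rmin_glb_lt; lra|]. intros y Hy.
      pose proof (Rlt_le_trans _ _ _ Hy (Rmin_l _ _)) as H1.
      pose proof (Rlt_le_trans _ _ _ Hy (Rmin_r _ _)) as H2.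
      apply Rabs_lt_between in H1. apply Rabs_lt_between in H2.
      rewrite (Hwr b) by lra. destruct (Rle_dec b y).
      * rewrite Hwr by lra. apply Hz.
      * rewrite Hw by lra. apply Hd. lra.
    + destruct (proj1 (Clim_locally_iff _ _ _) (Hc x ltac:(lra)) e He) as [d [Hd0 Hd]].
      exists (Rmin d (Rmin (b - x) (x - a))).
      split; [repeat apply Rmin_glb_lt; lra|]. intros y Hy.
      pose proof (Rlt_le_trans _ _ _ Hy (Rmin_l _ _)) as H1.
      pose proof (Rlt_le_trans _ _ _ Hy (Rmin_r _ _)) as H2.
      pose proof (Rlt_le_trans _ _ _ H2 (Rmin_l _ _)) as H3.
      pose proof (Rlt_le_trans _ _ _ H2 (Rmin_r _ _)) as H4.
      apply Rabs_lt_between in H3. apply Rabs_lt_between in H4.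
      rewrite !Hw by lra. now apply Hd.
Qed.

(** The integrands: continuity is demanded on the closed period, so the cut at 0 and [2 * PI] is not
    a break. The class is closed under products, unlike mere integrability. *)
Definition pwc (nd : nat) (thd : nat -> R) (u : R -> C) : Prop :=
  (forall x, 0 <= x <= 2 * PI -> (forall j, (1 <= j <= nd)%nat -> x <> thd j) ->
     Clim (locally x) u (u x)) /\
  (forall j, (1 <= j <= nd)%nat ->
     (exists l, Clim (at_right (thd j)) u l) /\ (exists l, Clim (at_left (thd j)) u l)).

Lemma pwc_continuous nd thd u : (forall x, Clim (locally x) u (u x)) -> pwc nd thd u.
Proof.
  intros H. split; auto. intros j _. split; exists (u (thd j)).
  - now apply Clim_locally_right.
  - now apply Clim_locally_left.
Qed.

Lemma pwc_plus nd thd u v : pwc nd thd u -> pwc nd thd v -> pwc nd thd (fun x => (u x + v x)%C).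
Proof.
  intros [Hu Lu] [Hv Lv]. split.
  - intros x Hx Hj. apply Clim_plus; auto. apply locally_filter.
  - intros j Hj. destruct (Lu j Hj) as [[l1 H1] [l2 H2]]. destruct (Lv j Hj) as [[l3 H3] [l4 H4]].
    split; [exists (l1 + l3)%C|exists (l2 + l4)%C]; apply Clim_plus; auto;
      apply within_filter; apply locally_filter.
Qed.

Lemma pwc_mult nd thd u v : pwc nd thd u -> pwc nd thd v -> pwc nd thd (fun x => (u x * v x)%C).
Proof.
  intros [Hu Lu] [Hv Lv]. split.
  - intros x Hx Hj. apply Clim_mult; auto. apply locally_filter.
  - intros j Hj. destruct (Lu j Hj) as [[l1 H1] [l2 H2]]. destruct (Lv j Hj) as [[l3 H3] [l4 H4]].
    split; [exists (l1 * l3)%C|exists (l2 * l4)%C]; apply Clim_mult; auto;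
      apply within_filter; apply locally_filter.
Qed.

Lemma break_params_increasing nd thd : break_params nd thd ->
  forall i j, (1 <= i)%nat -> (i < j)%nat -> (j <= nd)%nat -> thd i < thd j.
Proof.
  intros [_ [_ [_ H]]] i j Hi Hij. induction Hij; intros Hj.
  - apply H; lia.
  - apply Rlt_trans with (thd m); [apply IHHij; lia|apply H; lia].
Qed.

Lemma break_params_range nd thd : break_params nd thd ->
  forall j, (1 <= j <= nd)%nat -> 0 < thd j < 2 * PI.
Proof.
  intros Hb j Hj. pose proof (break_params_increasing nd thd Hb) as Hi.
  destruct Hb as [H1 [H2 [H3 _]]].
  split.
  - destruct (Nat.eq_dec j 1) as [->|]; [assumption|].
    apply Rlt_trans with (thd 1%nat); [assumption|]. apply Hi; lia.
  - destruct (Nat.eq_dec j nd) as [->|]; [assumption|].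
    apply Rlt_trans with (thd nd); [|assumption]. apply Hi; lia.
Qed.

Lemma pwc_ex_Cint nd thd u : break_params nd thd -> pwc nd thd u -> ex_Cint u.
Proof.
  intros Hb [Hc Hl]. pose proof (break_params_increasing nd thd Hb) as Hi.
  pose proof (break_params_range nd thd Hb) as Hr.
  destruct Hb as [H1 [H2 [H3 H4]]]. pose proof PI_RGT_0.
  pose proof (Hr 1%nat ltac:(lia)) as Hr1. pose proof (Hr nd ltac:(lia)) as Hrn.
  assert (Hne : forall k, (1 <= k < nd)%nat -> forall x, thd k < x < thd (S k) ->
     forall j, (1 <= j <= nd)%nat -> x <> thd j).
  { intros k Hk x Hx j Hj ->. destruct (Nat.lt_trichotomy j k) as [H'|[->|H']].
    - pose proof (Hi j k ltac:(lia) H' ltac:(lia)). lra.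
    - lra.
    - destruct (Nat.eq_dec j (S k)) as [->|]; [lra|].
      pose proof (Hi (S k) j ltac:(lia) ltac:(lia) ltac:(lia)). lra. }
  assert (Hlo : forall x, x < thd 1%nat -> forall j, (1 <= j <= nd)%nat -> x <> thd j).
  { intros x Hx j Hj ->. destruct (Nat.eq_dec j 1) as [->|]; [lra|].
    pose proof (Hi 1%nat j ltac:(lia) ltac:(lia) ltac:(lia)). lra. }
  assert (Hhi : forall x, thd nd < x -> forall j, (1 <= j <= nd)%nat -> x <> thd j).
  { intros x Hx j Hj ->. destruct (Nat.eq_dec j nd) as [->|]; [lra|].
    pose proof (Hi j nd ltac:(lia) ltac:(lia) ltac:(lia)). lra. }
  assert (Hk : forall k, (1 <= k)%nat -> (k <= nd)%nat ->
    ex_RInt (V := C_R_CompleteNormedModule) u 0 (thd k)).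
  { induction 1 as [|k Hk IH]; intros Hkn.
    - destruct (Hl 1%nat ltac:(lia)) as [_ [l Hl']].
      apply ex_RInt_continuous_limits with (u 0) l; auto.
      + intros x Hx. apply Hc; [lra|]. apply Hlo. lra.
      + apply Clim_locally_right. apply Hc; [lra|]. now apply Hlo.
    - apply (ex_RInt_Chasles (V := C_R_NormedModule)) with (thd k).
      + apply IH. lia.
      + destruct (Hl k ltac:(lia)) as [[l Hl1] _].
        destruct (Hl (S k) ltac:(lia)) as [_ [l' Hl2]].
        apply ex_RInt_continuous_limits with l l'; auto.
        intros x Hx. pose proof (Hr k ltac:(lia)). pose proof (Hr (S k) ltac:(lia)).
        apply Hc; [lra|]. apply (Hne k); [lia|lra]. }
  apply (ex_RInt_Chasles (V := C_R_NormedModule)) with (thd nd).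
  - apply Hk; lia.
  - destruct (Hl nd ltac:(lia)) as [[l Hl1] _].
    apply ex_RInt_continuous_limits with l (u (2 * PI)); auto.
    + intros x Hx. pose proof (Hr nd ltac:(lia)). apply Hc; [lra|]. apply Hhi. lra.
    + apply Clim_locally_left. apply Hc; [lra|]. now apply Hhi.
Qed.

(** * Integral operators with a Hoelder kernel *)

Section Operator.

Variables (nd : nat) (thd : nat -> R).
Hypothesis Hthd : break_params nd thd.
Variables (kappa : R -> R -> C) (M0 M1 mu : R).
Hypothesis M0pos : 0 <= M0.
Hypothesis M1pos : 0 <= M1.
Hypothesis Kpwc : forall x, pwc nd thd (kappa x).
Hypothesis Kbnd : forall x y, Cmod (kappa x y) <= M0.
Hypothesis Khold : forall x x' y, Cmod (kappa x y - kappa x' y)%C <= M1 * rpow (Rabs (x - x')) mu.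

Definition Aop (u : R -> C) (x : R) : C := Cint (fun y => (kappa x y * u y)%C).

Let Aint u x : pwc nd thd u -> ex_Cint (fun y => (kappa x y * u y)%C).
Proof. intros Hu. apply (pwc_ex_Cint nd thd); auto. now apply pwc_mult. Qed.

Lemma Aop_linear u v a : pwc nd thd u -> pwc nd thd v ->
  forall x, Aop (fun y => (u y + a * v y)%C) x = (Aop u x + a * Aop v x)%C.
Proof.
  intros Hu Hv x. unfold Aop.
  rewrite (Cint_ext _ (fun y => (kappa x y * u y + a * (kappa x y * v y))%C)) by (intros; ring).
  rewrite Cint_plus, Cint_scal; auto. now apply ex_Cint_scal; auto.
Qed.

Lemma Aop_sup u B : pwc nd thd u -> (forall y, 0 <= y <= 2 * PI -> Cmod (u y) <= B) ->
  bnd (Aop u) (2 * PI * M0 * B).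
Proof.
  intros Hu HB x. rewrite Rmult_assoc. apply Cint_bound; auto.
  intros y Hy. rewrite Cmod_mult. apply Rmult_le_compat; try apply Cmod_ge_0; auto.
Qed.

Lemma Aop_increment u B x x' : pwc nd thd u -> (forall y, 0 <= y <= 2 * PI -> Cmod (u y) <= B) ->
  Cmod (Aop u x - Aop u x')%C <= 2 * PI * M1 * B * rpow (Rabs (x - x')) mu.
Proof.
  intros Hu HB. unfold Aop. rewrite <- Cint_minus by auto.
  replace (2 * PI * M1 * B * rpow (Rabs (x - x')) mu)
    with (2 * PI * ((M1 * rpow (Rabs (x - x')) mu) * B)) by ring.
  apply Cint_bound.
  - apply (pwc_ex_Cint nd thd); auto.
    apply (eq_ind (fun y => ((kappa x y + (- RtoC 1) * kappa x' y) * u y)%C)).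
    + apply pwc_mult; auto. apply pwc_plus; auto. apply pwc_mult; auto.
      apply pwc_continuous. intros z. apply Clim_const, locally_filter.
    + apply functional_extensionality. intros y. ring.
  - intros y Hy. replace (kappa x y * u y - kappa x' y * u y)%C
      with ((kappa x y - kappa x' y) * u y)%C by ring.
    rewrite Cmod_mult. apply Rmult_le_compat; try apply Cmod_ge_0; auto.
Qed.

(** For distances up to 1 the exponent [mu] may be lowered to [s]; for larger ones the sup bound is
    used twice and the power is at least 1. One constant thus serves every exponent up to [mu]. *)
Lemma Aop_holder u B s : 0 < s -> s <= mu -> pwc nd thd u ->
  (forall y, 0 <= y <= 2 * PI -> Cmod (u y) <= B) ->
  holder everywhere s (2 * PI * (2 * M0 + M1) * B) (Aop u).
Proof.
  intros Hs Hsm Hu HB x y _ _. pose proof PI_RGT_0 as HP.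
  assert (B0 : 0 <= B) by (apply Rle_trans with (2 := HB 0 ltac:(lra)); apply Cmod_ge_0).
  set (d := Rabs (x - y)). assert (Hd : 0 <= d) by apply Rabs_pos.
  assert (H0 : 0 <= 2 * PI * M0 * B)
    by (apply Rmult_le_pos; [apply Rmult_le_pos; [lra|assumption]|assumption]).
  assert (H1 : 0 <= 2 * PI * M1 * B)
    by (apply Rmult_le_pos; [apply Rmult_le_pos; [lra|assumption]|assumption]).
  pose proof (rpow_ge_0 d s) as Hr.
  replace (2 * PI * (2 * M0 + M1) * B) with (2 * (2 * PI * M0 * B) + 2 * PI * M1 * B) by ring.
  destruct (Rle_dec d 1) as [Hd1|Hd1].
  - eapply Rle_trans; [apply (Aop_increment u B); assumption|]. fold d.
    assert (rpow d mu <= rpow d s) by (apply rpow_small; lra).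
    assert (0 <= 2 * (2 * PI * M0 * B) * rpow d s) by (apply Rmult_le_pos; lra).
    assert (2 * PI * M1 * B * rpow d mu <= 2 * PI * M1 * B * rpow d s)
      by (apply Rmult_le_compat_l; assumption).
    lra.
  - apply Rle_trans with (1 := Cmod_sub_le _ _).
    pose proof (Aop_sup u B Hu HB x). pose proof (Aop_sup u B Hu HB y).
    assert (1 <= rpow d s) by (apply rpow_ge_1; lra).
    assert (2 * (2 * PI * M0 * B) * 1 <= 2 * (2 * PI * M0 * B) * rpow d s)
      by (apply Rmult_le_compat_l; lra).
    assert (0 <= 2 * PI * M1 * B * rpow d s) by (apply Rmult_le_pos; lra).
    lra.
Qed.

End Operator.

(** * Hoelder functions *)

Lemma holder_concat u s A B p q r : 0 < s -> 0 <= A -> 0 <= B ->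
  holder (fun x => p <= x <= q) s A u -> holder (fun x => q <= x <= r) s B u ->
  holder (fun x => p <= x <= r) s (A + B) u.
Proof.
  intros Hs HA HB H1 H2.
  assert (Hw : forall x y, p <= x <= r -> p <= y <= r -> x <= y ->
    Cmod (u x - u y)%C <= (A + B) * rpow (Rabs (x - y)) s).
  { intros x y Hx Hy Hxy. pose proof (rpow_ge_0 (Rabs (x - y)) s) as Hr.
    rewrite (Rabs_left1 (x - y)) in * by lra.
    destruct (Rle_dec y q) as [Hyq|Hyq].
    - pose proof (H1 x y ltac:(lra) ltac:(lra)) as H. rewrite Rabs_left1 in H by lra. nra.
    - destruct (Rle_dec q x) as [Hqx|Hqx].
      + pose proof (H2 x y ltac:(lra) ltac:(lra)) as H. rewrite Rabs_left1 in H by lra. nra.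
      + apply Rle_trans with (1 := Cmod_sub_triangle _ (u q) _).
        pose proof (H1 x q ltac:(lra) ltac:(lra)) as Ha. rewrite Rabs_left1 in Ha by lra.
        pose proof (H2 q y ltac:(lra) ltac:(lra)) as Hb. rewrite Rabs_left1 in Hb by lra.
        pose proof (rpow_mono (- (x - q)) (- (x - y)) s Hs ltac:(lra) ltac:(lra)).
        pose proof (rpow_mono (- (q - y)) (- (x - y)) s Hs ltac:(lra) ltac:(lra)).
        nra. }
  intros x y Hx Hy. destruct (Rle_dec x y); [now apply Hw|].
  rewrite Cmod_sub_sym, Rabs_minus_sym. apply Hw; auto; lra.
Qed.

(** Two points less than a period apart are separated by at most one endpoint of a period interval,
    whence the factor 2. Points further apart are brought closer by periodicity, which only shrinks
    the right-hand side. *)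
Lemma holder_periodic u s A a : 0 < s -> 0 <= A -> (forall x, u (x + 2 * PI) = u x) ->
  holder (fun x => a <= x <= a + 2 * PI) s A u -> holder everywhere s (2 * A) u.
Proof.
  intros Hs HA Hp H. pose proof PI_RGT_0 as HP.
  assert (Hw1 : forall x y, x <= y < x + 2 * PI -> Cmod (u x - u y)%C <= 2 * A * rpow (y - x) s).
  { intros x y Hxy. destruct (period_reduction a x) as [k Hk].
    rewrite <- (periodic_IZR u Hp k x), <- (periodic_IZR u Hp k y).
    replace (y - x) with (y + 2 * PI * IZR k - (x + 2 * PI * IZR k)) by ring.
    set (x' := x + 2 * PI * IZR k) in *. set (y' := y + 2 * PI * IZR k).
    assert (Hxy' : x' <= y' < x' + 2 * PI) by (unfold x', y'; lra).
    pose proof (rpow_ge_0 (y' - x') s) as Hr.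
    destruct (Rle_dec y' (a + 2 * PI)).
    - pose proof (H x' y' ltac:(lra) ltac:(lra)) as H1. rewrite Rabs_left1 in H1 by lra.
      replace (- (x' - y')) with (y' - x') in H1 by ring. nra.
    - apply Rle_trans with (1 := Cmod_sub_triangle _ (u (a + 2 * PI)) _).
      pose proof (H x' (a + 2 * PI) ltac:(lra) ltac:(lra)) as H1. rewrite Rabs_left1 in H1 by lra.
      rewrite Hp in H1 |- *.
      pose proof (H a (y' - 2 * PI) ltac:(lra) ltac:(lra)) as H2. rewrite Rabs_left1 in H2 by lra.
      rewrite <- (Hp (y' - 2 * PI)) in H2. replace (y' - 2 * PI + 2 * PI) with y' in H2 by ring.
      pose proof (rpow_mono (- (x' - (a + 2 * PI))) (y' - x') s Hs ltac:(lra) ltac:(lra)).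
      pose proof (rpow_mono (- (a - (y' - 2 * PI))) (y' - x') s Hs ltac:(lra) ltac:(lra)).
      nra. }
  assert (Hw2 : forall x y, x <= y -> Cmod (u x - u y)%C <= 2 * A * rpow (y - x) s).
  { intros x y Hxy. destruct (period_reduction x y) as [k Hk].
    rewrite <- (periodic_IZR u Hp k y). eapply Rle_trans; [now apply Hw1|].
    apply Rmult_le_compat_l; [lra|]. apply rpow_mono; [assumption|lra|].
    assert (IZR k <= 0).
    { apply IZR_le. apply Z.lt_succ_r. apply lt_IZR. rewrite succ_IZR.
      nra. }
    nra. }
  intros x y _ _. destruct (Rle_dec x y).
  - rewrite Rabs_left1 by lra. replace (- (x - y)) with (y - x) by ring. now apply Hw2.
  - rewrite Rabs_pos_eq, Cmod_sub_sym by lra. apply Hw2. lra.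
Qed.

(** The estimate passes to one-sided limits; monotonicity of the power allows the distance to be
    replaced by the limiting one beforehand. *)
Lemma holder_closure u s M a b : a < b -> 0 < s -> 0 <= M ->
  holder (fun x => a < x < b) s M u -> Clim (at_right a) u (u a) -> Clim (at_left b) u (u b) ->
  holder (fun x => a <= x <= b) s M u.
Proof.
  intros Hab Hs HM H Ha Hb.
  assert (Hlim : forall (F : (R -> Prop) -> Prop) (FF : ProperFilter F) l z N, Clim F u l ->
    F (fun x => Cmod (u x - z)%C <= N) -> Cmod (l - z)%C <= N).
  { intros F FF l z N Hl HN. apply (Clim_le F (fun x => (u x + - z)%C)); [|exact HN].
    apply Clim_plus; [apply FF|assumption|apply Clim_const, FF]. }
  assert (Ha' : forall y, a < y < b -> Cmod (u a - u y)%C <= M * rpow (y - a) s).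
  { intros y Hy. apply (Hlim (at_right a) _ _ _ _ Ha).
    generalize (near_right a y ltac:(lra)). apply filter_imp. intros x Hx.
    pose proof (H x y ltac:(lra) ltac:(lra)) as H1. rewrite Rabs_left1 in H1 by lra.
    eapply Rle_trans; [exact H1|]. apply Rmult_le_compat_l; [assumption|]. apply rpow_mono; lra. }
  assert (Hb' : forall y, a < y < b -> Cmod (u b - u y)%C <= M * rpow (b - y) s).
  { intros y Hy. apply (Hlim (at_left b) _ _ _ _ Hb).
    generalize (near_left y b ltac:(lra)). apply filter_imp. intros x Hx.
    pose proof (H x y ltac:(lra) ltac:(lra)) as H1. rewrite Rabs_pos_eq in H1 by lra.
    eapply Rle_trans; [exact H1|]. apply Rmult_le_compat_l; [assumption|]. apply rpow_mono; lra. }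
  assert (Hab' : Cmod (u a - u b)%C <= M * rpow (b - a) s).
  { apply (Hlim (at_right a) _ _ _ _ Ha).
    generalize (near_right a b Hab). apply filter_imp. intros x Hx. rewrite Cmod_sub_sym.
    eapply Rle_trans; [apply Hb'; assumption|].
    apply Rmult_le_compat_l; [assumption|]. apply rpow_mono; lra. }
  assert (Hz : forall x, Cmod (u x - u x)%C <= M * rpow (Rabs (x - x)) s).
  { intros x. replace (u x - u x)%C with (RtoC 0) by ring. rewrite Cmod_0.
    apply Rmult_le_pos; [assumption|apply rpow_ge_0]. }
  assert (Hw : forall x y, a <= x <= b -> a <= y <= b -> x <= y ->
    Cmod (u x - u y)%C <= M * rpow (Rabs (x - y)) s).
  { intros x y Hx Hy Hxy.
    destruct (Req_dec x y) as [->|Hn]; [apply Hz|].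
    destruct (Req_dec x a) as [->|Hxa]; destruct (Req_dec y b) as [->|Hyb].
    - rewrite Rabs_left1 by lra. replace (- (a - b)) with (b - a) by ring. assumption.
    - rewrite Rabs_left1 by lra. replace (- (a - y)) with (y - a) by ring. apply Ha'. lra.
    - rewrite Rabs_left1 by lra. replace (- (x - b)) with (b - x) by ring.
      rewrite Cmod_sub_sym. apply Hb'. lra.
    - apply H; lra. }
  intros x y Hx Hy. destruct (Rle_dec x y); [now apply Hw|].
  rewrite Cmod_sub_sym, Rabs_minus_sym. apply Hw; auto; lra.
Qed.

Lemma Clim_locally_shift v x c l : Clim (locally x) v l ->
  Clim (locally (x + c)) (fun y => v (y - c)) l.
Proof.
  intros H. apply Clim_locally_iff. intros e He.
  destruct (proj1 (Clim_locally_iff _ _ _) H e He) as [d [Hd0 Hd]].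
  exists d. split; [assumption|]. intros y Hy. apply Hd.
  replace (y - c - x) with (y - (x + c)) by ring. assumption.
Qed.

Lemma Clim_left_shift v x c l : Clim (at_left x) v l ->
  Clim (at_left (x + c)) (fun y => v (y - c)) l.
Proof.
  intros H. apply Clim_left_iff. intros e He.
  destruct (proj1 (Clim_left_iff _ _ _) H e He) as [d [Hd0 Hd]].
  exists d. split; [assumption|]. intros y Hy. apply Hd. lra.
Qed.

Lemma periodic_shift_eq (v : R -> C) (k : Z) : (forall x, v (x + 2 * PI) = v x) ->
  (fun y => v (y - 2 * PI * IZR k)) = v.
Proof.
  intros H. apply functional_extensionality. intros y.
  rewrite <- (periodic_IZR v H k (y - 2 * PI * IZR k)). f_equal. ring.
Qed.

Lemma holder_plus D s A B u v : holder D s A u -> holder D s B v ->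
  holder D s (A + B) (fun x => (u x + v x)%C).
Proof.
  intros Hu Hv x y Hx Hy.
  replace (u x + v x - (u y + v y))%C with ((u x - u y) + (v x - v y))%C by ring.
  apply Rle_trans with (1 := Cmod_triangle _ _).
  specialize (Hu x y Hx Hy). specialize (Hv x y Hx Hy). lra.
Qed.

Lemma holder_minus D s A B u v : holder D s A u -> holder D s B v ->
  holder D s (A + B) (fun x => (u x - v x)%C).
Proof.
  intros Hu Hv x y Hx Hy.
  replace (u x - v x - (u y - v y))%C with ((u x - u y) - (v x - v y))%C by ring.
  apply Rle_trans with (1 := Cmod_sub_le _ _).
  specialize (Hu x y Hx Hy). specialize (Hv x y Hx Hy). lra.
Qed.

Lemma holder_mult D s A B P Q u v : 0 <= A -> 0 <= B ->
  (forall x, D x -> Cmod (u x) <= P) -> (forall x, D x -> Cmod (v x) <= Q) ->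
  holder D s A u -> holder D s B v ->
  holder D s (A * Q + P * B) (fun x => (u x * v x)%C).
Proof.
  intros HA HB HP HQ Hu Hv x y Hx Hy.
  replace (u x * v x - u y * v y)%C with ((u x - u y) * v x + u y * (v x - v y))%C by ring.
  apply Rle_trans with (1 := Cmod_triangle _ _). rewrite !Cmod_mult.
  pose proof (Hu x y Hx Hy) as H1. pose proof (Hv x y Hx Hy) as H2.
  pose proof (HP y Hy) as H3. pose proof (HQ x Hx) as H4.
  pose proof (Cmod_ge_0 (u y)). pose proof (Cmod_ge_0 (v x)).
  pose proof (Cmod_ge_0 (u x - u y)). pose proof (Cmod_ge_0 (v x - v y)).
  pose proof (Rmult_le_compat _ _ _ _ H5 H0 H1 H4).
  pose proof (Rmult_le_compat _ _ _ _ H H6 H3 H2).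
  lra.
Qed.

Lemma holder_inv D s A c0 u : 0 <= A -> 0 < c0 -> (forall x, D x -> c0 <= Cmod (u x)) ->
  holder D s A u -> holder D s (A / (c0 * c0)) (fun x => (/ u x)%C).
Proof.
  intros HA Hc Hl Hu x y Hx Hy.
  pose proof (Hl x Hx) as H1. pose proof (Hl y Hy) as H2.
  assert (u x <> RtoC 0) by (apply Cmod_gt_0; lra).
  assert (u y <> RtoC 0) by (apply Cmod_gt_0; lra).
  replace (/ u x - / u y)%C with ((u y - u x) * (/ u x * / u y))%C by (field; auto).
  rewrite !Cmod_mult, !Cmod_inv by assumption. rewrite Cmod_sub_sym.
  pose proof (Hu x y Hx Hy) as H3. pose proof (Cmod_ge_0 (u x - u y)).
  replace (A / (c0 * c0) * rpow (Rabs (x - y)) s) with (A * rpow (Rabs (x - y)) s * (/ c0 * / c0))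
    by (field; lra).
  apply Rmult_le_compat; [assumption| |assumption|].
  - apply Rmult_le_pos; left; apply Rinv_0_lt_compat; lra.
  - apply Rmult_le_compat; try (left; apply Rinv_0_lt_compat; lra);
      apply Rinv_le_contravar; lra.
Qed.

Lemma holder_weaken D s A B u : A <= B -> holder D s A u -> holder D s B u.
Proof.
  intros H Hu x y Hx Hy. eapply Rle_trans; [now apply Hu|].
  apply Rmult_le_compat_r; [apply rpow_ge_0|assumption].
Qed.

Lemma holder_ext D s A u v : (forall x, D x -> u x = v x) -> holder D s A u -> holder D s A v.
Proof. intros H Hu x y Hx Hy. rewrite <- !H by assumption. now apply Hu. Qed.

Lemma holder_restrict (D D' : R -> Prop) s A u : (forall x, D' x -> D x) ->
  holder D s A u -> holder D' s A u.
Proof. intros H Hu x y Hx Hy. apply Hu; auto. Qed.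

(** After division by [2 * PI] distances are at most 1, where the smaller exponent gives the larger
    power. The remaining factor [(2 PI)^s] is at most [2 * PI] because [s <= 1]. *)
Lemma holder_lower_exponent a b s t A u : 0 < t -> t <= s -> s <= 1 -> 0 <= A -> b <= a + 2 * PI ->
  holder (fun x => a <= x <= b) s A u -> holder (fun x => a <= x <= b) t (A * (2 * PI)) u.
Proof.
  intros Ht Hts Hs1 HA Hab Hu x y Hx Hy. eapply Rle_trans; [now apply Hu|].
  rewrite Rmult_assoc. apply Rmult_le_compat_l; [assumption|].
  pose proof PI2_3_2 as HP.
  set (d := Rabs (x - y)). assert (Hd : 0 <= d <= 2 * PI).
  { split; [apply Rabs_pos|]. apply Rabs_le. lra. }
  replace d with (2 * PI * (d / (2 * PI))) by (field; lra).
  assert (H1 : 0 <= d / (2 * PI)) by (apply Rdiv_le_0_compat; lra).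
  assert (H2 : d / (2 * PI) <= 1).
  { apply Rmult_le_reg_r with (2 * PI); [lra|]. unfold Rdiv. rewrite Rmult_assoc, Rinv_l; lra. }
  rewrite (rpow_mult (2 * PI) (d / (2 * PI)) s), (rpow_mult (2 * PI) (d / (2 * PI)) t) by lra.
  assert (H3 : rpow (2 * PI) s <= 2 * PI).
  { rewrite rpow_pos_eq by lra. rewrite <- (Rpower_1 (2 * PI)) at 2 by lra. apply Rle_Rpower; lra. }
  pose proof (rpow_small (d / (2 * PI)) s t ltac:(lra) Hts) as H4.
  pose proof (rpow_ge_1 (2 * PI) t ltac:(lra) ltac:(lra)) as H5.
  pose proof (rpow_ge_0 (d / (2 * PI)) s). pose proof (rpow_ge_0 (d / (2 * PI)) t).
  pose proof (rpow_ge_0 (2 * PI) s).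
  apply Rle_trans with (2 * PI * rpow (d / (2 * PI)) t).
  - apply Rmult_le_compat; assumption.
  - apply Rmult_le_compat_l; [lra|]. nra.
Qed.

(** * Collocation error *)

(* Both stability and convergence: [s = spl a] interpolates [v = u - A E], [E] being the error,
   so that [E - A E = v - s]. *)
Lemma collocation_error (A : (R -> C) -> R -> C) (M Kf alpha beta : R)
  (Hbeta : 0 < beta) (Hba : beta < alpha) (Ha1 : alpha <= 1) (HM : 0 <= M) (HKf : 0 <= Kf)
  (Asub : forall u v, CP u -> CP v -> forall x, A (fun y => (u y - v y)%C) x = (A u x - A v x)%C)
  (ACP : forall u, CP u -> CP (A u))
  (Aalpha : forall u B, CP u -> bnd u B -> holder everywhere alpha (M * B) (A u))
  (Abeta : forall u B, CP u -> bnd u B -> holder everywhere beta (M * B) (A u))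
  (Apriori : forall u G, CP u -> bnd (fun x => (u x - A u x)%C) G -> bnd u (Kf * G)) :
  exists K h0, 0 < K /\ 0 < h0 /\ h0 <= 1 /\
    forall m n rho, (m = 2 \/ m = 3 \/ m = 4)%nat -> (5 <= n)%nat -> mesh n < h0 ->
    forall u H a, CP u -> 0 <= H -> holder everywhere alpha H u ->
      (forall i, (i < n)%nat ->
         (spl m n rho a (node n rho i) - A (spl m n rho a) (node n rho i))%C =
         (u (node n rho i) - A u (node n rho i))%C) ->
      bnd (fun x => (u x - spl m n rho a x)%C) (K * rpow (mesh n) (alpha - beta) * H) /\
      holder everywhere beta (K * rpow (mesh n) (alpha - beta) * H)
        (fun x => (u x - spl m n rho a x)%C).
Proof.
  (* For meshes below [d], [12 * (Kf * M) * h^alpha] is at most 1/2: this is the factor of the error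
     in its own a priori bound. *)
  destruct (rpow_small_radius alpha 1 (24 * (Kf * M) + 1)) as [d [Hd0 Hd]]; [lra|lra|].
  (* [K1] is the absorbed sup norm constant, twice [12 * Kf]. In [K2], [M * K1] comes from [A E],
     and the multiple of 121 from interpolating [v = u - A E], whose Hoelder constant is at most
     [(1 + M * K1) * H]. *)
  set (K1 := 24 * Kf). set (K2 := M * K1 + 121 * (1 + M * K1)).
  assert (HKM : 0 <= Kf * M) by (apply Rmult_le_pos; assumption).
  assert (HMK : 0 <= M * K1) by (unfold K1; apply Rmult_le_pos; lra).
  exists (K1 + K2), (Rmin d 1). split; [unfold K2, K1 in *; lra|].
  split; [apply Rmin_glb_lt; lra|]. split; [apply Rmin_r|].
  intros m n rho Hm Hn Hh u H a Hu H0 HH Hcol.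
  pose proof (mesh_pos n Hn) as Hh0.
  assert (Hhd : mesh n < d) by (apply Rlt_le_trans with (1 := Hh), Rmin_l).
  assert (Hh1 : mesh n < 1) by (apply Rlt_le_trans with (1 := Hh), Rmin_r).
  set (h := mesh n) in *. set (s := spl m n rho a) in *.
  set (E := fun x => (u x - s x)%C).
  assert (Hs : CP s) by now apply spl_CP.
  assert (HE : CP E) by now apply CP_minus.
  set (v := fun x => (u x - A E x)%C).
  assert (Hv : CP v) by (apply CP_minus; auto).
  assert (Hint : forall i, (i < n)%nat -> s (node n rho i) = v (node n rho i)).
  { intros i Hi. unfold v. unfold E. rewrite Asub by assumption.
    replace (u (node n rho i) - (A u (node n rho i) - A s (node n rho i)))%C
      with ((u (node n rho i) - A u (node n rho i)) + A s (node n rho i))%C by ring.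
    rewrite <- Hcol by assumption. ring. }
  pose proof (rpow_ge_0 h alpha) as Hra. pose proof (rpow_ge_0 h (alpha - beta)) as Hrab.
  assert (Hv_err : forall B, 0 <= B -> bnd E B ->
    (forall x, Cmod (v x - s x)%C <= 12 * (H + M * B) * rpow h alpha) /\
    holder everywhere beta (121 * (H + M * B) * rpow h (alpha - beta)) (fun x => (v x - s x)%C)).
  { intros B HB0 HB. apply spl_interpolation_error; auto; try lra.
    - assert (0 <= M * B) by (apply Rmult_le_pos; assumption). lra.
    - apply Hv.
    - apply holder_minus; auto. }
  assert (Hvs : forall x, (E x - A E x)%C = (v x - s x)%C) by (intros x; unfold v, E; ring).
  assert (HEsup : bnd E (2 * (12 * Kf * H * rpow h alpha))).
  { destruct (CP_bounded E HE) as [B0 [HB00 HB0]].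
    intros x. apply (absorb_half (fun x => Cmod (E x)) (12 * Kf * H * rpow h alpha) B0 HB0).
    intros B HB. assert (HBp : 0 <= B) by (apply Rle_trans with (2 := HB 0); apply Cmod_ge_0).
    destruct (Hv_err B HBp HB) as [H1 _].
    assert (H2 : bnd E (Kf * (12 * (H + M * B) * rpow h alpha))).
    { apply Apriori; auto. intros y. rewrite Hvs. apply H1. }
    intros y. eapply Rle_trans; [apply H2|].
    assert (H3 : (24 * (Kf * M) + 1) * rpow h alpha <= 1).
    { left. apply Hd; lra. }
    assert (H4 : 12 * (Kf * M) * rpow h alpha <= / 2) by nra.
    assert (H5 : 12 * (Kf * M) * rpow h alpha * B <= / 2 * B) by (apply Rmult_le_compat_r; assumption).
    lra. }
  set (B := K1 * H * rpow h alpha).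
  assert (HB : bnd E B) by (intros x; unfold B, K1; specialize (HEsup x); lra).
  assert (HB0 : 0 <= B) by (apply Rle_trans with (2 := HB 0); apply Cmod_ge_0).
  assert (Hr1 : rpow h alpha <= rpow h (alpha - beta)) by (apply rpow_small; lra).
  assert (Hr2 : rpow h alpha <= 1).
  { apply Rle_trans with (rpow 1 alpha); [apply rpow_mono; lra|].
    rewrite rpow_pos_eq by lra. unfold Rpower. rewrite ln_1, Rmult_0_r, exp_0. lra. }
  assert (HK1 : 0 <= K1) by (unfold K1; lra).
  assert (HHr : 0 <= H * rpow h (alpha - beta)) by (apply Rmult_le_pos; assumption).
  assert (HB1 : B <= K1 * (H * rpow h (alpha - beta))).
  { unfold B. rewrite Rmult_assoc. apply Rmult_le_compat_l; [assumption|].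
    apply Rmult_le_compat_l; assumption. }
  assert (HB2 : B <= K1 * H).
  { unfold B. rewrite <- (Rmult_1_r (K1 * H)) at 2. apply Rmult_le_compat_l; [|assumption].
    apply Rmult_le_pos; assumption. }
  assert (HK2 : 0 <= K2) by (unfold K2; lra).
  split.
  - intros x. eapply Rle_trans; [apply HB|].
    replace ((K1 + K2) * rpow h (alpha - beta) * H)
      with (K1 * (H * rpow h (alpha - beta)) + K2 * (H * rpow h (alpha - beta))) by ring.
    assert (0 <= K2 * (H * rpow h (alpha - beta))) by (apply Rmult_le_pos; assumption). lra.
  - destruct (Hv_err B HB0 HB) as [_ H2].
    apply holder_ext with (fun x => (A E x + (v x - s x))%C).
    { intros x _. rewrite <- Hvs. unfold E. ring. }
    apply holder_weaken with (M * B + 121 * (H + M * B) * rpow h (alpha - beta)).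
    + replace ((K1 + K2) * rpow h (alpha - beta) * H)
        with (K1 * (H * rpow h (alpha - beta)) + M * (K1 * (H * rpow h (alpha - beta)))
          + 121 * (H + M * (K1 * H)) * rpow h (alpha - beta)) by (unfold K2; ring).
      assert (0 <= K1 * (H * rpow h (alpha - beta))) by (apply Rmult_le_pos; assumption).
      assert (M * B <= M * (K1 * (H * rpow h (alpha - beta)))) by (apply Rmult_le_compat_l; assumption).
      assert (M * B <= M * (K1 * H)) by (apply Rmult_le_compat_l; assumption).
      assert (121 * (H + M * B) * rpow h (alpha - beta) <= 121 * (H + M * (K1 * H)) * rpow h (alpha - beta))
        by (apply Rmult_le_compat_r; [assumption|lra]).
      lra.
    + apply holder_plus; auto.
Qed.

(** * The contour *)

Lemma Derive_periodic (g : R -> R) T : (forall x, g (x + T) = g x) ->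
  forall x, Derive g (x + T) = Derive g x.
Proof.
  intros H x. unfold Derive. f_equal. apply Lim_ext. intros h.
  replace (x + T + h) with (x + h + T) by ring. now rewrite !H.
Qed.

Lemma class_C2_MVT g : class_C2 g -> forall x y,
  exists z, Rmin x y <= z <= Rmax x y /\ g y - g x = Derive g z * (y - x).
Proof.
  intros [Hd _] x y.
  destruct (MVT_gen g x y (Derive g)) as [z [Hz1 Hz2]].
  - intros z _. apply Derive_correct. apply (Hd 1%nat z). lia.
  - intros z _. apply continuity_pt_filterlim. apply (ex_derive_continuous g). apply (Hd 1%nat z). lia.
  - eauto.
Qed.

Lemma class_C2_Derive_continuous g : class_C2 g -> forall x e, 0 < e ->
  exists d, 0 < d /\ forall y, Rabs (y - x) < d -> Rabs (Derive g y - Derive g x) < e.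
Proof.
  intros [Hd _] x e He.
  assert (Hc : continuous (Derive g) x).
  { apply (ex_derive_continuous (Derive g)). apply (Hd 2%nat x). lia. }
  destruct (proj1 (filterlim_locally (U := R_UniformSpace) (Derive g) _) Hc (mkposreal e He)) as [d Hd'].
  exists d. split; [apply cond_pos|]. intros y Hy. apply (Hd' y Hy).
Qed.

Section Contour.

Variable gamma : R -> C.
Hypothesis Hgamma : C2_contour gamma.

Let dgamma := CDerive gamma.

Lemma gamma_periodic x : gamma (x + 2 * PI) = gamma x.
Proof. apply Hgamma. Qed.

Lemma gamma_eq_angle x y : 0 <= x < 2 * PI -> 0 <= y < 2 * PI -> gamma x = gamma y -> x = y.
Proof. apply Hgamma. Qed.

Lemma angle_gamma x : 0 <= x < 2 * PI -> angle gamma (gamma x) = x.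
Proof.
  intros Hx. unfold angle.
  destruct (epsilon_spec (inhabits 0) (fun y => 0 <= y < 2 * PI /\ gamma y = gamma x)) as [H1 H2].
  - exists x; auto.
  - now apply gamma_eq_angle.
Qed.

Lemma gamma_angle_shift x : exists k : Z, x = angle gamma (gamma x) + 2 * PI * IZR k /\
  0 <= angle gamma (gamma x) < 2 * PI.
Proof.
  destruct (period_reduction 0 x) as [k Hk].
  assert (E : gamma x = gamma (x + 2 * PI * IZR k))
    by (symmetry; apply periodic_IZR, gamma_periodic).
  exists (- k)%Z. rewrite E. rewrite angle_gamma by lra. rewrite opp_IZR. split; [ring|lra].
Qed.

Lemma dgamma_CP : CP dgamma.
Proof.
  destruct Hgamma as [H1 [H2 [H3 _]]]. split.
  - intros x. apply Clim_locally_iff. intros e He.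
    destruct (class_C2_Derive_continuous _ H1 x (e / 2) ltac:(lra)) as [d1 [Hd1 Hd1']].
    destruct (class_C2_Derive_continuous _ H2 x (e / 2) ltac:(lra)) as [d2 [Hd2 Hd2']].
    exists (Rmin d1 d2). split; [now apply Rmin_glb_lt|]. intros y Hy.
    pose proof (Hd1' y (Rlt_le_trans _ _ _ Hy (Rmin_l _ _))) as Ha.
    pose proof (Hd2' y (Rlt_le_trans _ _ _ Hy (Rmin_r _ _))) as Hb.
    apply Rle_lt_trans with (1 := Cmod_le_abs _). simpl. unfold Rminus in *. lra.
  - intros x. unfold dgamma, CDerive. f_equal; apply Derive_periodic; intros y; now rewrite H3.
Qed.

Lemma gamma_lipschitz : exists L, 0 < L /\ forall x y, Cmod (gamma x - gamma y)%C <= L * Rabs (x - y).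
Proof.
  destruct (CP_bounded _ dgamma_CP) as [B [HB0 HB]].
  destruct Hgamma as [H1 [H2 _]].
  exists (2 * B + 1). split; [lra|]. intros x y.
  apply Rle_trans with (1 := Cmod_le_abs _).
  destruct (class_C2_MVT _ H1 y x) as [z1 [_ E1]]. destruct (class_C2_MVT _ H2 y x) as [z2 [_ E2]].
  change (fst (gamma x - gamma y)%C) with (Re (gamma x) - Re (gamma y)).
  change (snd (gamma x - gamma y)%C) with (Im (gamma x) - Im (gamma y)).
  rewrite E1, E2, !Rabs_mult.
  pose proof (Rle_trans _ _ _ (Rabs_fst_le (dgamma z1)) (HB z1)) as B1.
  pose proof (Rle_trans _ _ _ (Rabs_snd_le (dgamma z2)) (HB z2)) as B2.
  change (fst (dgamma z1)) with (Derive (fun u => Re (gamma u)) z1) in B1.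
  change (snd (dgamma z2)) with (Derive (fun u => Im (gamma u)) z2) in B2.
  pose proof (Rabs_pos (x - y)). nra.
Qed.

(** The mean value theorem applies to each coordinate separately, at points [z1] and [z2].
    Continuity of the derivative keeps the vector [w] so obtained within half of [m] of the
    derivative at [x0]. A single [d] serves as radius and as constant, the form needed for
    compactness. *)
Lemma gamma_locally_bilipschitz x0 : exists d, 0 < d /\
  forall x y, Rabs (x - x0) < d -> Rabs (y - x0) < d -> d * Rabs (x - y) <= Cmod (gamma x - gamma y)%C.
Proof.
  destruct Hgamma as [H1 [H2 [_ [Hne _]]]].
  set (m := Cmod (dgamma x0)).
  assert (Hm : 0 < m) by (apply Cmod_gt_0; apply Hne).
  destruct (class_C2_Derive_continuous _ H1 x0 (m / 4) ltac:(lra)) as [d1 [Hd1 Hd1']].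
  destruct (class_C2_Derive_continuous _ H2 x0 (m / 4) ltac:(lra)) as [d2 [Hd2 Hd2']].
  set (d := Rmin (m / 2) (Rmin d1 d2)).
  assert (Da : d <= m / 2) by apply Rmin_l.
  assert (Db : d <= d1) by (eapply Rle_trans; [apply Rmin_r|apply Rmin_l]).
  assert (Dc : d <= d2) by (eapply Rle_trans; [apply Rmin_r|apply Rmin_r]).
  exists d. split; [unfold d; repeat apply Rmin_glb_lt; lra|].
  intros x y Hx Hy.
  destruct (class_C2_MVT _ H1 y x) as [z1 [Z1 E1]]. destruct (class_C2_MVT _ H2 y x) as [z2 [Z2 E2]].
  assert (Hz : forall z, Rmin y x <= z <= Rmax y x -> Rabs (z - x0) < d).
  { intros z [Za Zb]. apply Rabs_lt_between in Hx. apply Rabs_lt_between in Hy.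
    pose proof (Rmin_glb_lt y x (x0 - d) ltac:(lra) ltac:(lra)).
    pose proof (Rmax_lub_lt y x (x0 + d) ltac:(lra) ltac:(lra)).
    apply Rabs_def1; lra. }
  set (w := (Derive (fun u => Re (gamma u)) z1, Derive (fun u => Im (gamma u)) z2) : C).
  assert (E : (gamma x - gamma y)%C = (w * RtoC (x - y))%C).
  { unfold w. apply injective_projections; simpl.
    - change (Re (gamma x) + - Re (gamma y) =
        Derive (fun u => Re (gamma u)) z1 * (x - y) - Derive (fun u => Im (gamma u)) z2 * 0).
      unfold Rminus in E1. rewrite E1. ring.
    - change (Im (gamma x) + - Im (gamma y) =
        Derive (fun u => Re (gamma u)) z1 * 0 + Derive (fun u => Im (gamma u)) z2 * (x - y)).
      unfold Rminus in E2. rewrite E2. ring. }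
  rewrite E, Cmod_mult, Cmod_R.
  apply Rmult_le_compat_r; [apply Rabs_pos|].
  pose proof (Cmod_diff_le (dgamma x0) w) as H. fold m in H.
  assert (Hw : Cmod (dgamma x0 - w)%C <= m / 4 + m / 4).
  { rewrite Cmod_sub_sym. apply Rle_trans with (1 := Cmod_le_abs _).
    pose proof (Hd1' z1 ltac:(apply Rlt_le_trans with (2 := Db); auto)).
    pose proof (Hd2' z2 ltac:(apply Rlt_le_trans with (2 := Dc); auto)).
    simpl. unfold Rminus in *. lra. }
  lra.
Qed.

(** Near the diagonal the local estimate applies. Off it the chord is positive, since equal points
    have parameters differing by a multiple of [2 * PI], excluded by the length of the interval.
    Compactness of the square makes the constant uniform. *)
Lemma chord_lower_bound a b : b - a < 2 * PI -> exists d, 0 < d /\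
  forall x y, a <= x <= b -> a <= y <= b -> d * Rabs (x - y) <= Cmod (gamma x - gamma y)%C.
Proof.
  intros Hab. pose proof PI_RGT_0 as HP.
  assert (Hloc : forall u v, exists d, 0 < d /\ (a <= u <= b -> a <= v <= b ->
    forall x y, a <= x <= b -> a <= y <= b -> Rabs (x - u) < d -> Rabs (y - v) < d ->
      d * Rabs (x - y) <= Cmod (gamma x - gamma y)%C)).
  { intros u v. destruct (Req_dec u v) as [<-|Huv].
    - destruct (gamma_locally_bilipschitz u) as [d [Hd0 Hd]]. exists d. split; auto.
    - destruct (classic (a <= u <= b /\ a <= v <= b)) as [[Hu Hv]|Hn].
      + set (m := Cmod (gamma u - gamma v)%C).
        assert (Hm : 0 < m).
        { apply Cmod_gt_0. intros H0.
          assert (E : gamma u = gamma v)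
            by (replace (gamma u) with ((gamma u - gamma v) + gamma v)%C by ring; rewrite H0; ring).
          destruct (gamma_angle_shift u) as [k1 [K1 _]]. destruct (gamma_angle_shift v) as [k2 [K2 _]].
          rewrite <- E in K2.
          assert (K : u - v = 2 * PI * IZR (k1 - k2)) by (rewrite minus_IZR; lra).
          assert (Hk : (k1 - k2 = 0)%Z).
          { assert (-1 < IZR (k1 - k2) < 1) by (split; nra).
            destruct H as [Ha Hb]. apply lt_IZR in Ha. apply lt_IZR in Hb. lia. }
          rewrite Hk in K. apply Huv. lra. }
        destruct gamma_lipschitz as [L [HL0 HL]].
        (* The first bound moves each endpoint by at most [m / 4], leaving a chord of at least
           [m / 2]; the second gives [d * (2 * PI) <= m / 4]. *)
        set (d := Rmin (m / (4 * L)) (m / (8 * PI))).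
        assert (Da : d <= m / (4 * L)) by apply Rmin_l.
        assert (Db : d <= m / (8 * PI)) by apply Rmin_r.
        assert (Hd0 : 0 < d) by (unfold d; apply Rmin_glb_lt; apply Rdiv_lt_0_compat; lra).
        assert (Da' : L * d <= m / 4).
        { replace (m / 4) with (L * (m / (4 * L))) by (field; lra). apply Rmult_le_compat_l; lra. }
        assert (Db' : d * (2 * PI) <= m / 4).
        { replace (m / 4) with (m / (8 * PI) * (2 * PI)) by (field; lra). apply Rmult_le_compat_r; lra. }
        exists d. split; [assumption|]. intros _ _ x y Hx Hy Hxu Hyv.
        assert (Hxy : Rabs (x - y) <= 2 * PI) by (apply Rabs_le; lra).
        apply Rle_trans with (m / 4).
        { apply Rle_trans with (2 := Db'). apply Rmult_le_compat_l; lra. }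
        pose proof (HL x u) as HL1. pose proof (HL y v) as HL2.
        assert (L * Rabs (x - u) <= L * d) by (apply Rmult_le_compat_l; lra).
        assert (L * Rabs (y - v) <= L * d) by (apply Rmult_le_compat_l; lra).
        pose proof (Cmod_diff_le (gamma u - gamma v)%C (gamma x - gamma y)%C) as H3.
        replace (gamma u - gamma v - (gamma x - gamma y))%C
          with ((gamma y - gamma v) - (gamma x - gamma u))%C in H3 by ring.
        pose proof (Cmod_sub_le (gamma y - gamma v)%C (gamma x - gamma u)%C).
        fold m in H3. lra.
      + exists 1. split; [lra|]. intros; tauto. }
  destruct (choice (fun p d => 0 < d /\ (a <= fst p <= b -> a <= snd p <= b ->
    forall x y, a <= x <= b -> a <= y <= b -> Rabs (x - fst p) < d -> Rabs (y - snd p) < d ->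
      d * Rabs (x - y) <= Cmod (gamma x - gamma y)%C)) (fun p => Hloc (fst p) (snd p)))
    as [delta Hdelta].
  (* A Lebesgue number: every [(x, y)] lies in the box of some [(u, v)] whose size is at least [d].
     The conclusion is stated under a double negation. *)
  destruct (compactness_value_2d a b a b (fun u v => mkposreal _ (proj1 (Hdelta (u, v))))) as [d Hd].
  exists d. split; [apply cond_pos|]. intros x y Hx Hy.
  specialize (Hd x y Hx Hy). apply NNPP in Hd.
  destruct Hd as [u [v [Hu [Hv [H1 [H2 H3]]]]]]. simpl in H1, H2, H3.
  destruct (Hdelta (u, v)) as [_ H]. simpl in H.
  apply Rle_trans with (2 := H Hu Hv x y Hx Hy H1 H2).
  apply Rmult_le_compat_r; [apply Rabs_pos|assumption].
Qed.

(** The inverse of the derivative is again continuous and periodic, hence bounded. *)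
Lemma dgamma_lower_bound : exists d, 0 < d /\ forall x, d <= Cmod (dgamma x).
Proof.
  assert (Hne : forall x, dgamma x <> RtoC 0) by apply Hgamma.
  assert (Hi : CP (fun x => (/ dgamma x)%C)).
  { destruct dgamma_CP as [H1 H2]. split.
    - intros x. apply Clim_inv; auto. apply locally_filter.
    - intros x. now rewrite H2. }
  destruct (CP_bounded _ Hi) as [B [HB0 HB]].
  exists (/ (B + 1)). split; [apply Rinv_0_lt_compat; lra|]. intros x.
  specialize (HB x). simpl in HB. rewrite Cmod_inv in HB by auto.
  assert (H0 : 0 < Cmod (dgamma x)) by now apply Cmod_gt_0.
  rewrite <- (Rinv_inv (Cmod (dgamma x))). apply Rinv_le_contravar; [|lra].
  now apply Rinv_0_lt_compat.
Qed.

Lemma speed_integrable a b : ex_RInt (fun u => Cmod (dgamma u)) a b.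
Proof.
  apply (ex_RInt_continuous (V := R_CompleteNormedModule)). intros x _.
  apply (filterlim_locally (U := R_UniformSpace)). intros e.
  destruct (proj1 (Clim_locally_iff _ _ _) (proj1 dgamma_CP x) e (cond_pos e)) as [d [Hd0 Hd]].
  exists (mkposreal d Hd0). intros y Hy. specialize (Hd y Hy).
  unfold ball; simpl; unfold AbsRing_ball, abs, minus, plus, opp; simpl.
  apply Rle_lt_trans with (2 := Hd).
  pose proof (Cmod_diff_le (dgamma y) (dgamma x)).
  pose proof (Cmod_diff_le (dgamma x) (dgamma y)) as H2. rewrite (Cmod_sub_sym (dgamma x)) in H2.
  apply Rabs_le. lra.
Qed.

(** For the case of a single arc, whose chord degenerates at the coinciding endpoints: the speed
    lies between positive constants. *)
Lemma arc_length_bounds : exists d L, 0 < d /\ 0 < L /\ forall x y,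
  d * Rabs (x - y) <= Rabs (RInt (fun u => Cmod (dgamma u)) x y) <= L * Rabs (x - y).
Proof.
  destruct dgamma_lower_bound as [d [Hd0 Hd]].
  destruct (CP_bounded _ dgamma_CP) as [B [HB0 HB]].
  exists d, (B + 1). split; [assumption|]. split; [lra|].
  assert (Hw : forall x y, x <= y ->
    d * (y - x) <= RInt (fun u => Cmod (dgamma u)) x y <= (B + 1) * (y - x)).
  { intros x y Hxy.
    assert (Hcst : forall v, RInt (fun _ => v) x y = v * (y - x)).
    { intros v. rewrite RInt_const. unfold scal; simpl; unfold mult; simpl. ring. }
    rewrite <- !Hcst. split.
    - apply RInt_le; [assumption|apply ex_RInt_const|apply speed_integrable|]. intros; apply Hd.
    - apply RInt_le; [assumption|apply speed_integrable|apply ex_RInt_const|].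
      intros z _. specialize (HB z). lra. }
  intros x y. destruct (Rle_dec x y) as [Hxy|Hxy].
  - specialize (Hw x y Hxy). rewrite (Rabs_left1 (x - y)) by lra.
    rewrite Rabs_pos_eq by (assert (0 <= d * (y - x)) by (apply Rmult_le_pos; lra); lra). lra.
  - specialize (Hw y x ltac:(lra)). rewrite (Rabs_pos_eq (x - y)) by lra.
    rewrite <- (opp_RInt_swap (V := R_CompleteNormedModule)) by apply speed_integrable.
    unfold opp; simpl. rewrite Rabs_Ropp.
    rewrite Rabs_pos_eq by (assert (0 <= d * (x - y)) by (apply Rmult_le_pos; lra); lra). lra.
Qed.

Variables (nd : nat) (thd : nat -> R).
Hypothesis Hthd : break_params nd thd.

Definition in_arc (j : nat) (x : R) : Prop := arc_lo thd j <= x <= arc_hi nd thd j.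

Lemma arc_hi_cases j : (1 <= j <= nd)%nat ->
  ((j < nd)%nat /\ arc_hi nd thd j = thd (S j)) \/ (j = nd /\ arc_hi nd thd j = thd 1%nat + 2 * PI).
Proof.
  intros Hj. unfold arc_hi. destruct (Nat.ltb_spec j nd); [left|right]; split; auto; lia.
Qed.

Lemma arc_nonempty j : (1 <= j <= nd)%nat -> arc_lo thd j < arc_hi nd thd j <= arc_lo thd j + 2 * PI.
Proof.
  intros Hj. unfold arc_lo. pose proof (break_params_range nd thd Hthd) as Hr.
  pose proof (break_params_increasing nd thd Hthd) as Hi.
  pose proof (Hr j Hj). pose proof (Hr 1%nat ltac:(lia)).
  destruct (arc_hi_cases j Hj) as [[H1 ->]|[H1 ->]].
  - pose proof (Hr (S j) ltac:(lia)). pose proof (Hi j (S j) ltac:(lia) ltac:(lia) ltac:(lia)). lra.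
  - split; [lra|]. destruct (Nat.eq_dec j 1) as [->|]; [lra|].
    pose proof (Hi 1%nat j ltac:(lia) ltac:(lia) ltac:(lia)). lra.
Qed.

(** The bridge between the norms on the curve and Hoelder conditions in the parameter. With at least
    two break points every closed arc is shorter than a period, so chords are bounded below; with
    one, arc length takes their place. *)
Lemma arc_dist_bounds : exists d L, 0 < d /\ 0 < L /\
  forall j, (1 <= j <= nd)%nat -> forall x y, in_arc j x -> in_arc j y ->
    d * Rabs (x - y) <= arc_dist gamma nd x y <= L * Rabs (x - y).
Proof.
  unfold arc_dist. destruct (Nat.eqb_spec nd 1) as [H1|H1].
  - destruct arc_length_bounds as [d [L [Hd [HL H]]]]. exists d, L. repeat split; auto; apply H.
  - destruct gamma_lipschitz as [L [HL0 HL]].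
    assert (Hk : forall k, (k <= nd)%nat -> exists d, 0 < d /\
      forall j, (1 <= j <= k)%nat -> forall x y, in_arc j x -> in_arc j y ->
        d * Rabs (x - y) <= Cmod (gamma x - gamma y)%C).
    { induction k as [|k IH]; intros Hk.
      - exists 1. split; [lra|]. intros; lia.
      - destruct (IH ltac:(lia)) as [d1 [Hd1 Hd1']].
        destruct (chord_lower_bound (arc_lo thd (S k)) (arc_hi nd thd (S k))) as [d2 [Hd2 Hd2']].
        { unfold arc_lo. pose proof (break_params_range nd thd Hthd) as Hr.
          pose proof (Hr (S k) ltac:(lia)).
          destruct (arc_hi_cases (S k) ltac:(lia)) as [[H2 ->]|[H2 ->]].
          - pose proof (Hr (S (S k)) ltac:(lia)). lra.
          - pose proof (break_params_increasing nd thd Hthd 1%nat (S k) ltac:(lia) ltac:(lia) ltac:(lia)). lra. }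
        exists (Rmin d1 d2). split; [now apply Rmin_glb_lt|].
        intros j Hj x y Hx Hy. destruct (Nat.eq_dec j (S k)) as [->|Hjk].
        + apply Rle_trans with (2 := Hd2' x y Hx Hy).
          apply Rmult_le_compat_r; [apply Rabs_pos|apply Rmin_r].
        + apply Rle_trans with (2 := Hd1' j ltac:(lia) x y Hx Hy).
          apply Rmult_le_compat_r; [apply Rabs_pos|apply Rmin_l]. }
    destruct (Hk nd (le_n _)) as [d [Hd0 Hd]]. exists d, L. repeat split; auto. now apply (Hd j).
Qed.

(** * Piecewise Hoelder functions and their traces *)

Local Notation lo := (arc_lo thd).
Local Notation hi := (arc_hi nd thd).
Local Notation trace := (arc_trace gamma nd thd).

Definition arc_index (j : nat) : Prop := (1 <= j <= nd)%nat.

Lemma arc_hi_break j : arc_index j -> exists i (k : Z), arc_index i /\ hi j = thd i + 2 * PI * IZR k.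
Proof.
  intros Hj. destruct Hthd as [H1 _]. unfold arc_index in *.
  destruct (arc_hi_cases j Hj) as [[H2 ->]|[H2 ->]].
  - exists (S j), 0%Z. split; [lia|]. ring.
  - exists 1%nat, 1%Z. split; [lia|]. ring.
Qed.

Lemma break_arc_hi i : arc_index i -> exists j (k : Z), arc_index j /\ hi j = thd i + 2 * PI * IZR k.
Proof.
  intros Hi. destruct Hthd as [H1 _]. unfold arc_index in *.
  destruct (Nat.eq_dec i 1) as [->|Hi1].
  - exists nd, 1%Z. split; [lia|].
    destruct (arc_hi_cases nd ltac:(lia)) as [[H2 _]|[_ ->]]; [lia|]. ring.
  - exists (pred i), 0%Z. split; [lia|].
    destruct (arc_hi_cases (pred i) ltac:(lia)) as [[_ ->]|[H2 _]]; [|lia].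
    replace (S (pred i)) with i by lia. ring.
Qed.

Lemma open_arc_avoids_breaks j x : arc_index j -> lo j < x < hi j ->
  forall i (k : Z), arc_index i -> x <> thd i + 2 * PI * IZR k.
Proof.
  intros Hj Hx i k Hi E. unfold arc_lo, arc_index in *.
  pose proof (break_params_range nd thd Hthd) as Hr.
  pose proof (break_params_increasing nd thd Hthd) as Hinc.
  pose proof PI_RGT_0 as HP.
  pose proof (Hr i Hi) as Ri. pose proof (Hr j Hj) as Rj. pose proof (Hr 1%nat ltac:(lia)) as R1.
  destruct (arc_hi_cases j Hj) as [[H2 E2]|[H2 E2]]; rewrite E2 in Hx.
  - pose proof (Hr (S j) ltac:(lia)) as Rs.
    assert (Hk : k = 0%Z).
    { assert (-1 < IZR k < 1) as [Ha Hb] by (split; nra).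
      apply lt_IZR in Ha. apply lt_IZR in Hb. lia. }
    subst k. assert (E' : x = thd i) by lra. subst x.
    destruct (Nat.lt_trichotomy i j) as [H|[->|H]].
    + pose proof (Hinc i j ltac:(lia) H ltac:(lia)). lra.
    + lra.
    + destruct (Nat.eq_dec i (S j)) as [->|]; [lra|].
      pose proof (Hinc (S j) i ltac:(lia) ltac:(lia) ltac:(lia)). lra.
  - subst j.
    (* The last arc runs through the cut, so its parameters may exceed [2 * PI] and a shift by one
       period has to be considered too. *)
    assert (Hk : k = 0%Z \/ k = 1%Z).
    { assert (-1 < IZR k < 2) as [Ha Hb] by (split; nra).
      apply lt_IZR in Ha. apply lt_IZR in Hb. lia. }
    destruct Hk as [-> | ->].
    + destruct (Nat.eq_dec i nd) as [->|]; [lra|].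
      pose proof (Hinc i nd ltac:(lia) ltac:(lia) ltac:(lia)). lra.
    + destruct (Nat.eq_dec i 1) as [->|]; [lra|].
      pose proof (Hinc 1%nat i ltac:(lia) ltac:(lia) ltac:(lia)). lra.
Qed.

Lemma open_arc_not_break_point j x : arc_index j -> lo j < x < hi j ->
  ~ break_point gamma nd thd (gamma x).
Proof.
  intros Hj Hx [i [Hi E]].
  destruct (gamma_angle_shift x) as [k1 [K1 _]].
  destruct (gamma_angle_shift (thd i)) as [k2 [K2 _]].
  rewrite <- E in K2.
  apply (open_arc_avoids_breaks j x Hj Hx i (k1 - k2)%Z Hi).
  rewrite minus_IZR. lra.
Qed.

(** The half-open arcs tile the line modulo the period. The right end is the included one because a
    break point carries its incoming value. *)
Lemma arcs_cover x : exists j (k : Z), arc_index j /\ lo j < x + 2 * PI * IZR k <= hi j.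
Proof.
  pose proof Hthd as [H1 _]. unfold arc_lo, arc_index.
  destruct (period_reduction (thd 1%nat) x) as [k Hk].
  set (x' := x + 2 * PI * IZR k) in *.
  destruct (Req_dec x' (thd 1%nat)) as [E|Hne].
  - exists nd, (k + 1)%Z. split; [lia|].
    destruct (arc_hi_cases nd ltac:(lia)) as [[H2 _]|[_ ->]]; [lia|].
    rewrite plus_IZR. replace (x + 2 * PI * (IZR k + 1)) with (x' + 2 * PI) by (unfold x'; ring).
    pose proof (break_params_range nd thd Hthd nd ltac:(lia)).
    pose proof (break_params_range nd thd Hthd 1%nat ltac:(lia)). lra.
  - assert (Hi : forall i, (1 <= i)%nat -> (i <= nd)%nat -> thd i < x' \/
      exists j, (1 <= j <= nd)%nat /\ thd j < x' <= hi j).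
    { induction 1 as [|i Hi IH]; intros Hn; [left; lra|].
      destruct (IH ltac:(lia)) as [IH'|IH']; [|now right].
      destruct (Rle_dec x' (thd (S i))); [right|left; lra].
      exists i. split; [lia|].
      destruct (arc_hi_cases i ltac:(lia)) as [[_ ->]|[H2 _]]; [lra|lia]. }
    destruct (Hi nd H1 (le_n _)) as [H|[j [Hj H]]].
    + exists nd, k. split; [lia|].
      destruct (arc_hi_cases nd ltac:(lia)) as [[H2 _]|[_ ->]]; [lia|]. fold x'. lra.
    + exists j, k. split; auto.
Qed.

(* [T j] represents [v] on the [j]-th completed arc. *)
Definition traced (s : R) (v : R -> C) (T : nat -> R -> C) : Prop :=
  forall j, arc_index j ->
    (exists M, 0 <= M /\ holder (in_arc j) s M (T j)) /\
    forall x, lo j < x <= hi j -> v x = T j x.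

Lemma arc_lt j : arc_index j -> lo j < hi j.
Proof. intros Hj. apply (arc_nonempty j Hj). Qed.

Lemma traced_Clim F (FF : Filter F) s v T j x : 0 < s -> traced s v T -> arc_index j ->
  in_arc j x -> filter_le F (locally x) -> F (fun y => lo j < y < hi j) -> Clim F v (T j x).
Proof.
  intros Hs HT Hj Hx HF Harc. destruct (HT j Hj) as [[M [_ HM]] He].
  apply (Clim_ext F (T j)).
  - revert Harc. apply filter_imp. intros y Hy. symmetry. apply He. lra.
  - apply (holder_Clim F (in_arc j) s M); auto.
    revert Harc. apply filter_imp. intros y Hy. unfold in_arc in *. lra.
Qed.

Lemma traced_right s v T j : 0 < s -> traced s v T -> arc_index j ->
  Clim (at_right (lo j)) v (T j (lo j)).
Proof.
  intros Hs HT Hj. pose proof (arc_lt j Hj).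
  apply (traced_Clim (at_right (lo j)) _ s v T j); auto.
  - unfold in_arc in *. lra.
  - apply filter_le_within.
  - now apply near_right.
Qed.

Lemma traced_left s v T j : 0 < s -> traced s v T -> arc_index j ->
  Clim (at_left (hi j)) v (T j (hi j)).
Proof.
  intros Hs HT Hj. pose proof (arc_lt j Hj).
  apply (traced_Clim (at_left (hi j)) _ s v T j); auto.
  - unfold in_arc in *. lra.
  - apply filter_le_within.
  - now apply near_left.
Qed.

Lemma traced_open s v T j x : 0 < s -> traced s v T -> arc_index j -> lo j < x < hi j ->
  Clim (locally x) v (v x).
Proof.
  intros Hs HT Hj Hx. rewrite (proj2 (HT j Hj) x) by lra.
  apply (traced_Clim (locally x) _ s v T j); auto.
  - unfold in_arc in *. lra.
  - intros P HP. exact HP.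
  - now apply near_open.
Qed.

Lemma traced_left_break s v T i : 0 < s -> (forall x, v (x + 2 * PI) = v x) -> traced s v T ->
  arc_index i -> Clim (at_left (thd i)) v (v (thd i)).
Proof.
  intros Hs Hp HT Hi. destruct (break_arc_hi i Hi) as [j [k [Hj E]]].
  pose proof (traced_left s v T j Hs HT Hj) as H.
  rewrite <- (proj2 (HT j Hj) (hi j)) in H by (pose proof (arc_lt j Hj); lra).
  rewrite E in H. rewrite (periodic_IZR v Hp k) in H.
  apply (Clim_left_shift _ _ (2 * PI * IZR (- k))) in H.
  rewrite (periodic_shift_eq v (- k) Hp) in H. rewrite opp_IZR in H.
  replace (thd i + 2 * PI * IZR k + 2 * PI * - IZR k) with (thd i) in H by ring. exact H.
Qed.

Lemma traced_pwc s v T : 0 < s -> (forall x, v (x + 2 * PI) = v x) -> traced s v T -> pwc nd thd v.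
Proof.
  intros Hs Hp HT. pose proof PI_RGT_0 as HP. split.
  - intros x Hx Hne. destruct (arcs_cover x) as [j [k [Hj Hjk]]].
    destruct (Req_dec (x + 2 * PI * IZR k) (hi j)) as [E|Hn].
    + exfalso. destruct (arc_hi_break j Hj) as [i [k' [Hi E']]].
      pose proof (break_params_range nd thd Hthd i Hi) as Ri.
      assert (Hk : (k' - k = 0)%Z).
      { assert (Hq : 2 * PI * IZR (k' - k) = x - thd i) by (rewrite minus_IZR; lra).
        assert (-1 < IZR (k' - k) < 1) as [Ha Hb] by (split; nra).
        apply lt_IZR in Ha. apply lt_IZR in Hb. lia. }
      apply (Hne i Hi). replace k' with k in E' by lia. lra.
    + pose proof (traced_open s v T j (x + 2 * PI * IZR k) Hs HT Hj ltac:(lra)) as H.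
      rewrite (periodic_IZR v Hp k) in H.
      apply (Clim_locally_shift _ _ (2 * PI * IZR (- k))) in H.
      rewrite (periodic_shift_eq v (- k) Hp) in H. rewrite opp_IZR in H.
      replace (x + 2 * PI * IZR k + 2 * PI * - IZR k) with x in H by ring. exact H.
  - intros i Hi. split.
    + exists (T i (lo i)). now apply (traced_right s).
    + exists (v (thd i)). now apply (traced_left_break s v T).
Qed.

Lemma traced_plus s v v' T T' : traced s v T -> traced s v' T' ->
  traced s (fun x => (v x + v' x)%C) (fun j x => (T j x + T' j x)%C).
Proof.
  intros H H' j Hj. destruct (H j Hj) as [[M [HM0 HM]] He]. destruct (H' j Hj) as [[M' [HM0' HM']] He'].
  split.
  - exists (M + M'). split; [lra|]. now apply holder_plus.
  - intros x Hx. now rewrite He, He'.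
Qed.

Lemma holder_bounded j s M T : arc_index j -> 0 < s -> 0 <= M -> holder (in_arc j) s M T ->
  exists B, 0 <= B /\ forall x, in_arc j x -> Cmod (T x) <= B.
Proof.
  intros Hj Hs HM H. pose proof (arc_nonempty j Hj) as Hn.
  assert (H0 : in_arc j (lo j)) by (unfold in_arc; lra).
  exists (Cmod (T (lo j)) + M * rpow (2 * PI) s). pose proof (rpow_ge_0 (2 * PI) s). split.
  - pose proof (Cmod_ge_0 (T (lo j))). nra.
  - intros x Hx. eapply Rle_trans; [apply (Cmod_diff_le (T x) (T (lo j)))|].
    apply Rplus_le_compat_l. eapply Rle_trans; [apply H; assumption|].
    apply Rmult_le_compat_l; [assumption|]. apply rpow_mono; [assumption|apply Rabs_pos|].
    unfold in_arc in *. apply Rabs_le. lra.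
Qed.

Lemma traced_mult s v v' T T' : 0 < s -> traced s v T -> traced s v' T' ->
  traced s (fun x => (v x * v' x)%C) (fun j x => (T j x * T' j x)%C).
Proof.
  intros Hs H H' j Hj. destruct (H j Hj) as [[M [HM0 HM]] He]. destruct (H' j Hj) as [[M' [HM0' HM']] He'].
  split.
  - destruct (holder_bounded j s M (T j) Hj Hs HM0 HM) as [B [HB0 HB]].
    destruct (holder_bounded j s M' (T' j) Hj Hs HM0' HM') as [B' [HB0' HB']].
    exists (M * B' + B * M'). split.
    + pose proof (Rmult_le_pos _ _ HM0 HB0'). pose proof (Rmult_le_pos _ _ HB0 HM0'). lra.
    + now apply holder_mult.
  - intros x Hx. now rewrite He, He'.
Qed.

Lemma traced_inv s v T c0 : 0 < c0 ->
  (forall j x, arc_index j -> in_arc j x -> c0 <= Cmod (T j x)) ->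
  traced s v T -> traced s (fun x => (/ v x)%C) (fun j x => (/ T j x)%C).
Proof.
  intros Hc Hl H j Hj. destruct (H j Hj) as [[M [HM0 HM]] He]. split.
  - exists (M / (c0 * c0)). split.
    + apply Rdiv_le_0_compat; [assumption|]. now apply Rmult_lt_0_compat.
    + apply holder_inv; auto.
  - intros x Hx. now rewrite He.
Qed.

Lemma traced_scal s a v T : traced s v T ->
  traced s (fun x => (a * v x)%C) (fun j x => (a * T j x)%C).
Proof.
  intros H j Hj. destruct (H j Hj) as [[M [HM0 HM]] He]. split.
  - exists (Cmod a * M). split; [apply Rmult_le_pos; [apply Cmod_ge_0|assumption]|].
    intros x y Hx Hy. replace (a * T j x - a * T j y)%C with (a * (T j x - T j y))%C by ring.
    rewrite Cmod_mult, Rmult_assoc. apply Rmult_le_compat_l; [apply Cmod_ge_0|now apply HM].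
  - intros x Hx. now rewrite He.
Qed.

Lemma traced_lower_exponent s t v T : 0 < t -> t <= s -> s <= 1 -> traced s v T -> traced t v T.
Proof.
  intros Ht Hts Hs H j Hj. destruct (H j Hj) as [[M [HM0 HM]] He]. split; [|assumption].
  exists (M * (2 * PI)). pose proof PI_RGT_0. split; [nra|].
  apply (holder_lower_exponent _ _ s t); auto. now apply (arc_nonempty j Hj).
Qed.

Lemma traced_global s v M : 0 <= M -> holder everywhere s M v -> traced s v (fun _ => v).
Proof.
  intros HM H j Hj. split; auto. exists M. split; [assumption|].
  apply (holder_restrict everywhere); auto. intros; exact I.
Qed.

Lemma PH_of_traced s v T : 0 < s ->
  traced s (fun x => v (gamma x)) T -> PH gamma nd thd s v.
Proof.
  intros Hs HT.
  assert (Hp : forall x, v (gamma (x + 2 * PI)) = v (gamma x))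
    by (intros; now rewrite gamma_periodic).
  destruct (arc_dist_bounds) as [d [L [Hd0 [HL0 Hd]]]].
  split.
  - intros j Hj. destruct (HT j Hj) as [[M [HM0 HM]] He].
    exists (M * rpow (/ d) s). intros x y Hx Hy Hxy.
    assert (Ix : in_arc j x) by (unfold in_arc; lra).
    assert (Iy : in_arc j y) by (unfold in_arc; lra).
    rewrite !He by (lra).
    eapply Rle_trans; [now apply HM|].
    destruct (Hd j Hj x y Ix Iy) as [H1 _].
    assert (Hxy0 : 0 < Rabs (x - y)) by (apply Rabs_pos_lt; lra).
    assert (0 < d * Rabs (x - y)) by (apply Rmult_lt_0_compat; assumption).
    rewrite <- rpow_pos_eq by lra. rewrite Rmult_assoc.
    assert (0 < / d) by now apply Rinv_0_lt_compat.
    rewrite <- rpow_mult by lra. apply Rmult_le_compat_l; [assumption|].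
    apply rpow_mono; [assumption|lra|].
    apply Rmult_le_reg_l with d; [assumption|]. rewrite <- Rmult_assoc, Rinv_r by lra. lra.
  - intros j Hj. split.
    + exists (T j (lo j)). apply (Clim_filterlim (at_right (thd j))).
      now apply (traced_right s (fun x => v (gamma x))).
    + apply (Clim_filterlim (at_left (thd j))).
      now apply (traced_left_break s (fun x => v (gamma x)) T).
Qed.

Lemma lat_out_traced s v T j : 0 < s -> traced s (fun x => v (gamma x)) T -> arc_index j ->
  lat_out gamma v (thd j) = T j (lo j).
Proof.
  intros Hs HT Hj. unfold lat_out. apply (lim_Clim (at_right (thd j)) (fun x => v (gamma x))).
  now apply (traced_right s (fun x => v (gamma x))).
Qed.

Lemma lat_in_traced s v T j : 0 < s -> traced s (fun x => v (gamma x)) T -> arc_index j ->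
  lat_in gamma v (thd j) = v (gamma (thd j)).
Proof.
  intros Hs HT Hj. unfold lat_in. apply (lim_Clim (at_left (thd j)) (fun x => v (gamma x))).
  apply (traced_left_break s (fun x => v (gamma x)) T); auto.
  intros x. now rewrite gamma_periodic.
Qed.

(** Limits are unique, so any Hoelder representative [T] on the closed arcs computes the norm of
    [v]. *)
Lemma arc_trace_traced s v T j x : 0 < s -> traced s (fun x => v (gamma x)) T -> arc_index j ->
  in_arc j x -> trace v j x = T j x.
Proof.
  intros Hs HT Hj [Hx1 Hx2]. unfold arc_trace.
  destruct (Rle_dec x (lo j)) as [H1|H1].
  - replace x with (lo j) by (lra). now apply (lat_out_traced s).
  - destruct (Rle_dec (hi j) x) as [H2|H2].
    + replace x with (hi j) by (lra). unfold lat_in.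
      apply (lim_Clim (at_left (hi j)) (fun x => v (gamma x))).
      now apply (traced_left s (fun x => v (gamma x))).
    + apply (proj2 (HT j Hj)). lra.
Qed.

(** Converse of [PH_of_traced], with the canonical trace. The Hoelder estimate on an open arc
    extends to the completed arc by passing to the lateral limits, and left continuity at break
    points identifies the trace at the right end with the value of [v]. *)
Lemma PH_traced s v : 0 < s -> PH gamma nd thd s v ->
  traced s (fun x => v (gamma x)) (trace v).
Proof.
  intros Hs [H1 H2] j Hj. set (u := fun x => v (gamma x)).
  assert (Hp : forall x, u (x + 2 * PI) = u x)
    by (intros; unfold u; now rewrite gamma_periodic).
  pose proof (arc_lt j Hj) as Hlt.
  destruct (H2 j Hj) as [[l Hl] _]. apply (Clim_filterlim (at_right (thd j))) in Hl.
  assert (Hout : lat_out gamma v (lo j) = l)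
    by (apply (lim_Clim (at_right (thd j)) u); exact Hl).
  assert (Hleft : Clim (at_left (hi j)) u (u (hi j))).
  { destruct (arc_hi_break j Hj) as [i [k [Hi E]]].
    destruct (H2 i Hi) as [_ Hr]. apply (Clim_filterlim (at_left (thd i))) in Hr.
    apply (Clim_left_shift _ _ (2 * PI * IZR k)) in Hr.
    change (fun y => v (gamma (y - 2 * PI * IZR k))) with (fun y => u (y - 2 * PI * IZR k)) in Hr.
    rewrite (periodic_shift_eq u k Hp) in Hr. rewrite E, (periodic_IZR u Hp). exact Hr. }
  assert (Hin : lat_in gamma v (hi j) = u (hi j))
    by (apply (lim_Clim (at_left (hi j)) u); exact Hleft).
  assert (Tlo : trace v j (lo j) = l).
  { unfold arc_trace. destruct (Rle_dec (lo j) (lo j)) as [Hn|Hn]; [exact Hout|].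
    exfalso; apply Hn; lra. }
  assert (Thi : forall x, lo j < x <= hi j -> trace v j x = u x).
  { intros x Hx. unfold arc_trace. destruct (Rle_dec x (lo j)) as [Hn|Hn];
      [lra|].
    destruct (Rle_dec (hi j) x) as [Hm|Hm]; [|reflexivity].
    replace x with (hi j) by (lra). exact Hin. }
  split; [|intros x Hx; symmetry; now apply Thi].
  destruct (arc_dist_bounds) as [d [L [Hd0 [HL0 Hd]]]].
  destruct (H1 j Hj) as [M HM].
  pose proof (rpow_ge_0 L s) as HrL.
  exists (Rabs M * rpow L s). split; [apply Rmult_le_pos; [apply Rabs_pos|assumption]|].
  apply holder_closure; auto.
  - apply Rmult_le_pos; [apply Rabs_pos|assumption].
  - intros x y Hx Hy. rewrite !Thi by (lra).
    destruct (Req_dec x y) as [->|Hxy].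
    { replace (u y - u y)%C with (RtoC 0) by ring. rewrite Cmod_0.
      apply Rmult_le_pos; [apply Rmult_le_pos; [apply Rabs_pos|assumption]|apply rpow_ge_0]. }
    eapply Rle_trans; [apply HM; assumption|].
    destruct (Hd j Hj x y ltac:(unfold in_arc; lra) ltac:(unfold in_arc; lra)) as [D1 D2].
    assert (Hxy0 : 0 < Rabs (x - y)) by (apply Rabs_pos_lt; lra).
    assert (0 < d * Rabs (x - y)) by (apply Rmult_lt_0_compat; assumption).
    rewrite <- rpow_pos_eq by lra. rewrite Rmult_assoc.
    rewrite <- rpow_mult by lra.
    apply Rle_trans with (Rabs M * rpow (arc_dist gamma nd x y) s).
    + apply Rmult_le_compat_r; [apply rpow_ge_0|apply RRle_abs].
    + apply Rmult_le_compat_l; [apply Rabs_pos|]. apply rpow_mono; lra.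
  - rewrite Tlo.
    apply (Clim_ext (at_right (lo j)) u); [|exact Hl].
    generalize (near_right (lo j) (hi j) Hlt). apply filter_imp. intros y Hy. rewrite Thi; [reflexivity|lra].
  - rewrite Thi by lra.
    apply (Clim_ext (at_left (hi j)) u); [|exact Hleft].
    generalize (near_left (lo j) (hi j) Hlt). apply filter_imp. intros y Hy. rewrite Thi; [reflexivity|lra].
Qed.

(** * The extended real norm and Hoelder bounds in the parameter *)

Lemma arc_sup_ge v j x : in_arc j x ->
  Rbar_le (Cmod (trace v j x)) (arc_sup gamma nd thd v j).
Proof.
  intros Hx. unfold arc_sup.
  destruct (Lub_Rbar_correct (fun r => exists x, lo j <= x <= hi j /\
    r = Cmod (trace v j x))) as [H _].
  apply H. exists x. split; [exact Hx|reflexivity].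
Qed.

Lemma arc_seminorm_ge s v j x y : in_arc j x -> in_arc j y -> x <> y ->
  Rbar_le (Cmod (trace v j x - trace v j y)%C
        / Rpower (arc_dist gamma nd x y) s) (arc_seminorm gamma nd thd s v j).
Proof.
  intros Hx Hy Hxy. unfold arc_seminorm.
  destruct (Lub_Rbar_correct (fun r => exists x y,
    lo j <= x <= hi j /\ lo j <= y <= hi j /\
    x <> y /\
    r = Cmod (trace v j x - trace v j y)%C
        / Rpower (arc_dist gamma nd x y) s)) as [H _].
  apply H. exists x, y. repeat split; auto; apply Hx || apply Hy.
Qed.

Lemma arc_sup_nonneg v j : arc_index j -> Rbar_le 0 (arc_sup gamma nd thd v j).
Proof.
  intros Hj. pose proof (arc_lt j Hj).
  eapply Rbar_le_trans; [|apply (arc_sup_ge v j (lo j)); unfold in_arc in *; lra].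
  apply Cmod_ge_0.
Qed.

Lemma arc_seminorm_nonneg s v j : arc_index j -> Rbar_le 0 (arc_seminorm gamma nd thd s v j).
Proof.
  intros Hj. pose proof (arc_lt j Hj).
  eapply Rbar_le_trans; [|apply (arc_seminorm_ge s v j (lo j) (hi j)); unfold in_arc in *; lra].
  apply Rdiv_le_0_compat; [apply Cmod_ge_0|]. unfold Rpower. apply exp_pos.
Qed.

Lemma PH_norm_ge s v j : arc_index j ->
  Rbar_le (Rbar_plus (arc_sup gamma nd thd v j) (arc_seminorm gamma nd thd s v j))
    (PH_norm gamma nd thd s v).
Proof.
  intros Hj. unfold PH_norm.
  destruct (proj2_sig (Rbar_ex_lub (fun r => exists j, (1 <= j <= nd)%nat /\
    r = Rbar_plus (arc_sup gamma nd thd v j) (arc_seminorm gamma nd thd s v j)))) as [H _].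
  apply H. exists j. auto.
Qed.

Lemma PH_norm_nonneg s v : Rbar_le 0 (PH_norm gamma nd thd s v).
Proof.
  assert (H1 : arc_index 1) by (destruct Hthd; unfold arc_index; lia).
  eapply Rbar_le_trans; [|now apply (PH_norm_ge s v 1%nat)].
  replace (Finite 0) with (Rbar_plus 0 0) by (simpl; f_equal; ring).
  apply Rbar_plus_le_compat; [now apply arc_sup_nonneg|now apply arc_seminorm_nonneg].
Qed.

Lemma PH_norm_controls s : 0 < s -> exists P, 0 < P /\ forall v B, PH_norm gamma nd thd s v = Finite B ->
  forall j, arc_index j ->
    (forall x, in_arc j x -> Cmod (trace v j x) <= B) /\
    holder (in_arc j) s (P * B) (trace v j).
Proof.
  intros Hs. destruct (arc_dist_bounds) as [d [L [Hd0 [HL0 Hd]]]].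
  exists (rpow L s). split; [rewrite rpow_pos_eq by assumption; unfold Rpower; apply exp_pos|].
  intros v B HB j Hj.
  pose proof (PH_norm_ge s v j Hj) as H. rewrite HB in H.
  pose proof (arc_sup_nonneg v j Hj) as S0. pose proof (arc_seminorm_nonneg s v j Hj) as N0.
  (* Both summands are nonnegative, so a finite bound on the sum makes each of them finite and at
     most [B]. *)
  assert (HSN : exists S N, arc_sup gamma nd thd v j = Finite S /\
    arc_seminorm gamma nd thd s v j = Finite N /\ S <= B /\ N <= B).
  { destruct (arc_sup gamma nd thd v j) as [S| |]; destruct (arc_seminorm gamma nd thd s v j) as [N| |];
      simpl in *; try tauto.
    exists S, N. repeat split; lra. }
  destruct HSN as [S [N [ES [EN [HS HN]]]]]. split.
  - intros x Hx. pose proof (arc_sup_ge v j x Hx) as H1. rewrite ES in H1. simpl in H1. lra.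
  - assert (B0 : 0 <= B) by (rewrite ES in S0; simpl in S0; lra).
    intros x y Hx Hy. pose proof (rpow_ge_0 L s) as HrL.
    destruct (Req_dec x y) as [->|Hxy].
    { replace (trace v j y - trace v j y)%C with (RtoC 0) by ring.
      rewrite Cmod_0. apply Rmult_le_pos; [now apply Rmult_le_pos|apply rpow_ge_0]. }
    pose proof (arc_seminorm_ge s v j x y Hx Hy Hxy) as H1. rewrite EN in H1. simpl in H1.
    destruct (Hd j Hj x y Hx Hy) as [D1 D2].
    assert (Hxy0 : 0 < Rabs (x - y)) by (apply Rabs_pos_lt; lra).
    assert (0 < d * Rabs (x - y)) by (apply Rmult_lt_0_compat; assumption).
    rewrite <- rpow_pos_eq in H1 by lra.
    assert (Hr : 0 < rpow (arc_dist gamma nd x y) s)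
      by (rewrite rpow_pos_eq by lra; unfold Rpower; apply exp_pos).
    apply Rle_trans with (B * rpow (arc_dist gamma nd x y) s).
    + apply Rmult_le_reg_r with (/ rpow (arc_dist gamma nd x y) s); [now apply Rinv_0_lt_compat|].
      rewrite Rmult_assoc, Rinv_r by lra. unfold Rdiv in H1. lra.
    + rewrite (Rmult_comm (rpow L s)), Rmult_assoc. apply Rmult_le_compat_l; [assumption|].
      rewrite <- rpow_mult by lra. apply rpow_mono; lra.
Qed.

Lemma PH_norm_le s : 0 < s -> exists P, 0 < P /\ forall v B A, 0 <= A ->
  (forall j, arc_index j -> (forall x, in_arc j x -> Cmod (trace v j x) <= B) /\
     holder (in_arc j) s A (trace v j)) ->
  Rbar_le (PH_norm gamma nd thd s v) (Finite (B + P * A)).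
Proof.
  intros Hs. destruct (arc_dist_bounds) as [d [L [Hd0 [HL0 Hd]]]].
  assert (Hid : 0 < / d) by now apply Rinv_0_lt_compat.
  exists (rpow (/ d) s). split; [rewrite rpow_pos_eq by assumption; unfold Rpower; apply exp_pos|].
  intros v B A HA H. unfold PH_norm.
  destruct (proj2_sig (Rbar_ex_lub (fun r => exists j, (1 <= j <= nd)%nat /\
    r = Rbar_plus (arc_sup gamma nd thd v j) (arc_seminorm gamma nd thd s v j)))) as [_ Hlub].
  apply Hlub. intros r [j [Hj ->]]. destruct (H j Hj) as [HB Hh].
  change (Finite (B + rpow (/ d) s * A)) with (Rbar_plus B (rpow (/ d) s * A)).
  apply Rbar_plus_le_compat.
  - unfold arc_sup. apply Lub_Rbar_correct. intros q [x [Hx ->]]. simpl. now apply HB.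
  - unfold arc_seminorm. apply Lub_Rbar_correct. intros q [x [y [Hx [Hy [Hxy ->]]]]]. simpl.
    destruct (Hd j Hj x y Hx Hy) as [D1 _].
    assert (Hxy0 : 0 < Rabs (x - y)) by (apply Rabs_pos_lt; lra).
    assert (0 < d * Rabs (x - y)) by (apply Rmult_lt_0_compat; assumption).
    rewrite <- rpow_pos_eq by lra.
    assert (Hr : 0 < rpow (arc_dist gamma nd x y) s)
      by (rewrite rpow_pos_eq by lra; unfold Rpower; apply exp_pos).
    apply Rmult_le_reg_r with (rpow (arc_dist gamma nd x y) s); [assumption|].
    unfold Rdiv. rewrite (Rmult_assoc (Cmod _)), Rinv_l, Rmult_1_r by lra.
    eapply Rle_trans; [now apply Hh|].
    rewrite (Rmult_comm (rpow (/ d) s)), Rmult_assoc. apply Rmult_le_compat_l; [assumption|].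
    rewrite <- rpow_mult by lra. apply rpow_mono; [assumption|lra|].
    apply Rmult_le_reg_l with d; [assumption|]. rewrite <- Rmult_assoc, Rinv_r by lra. lra.
Qed.

(** * Splitting off the jumps *)

Lemma break_params_le i j : (1 <= i)%nat -> (i <= j)%nat -> (j <= nd)%nat -> thd i <= thd j.
Proof.
  intros Hi Hij Hj. destruct (Nat.eq_dec i j) as [->|]; [lra|].
  left. apply (break_params_increasing nd thd Hthd); lia.
Qed.

(* On the arc [j] the jump generator [G_i] is affine. *)
Definition jump_ramp (i j : nat) (x : R) : R := (if Nat.leb i j then 1 else 0) - x / (2 * PI).

Lemma angle_arc j x : arc_index j -> lo j < x <= hi j ->
  (x < 2 * PI /\ angle gamma (gamma x) = x) \/
  (2 * PI <= x /\ j = nd /\ angle gamma (gamma x) = x - 2 * PI).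
Proof.
  intros Hj Hx. unfold arc_index, arc_lo in *.
  pose proof (break_params_range nd thd Hthd) as Hr. pose proof (Hr j Hj) as Rj.
  destruct (Rlt_dec x (2 * PI)) as [H|H].
  - left. split; [assumption|]. apply angle_gamma. lra.
  - right. destruct (arc_hi_cases j Hj) as [[H1 E]|[H1 E]]; rewrite E in Hx.
    + pose proof (Hr (S j) ltac:(lia)). lra.
    + split; [lra|]. split; [assumption|].
      pose proof (Hr 1%nat ltac:(lia)).
      replace (gamma x) with (gamma (x - 2 * PI)).
      * apply angle_gamma. lra.
      * rewrite <- (gamma_periodic (x - 2 * PI)). f_equal. ring.
Qed.

(** Past the cut the angle drops by [2 * PI]: the step function falls from 1 to 0 and the ramp by 1.
    The two changes cancel, so the same affine formula continues along the last arc. *)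
Lemma Ggen_arc i j x : arc_index i -> arc_index j ->
  lo j < x <= hi j -> Ggen gamma thd i (gamma x) = jump_ramp i j x.
Proof.
  intros Hi Hj Hx. pose proof PI_RGT_0 as HP.
  unfold Ggen, Hgen, ramp, jump_ramp.
  destruct (angle_arc j x Hj Hx) as [[H ->]|[H [E ->]]]; unfold arc_index, arc_lo in *.
  - destruct (Nat.leb_spec i j) as [Hij|Hij].
    + pose proof (break_params_le i j ltac:(lia) Hij ltac:(lia)).
      destruct (Rle_dec x (thd i)); lra.
    + destruct (arc_hi_cases j Hj) as [[H1 E]|[H1 E]]; [|lia]. rewrite E in Hx.
      pose proof (break_params_le (S j) i ltac:(lia) Hij ltac:(lia)).
      destruct (Rle_dec x (thd i)); lra.
  - subst j. destruct (Nat.leb_spec i nd); [|lia].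
    destruct (arc_hi_cases nd Hj) as [[H1 E]|[H1 E]]; [lia|]. rewrite E in Hx.
    pose proof (break_params_le 1 i ltac:(lia) ltac:(lia) ltac:(lia)).
    destruct (Rle_dec (x - 2 * PI) (thd i)); [|lra]. field. lra.
Qed.

(** At the left end of arc [j] the generators carry their incoming values. Only the generator with
    index [j] jumps there, by 1, so only it departs from the affine formula of the arc. *)
Lemma Ggen_break i j : arc_index i -> arc_index j ->
  Ggen gamma thd i (gamma (thd j)) = jump_ramp i j (thd j) - (if Nat.eqb i j then 1 else 0).
Proof.
  intros Hi Hj. pose proof (break_params_range nd thd Hthd j Hj) as Rj.
  unfold Ggen, Hgen, ramp, jump_ramp. rewrite angle_gamma by lra.
  unfold arc_index in *.
  destruct (Nat.lt_trichotomy i j) as [H|[->|H]].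
  - pose proof (break_params_increasing nd thd Hthd i j ltac:(lia) H ltac:(lia)).
    destruct (Rle_dec (thd j) (thd i)); [lra|].
    destruct (Nat.leb_spec i j); [|lia]. destruct (Nat.eqb_spec i j); [lia|]. lra.
  - destruct (Rle_dec (thd j) (thd j)); [|lra].
    rewrite Nat.leb_refl, Nat.eqb_refl. lra.
  - pose proof (break_params_increasing nd thd Hthd j i ltac:(lia) H ltac:(lia)).
    destruct (Rle_dec (thd j) (thd i)); [|lra].
    destruct (Nat.leb_spec i j); [lia|]. destruct (Nat.eqb_spec i j); [lia|]. lra.
Qed.

Definition jump_trace (f : C -> C) (j : nat) (x : R) : C :=
  csum nd (fun i => (jump gamma thd f (S i) * RtoC (jump_ramp (S i) j x))%C).

Lemma Jpart_arc f j x : arc_index j -> lo j < x <= hi j ->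
  Jpart gamma nd thd f (gamma x) = jump_trace f j x.
Proof.
  intros Hj Hx. unfold Jpart, jump_trace. rewrite sum_n_m_csum. apply csum_ext.
  intros i Hi. rewrite (Ggen_arc (S i) j); auto. unfold arc_index; lia.
Qed.

Lemma Jpart_break f j : arc_index j ->
  Jpart gamma nd thd f (gamma (thd j)) = (jump_trace f j (thd j) - jump gamma thd f j)%C.
Proof.
  intros Hj. unfold Jpart, jump_trace. rewrite sum_n_m_csum. unfold arc_index in Hj.
  rewrite (csum_ext nd _ (fun i => (jump gamma thd f (S i) * RtoC (jump_ramp (S i) j (thd j))
    + (- RtoC 1) * (jump gamma thd f (S i) * RtoC (if Nat.eqb (S i) j then 1 else 0)))%C)).
  - rewrite csum_plus, csum_scal.
    rewrite (csum_single nd (fun i => (jump gamma thd f (S i) * RtoC (if Nat.eqb (S i) j then 1 else 0))%C) (pred j)).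
    + replace (S (pred j)) with j by lia. rewrite Nat.eqb_refl. ring.
    + lia.
    + intros i Hi Hij. destruct (Nat.eqb_spec (S i) j); [lia|]. ring.
  - intros i Hi. rewrite Ggen_break by (unfold arc_index; lia). rewrite RtoC_minus. ring.
Qed.

Lemma jump_trace_bounds f D s j : 0 < s -> s <= 1 -> 0 <= D -> arc_index j ->
  (forall i, arc_index i -> Cmod (jump gamma thd f i) <= D) ->
  (forall x, in_arc j x -> Cmod (jump_trace f j x) <= INR nd * (D * 2)) /\
  holder (in_arc j) s (INR nd * D) (jump_trace f j).
Proof.
  intros Hs Hs1 HD Hj HJ. pose proof PI2_3_2 as HP.
  pose proof (arc_nonempty j Hj) as Hn.
  pose proof (break_params_range nd thd Hthd j Hj) as Rj. unfold in_arc, arc_lo in *.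
  assert (Hq : forall x, x / (2 * PI) * (2 * PI) = x) by (intros; field; lra).
  split.
  - intros x Hx. apply csum_bound. intros i Hi. rewrite Cmod_mult, Cmod_R.
    apply Rmult_le_compat; try apply Cmod_ge_0; try apply Rabs_pos.
    + apply HJ. unfold arc_index; lia.
    (* Parameters on the arcs lie between 0 and [4 * PI], so the ramp stays in [[0, 2]] and the
       generator is at most 2 in modulus. *)
    + unfold jump_ramp. assert (0 <= x / (2 * PI) <= 2).
      { specialize (Hq x). split; nra. }
      destruct (Nat.leb (S i) j); apply Rabs_le; lra.
  - intros x y Hx Hy. unfold jump_trace.
    replace (csum nd (fun i => (jump gamma thd f (S i) * RtoC (jump_ramp (S i) j x))%C) -
             csum nd (fun i => (jump gamma thd f (S i) * RtoC (jump_ramp (S i) j y))%C))%C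
      with (csum nd (fun i => (jump gamma thd f (S i) * RtoC (- ((x - y) / (2 * PI))))%C)).
    + rewrite Rmult_assoc. apply csum_bound. intros i Hi. rewrite Cmod_mult, Cmod_R, Rabs_Ropp.
      apply Rmult_le_compat; try apply Cmod_ge_0; try apply Rabs_pos.
      * apply HJ. unfold arc_index; lia.
      * unfold Rdiv. rewrite Rabs_mult, (Rabs_pos_eq (/ (2 * PI)))
          by (left; apply Rinv_0_lt_compat; lra).
        set (d := Rabs (x - y)).
        assert (Hd : 0 <= d <= 2 * PI) by (split; [apply Rabs_pos|apply Rabs_le; lra]).
        assert (Hi1 : 0 < / (2 * PI) < 1).
        { split; [apply Rinv_0_lt_compat; lra|]. rewrite <- Rinv_1. apply Rinv_lt_contravar; lra. }
        assert (H1 : 0 <= d * / (2 * PI) <= 1).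
        { split; [apply Rmult_le_pos; lra|].
          apply Rmult_le_reg_r with (2 * PI); [lra|]. rewrite Rmult_assoc, Rinv_l; lra. }
        apply Rle_trans with (rpow (d * / (2 * PI)) s).
        -- rewrite <- (rpow_1 (d * / (2 * PI))) at 1 by lra. apply rpow_small; lra.
        -- apply rpow_mono; [assumption|lra|]. nra.
    + transitivity (csum nd (fun i => (jump gamma thd f (S i) * RtoC (jump_ramp (S i) j x)
          + (- RtoC 1) * (jump gamma thd f (S i) * RtoC (jump_ramp (S i) j y)))%C)).
      * apply csum_ext. intros i Hi.
        replace (- ((x - y) / (2 * PI))) with (jump_ramp (S i) j x - jump_ramp (S i) j y)
          by (unfold jump_ramp; field; lra).
        rewrite RtoC_minus. ring.
      * rewrite csum_plus, csum_scal. ring.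
Qed.

Lemma jump_trace_traced f s : 0 < s -> s <= 1 ->
  traced s (fun x => Jpart gamma nd thd f (gamma x)) (jump_trace f).
Proof.
  intros Hs Hs1 j Hj.
  destruct (uniform_constant (arc_index) (fun i D => Cmod (jump gamma thd f i) <= D) nd)
    as [D [HD0 HD]]; [unfold arc_index; lia|intros; lra| |].
  { intros i _. eexists. split; [apply Cmod_ge_0|apply Rle_refl]. }
  split.
  - exists (INR nd * D). split; [apply Rmult_le_pos; [apply pos_INR|assumption]|].
    now apply jump_trace_bounds.
  - intros x Hx. now apply Jpart_arc.
Qed.

(** Concatenating the arcs adds up their constants, and closing the period doubles the sum. *)
Lemma holder_glue u s A : 0 < s -> 0 <= A -> (forall x, u (x + 2 * PI) = u x) ->
  (forall j, arc_index j -> holder (in_arc j) s A u) ->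
  holder everywhere s (2 * (INR nd * A)) u.
Proof.
  intros Hs HA Hp H. pose proof Hthd as [Hn _].
  assert (Hk : forall k, (1 <= k)%nat -> (k <= nd)%nat ->
    holder (fun x => thd 1%nat <= x <= hi k) s (INR k * A) u).
  { induction 1 as [|k Hk IH]; intros Hkn.
    - simpl INR. rewrite Rmult_1_l. apply (H 1%nat). unfold arc_index; lia.
    - rewrite S_INR. replace ((INR k + 1) * A) with (INR k * A + A) by ring.
      apply holder_concat with (thd (S k)); auto.
      + apply Rmult_le_pos; [apply pos_INR|assumption].
      + destruct (arc_hi_cases k ltac:(lia)) as [[_ E]|[E _]]; [|lia].
        rewrite <- E. apply IH. lia.
      + apply (H (S k)). unfold arc_index; lia. }
  apply holder_periodic with (thd 1%nat); auto.
  - apply Rmult_le_pos; [apply pos_INR|assumption].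
  - specialize (Hk nd Hn (le_n _)).
    destruct (arc_hi_cases nd ltac:(lia)) as [[E _]|[_ E]]; [lia|].
    now rewrite E in Hk.
Qed.

Lemma jump_bound f s B : 0 < s -> PH gamma nd thd s f ->
  (forall j x, arc_index j -> in_arc j x -> Cmod (trace f j x) <= B) ->
  forall i, arc_index i -> Cmod (jump gamma thd f i) <= 2 * B.
Proof.
  intros Hs Hf HB i Hi. pose proof (PH_traced s f Hs Hf) as HT.
  unfold jump.
  rewrite (lat_out_traced s f _ i Hs HT Hi).
  rewrite (lat_in_traced s f _ i Hs HT Hi).
  eapply Rle_trans; [apply Cmod_sub_le|].
  destruct (break_arc_hi i Hi) as [j [k [Hj E]]].
  assert (E' : f (gamma (thd i)) = trace f j (hi j)).
  { pose proof (arc_nonempty j Hj).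
    rewrite <- (proj2 (HT j Hj)) by lra. rewrite E.
    now rewrite (periodic_IZR gamma gamma_periodic). }
  rewrite E'. pose proof (arc_nonempty i Hi). pose proof (arc_nonempty j Hj).
  pose proof (HB i (lo i) Hi ltac:(unfold in_arc; lra)).
  pose proof (HB j (hi j) Hj ltac:(unfold in_arc; lra)). lra.
Qed.

(** The formula includes the left end of the arc. There [f] and [J_f] both take incoming values,
    which differ from the outgoing ones by the same jump; this is the continuity of [f_C] at break
    points. *)
Lemma Cpart_trace f s j x : 0 < s -> PH gamma nd thd s f -> arc_index j -> in_arc j x ->
  Cpart gamma nd thd f (gamma x) = (trace f j x - jump_trace f j x)%C.
Proof.
  intros Hs Hf Hj Hx. pose proof (PH_traced s f Hs Hf) as HT.
  unfold Cpart. destruct (Req_dec x (lo j)) as [->|Hn].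
  - unfold arc_lo. rewrite Jpart_break by assumption. unfold jump.
    rewrite (lat_out_traced s f _ j Hs HT Hj).
    rewrite (lat_in_traced s f _ j Hs HT Hj).
    unfold arc_lo. ring.
  - unfold in_arc in Hx. rewrite (Jpart_arc f j) by (auto; lra).
    f_equal. apply (HT j Hj). lra.
Qed.

(** Jumps are at most [2 * B] and generators at most 2, whence the bound of [J_f]. As [f_C] agrees
    with a Hoelder function on every completed arc, endpoints included, the arcs can be glued. *)
Lemma Cpart_bounds f s B A : 0 < s -> s <= 1 -> 0 <= B -> 0 <= A -> PH gamma nd thd s f ->
  (forall j, arc_index j ->
     (forall x, in_arc j x -> Cmod (trace f j x) <= B) /\
     holder (in_arc j) s A (trace f j)) ->
  bnd (fun x => Jpart gamma nd thd f (gamma x)) (INR nd * (2 * B * 2)) /\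
  bnd (fun x => Cpart gamma nd thd f (gamma x)) (B + INR nd * (2 * B * 2)) /\
  holder everywhere s (2 * (INR nd * (A + INR nd * (2 * B)))) (fun x => Cpart gamma nd thd f (gamma x)).
Proof.
  intros Hs Hs1 HB HA Hf Hb.
  assert (HJ : forall i, arc_index i -> Cmod (jump gamma thd f i) <= 2 * B).
  { apply (jump_bound f s B Hs Hf). intros j x Hj Hx. now apply Hb. }
  assert (Hcov : forall x, exists j y, arc_index j /\ in_arc j y /\
     lo j < y <= hi j /\ gamma x = gamma y).
  { intros x. destruct (arcs_cover x) as [j [k [Hj Hx]]].
    exists j, (x + 2 * PI * IZR k).
    rewrite (periodic_IZR gamma gamma_periodic).
    unfold in_arc. repeat split; auto; lra || apply Hj. }
  split; [|split].
  - intros x. destruct (Hcov x) as [j [y [Hj [Hy [Hy' E]]]]]. rewrite E, (Jpart_arc f j y) by assumption.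
    now apply (jump_trace_bounds f (2 * B) s j Hs Hs1 ltac:(lra) Hj HJ).
  - intros x. destruct (Hcov x) as [j [y [Hj [Hy [Hy' E]]]]].
    rewrite E, (Cpart_trace f s j y) by assumption.
    eapply Rle_trans; [apply Cmod_sub_le|]. apply Rplus_le_compat.
    + now apply Hb.
    + now apply (jump_trace_bounds f (2 * B) s j Hs Hs1 ltac:(lra) Hj HJ).
  - pose proof (pos_INR nd). apply holder_glue; auto.
    + assert (0 <= INR nd * (2 * B)) by (apply Rmult_le_pos; lra). lra.
    + intros x. now rewrite gamma_periodic.
    + intros j Hj.
      apply holder_ext with (fun x => (trace f j x - jump_trace f j x)%C).
      * intros x Hx. symmetry. now apply (Cpart_trace f s).
      * apply holder_minus; [now apply Hb|].
        now apply (jump_trace_bounds f (2 * B) s j Hs Hs1 ltac:(lra) Hj HJ).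
Qed.

Lemma Bspline_gamma m n rho j x : (m = 2 \/ m = 3 \/ m = 4)%nat -> (5 <= n)%nat -> (j < n)%nat ->
  Bspline gamma m n rho (S j) (gamma x) = bs m n j ((x - rho) / mesh n).
Proof.
  intros Hm Hn Hj. destruct (gamma_angle_shift x) as [k [K _]].
  pose proof (mesh_pos n Hn) as Hh. pose proof (mesh_period n Hn) as Hnh.
  replace ((x - rho) / mesh n) with ((angle gamma (gamma x) - rho) / mesh n + INR n * IZR k).
  - rewrite bs_periodic by assumption. unfold Bspline, bs. f_equal.
    apply functional_extensionality. intros l. f_equal.
    unfold knot. rewrite S_INR. field. lra.
  - rewrite K at 2. rewrite <- Hnh. field. lra.
Qed.

Lemma spline_gamma m n rho a x : (m = 2 \/ m = 3 \/ m = 4)%nat -> (5 <= n)%nat ->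
  sum_n_m (G := C_AbelianMonoid) (fun j => (a j * RtoC (Bspline gamma m n rho j (gamma x)))%C) 1 n =
  spl m n rho (fun j => a (S j)) x.
Proof.
  intros Hm Hn. rewrite sum_n_m_csum. apply csum_ext. intros j Hj. now rewrite Bspline_gamma.
Qed.

(** * The integral equation *)

Variables (alpha beta mu : R) (k : C -> C -> C) (c : C -> C) (c0 : R) (lambda : C).
Hypothesis Hbeta : 0 < beta.
Hypothesis Hba : beta < alpha.
Hypothesis Ham : alpha < mu.
Hypothesis Hmu : mu <= 1.
Hypothesis Hk : kernel_regular gamma mu k.
Hypothesis Hc : PH gamma nd thd alpha c.
Hypothesis Hc0 : 0 < c0.
Hypothesis Hcinf : forall t, on_curve gamma t -> ~ break_point gamma nd thd t -> c0 <= Cmod (c t).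
Hypothesis Hker : forall w : C -> C, PH gamma nd thd beta w ->
            (forall t, on_curve gamma t ->
               (w t - lambda * Ktilde gamma k c w t)%C = RtoC 0) ->
            forall t, on_curve gamma t -> w t = RtoC 0.

Lemma on_curve_gamma x : on_curve gamma (gamma x).
Proof. now exists x. Qed.

Lemma gamma_comp_periodic (v : C -> C) x : v (gamma (x + 2 * PI)) = v (gamma x).
Proof. now rewrite gamma_periodic. Qed.

(** The lower bound holds inside the arcs, which avoid the break points, and passes to the lateral
    limits at both ends. *)
Lemma c_trace_lower j x : arc_index j -> in_arc j x ->
  c0 <= Cmod (trace c j x).
Proof.
  intros Hj Hx. assert (Ha : 0 < alpha) by lra.
  pose proof (PH_traced alpha c Ha Hc) as HT.
  pose proof (arc_nonempty j Hj) as Hn.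
  assert (Hopen : forall y, lo j < y < hi j -> c0 <= Cmod (c (gamma y))).
  { intros y Hy. apply Hcinf; [apply on_curve_gamma|].
    now apply (open_arc_not_break_point j). }
  destruct (Req_dec x (lo j)) as [->|H1]; [|destruct (Req_dec x (hi j)) as [->|H2]].
  - apply (Clim_ge (at_right (lo j)) (fun y => c (gamma y))).
    + now apply (traced_right alpha (fun y => c (gamma y))).
    + generalize (near_right (lo j) (hi j) ltac:(lra)). now apply filter_imp.
  - apply (Clim_ge (at_left (hi j)) (fun y => c (gamma y))).
    + now apply (traced_left alpha (fun y => c (gamma y))).
    + generalize (near_left (lo j) (hi j) ltac:(lra)). now apply filter_imp.
  - unfold in_arc in Hx. rewrite <- (proj2 (HT j Hj) x) by lra. apply Hopen. lra.
Qed.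

Lemma c_lower x : c0 <= Cmod (c (gamma x)).
Proof.
  assert (Ha : 0 < alpha) by lra.
  destruct (arcs_cover x) as [j [q [Hj Hx]]].
  rewrite <- (periodic_IZR (fun y => c (gamma y)) (gamma_comp_periodic c) q x).
  rewrite (proj2 (PH_traced alpha c Ha Hc j Hj)) by assumption.
  apply c_trace_lower; auto. unfold in_arc. lra.
Qed.

Lemma c_neq_0 x : c (gamma x) <> RtoC 0.
Proof. apply Cmod_gt_0. pose proof (c_lower x). lra. Qed.

Lemma c_inv_traced : traced alpha (fun x => (/ c (gamma x))%C)
  (fun j x => (/ trace c j x)%C).
Proof.
  apply (traced_inv alpha (fun x => c (gamma x)) _ c0 Hc0).
  - intros j x. apply c_trace_lower.
  - apply (PH_traced); auto. lra.
Qed.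

(** [lambda], the weight [1 / c] and the line element are absorbed into the kernel, so that the
    operator it defines is [lambda * Ktilde] in the parameter ([Ktilde_Aop]). *)
Definition kappa (x y : R) : C :=
  (lambda * k (gamma x) (gamma y) * / c (gamma y) * CDerive gamma y)%C.

Lemma kernel_continuous x y0 : Clim (locally y0) (fun y => k (gamma x) (gamma y)) (k (gamma x) (gamma y0)).
Proof.
  destruct Hk as [_ [_ [om [Hom1 Hom2]]]].
  destruct (gamma_lipschitz) as [L [HL0 HL]].
  apply Clim_locally_iff. intros e He.
  destruct (proj1 (filterlim_locally (U := R_UniformSpace) om 0) Hom1 (mkposreal e He)) as [d Hd].
  exists (d / L). split; [apply Rdiv_lt_0_compat; [apply cond_pos|assumption]|].
  intros y Hy. set (r := Cmod (gamma y - gamma y0)%C).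
  assert (Hr : r < d).
  { apply Rle_lt_trans with (1 := HL y y0).
    replace (pos d) with (L * (d / L)) by (field; lra). now apply Rmult_lt_compat_l. }
  (* The modulus of continuity is controlled only to the right of 0, so coinciding points are
     treated apart. *)
  destruct (Cmod_ge_0 (gamma y - gamma y0)) as [Hr0|Hr0].
  - apply Rle_lt_trans with (1 := Hom2 _ _ _ (on_curve_gamma x) (on_curve_gamma y) (on_curve_gamma y0)).
    fold r. assert (Hb : ball (M := R_UniformSpace) 0 e (om r)).
    { apply Hd; [|exact Hr0]. unfold ball; simpl; unfold AbsRing_ball, abs, minus, plus, opp; simpl.
      replace (r + - 0) with r by ring. rewrite Rabs_pos_eq; [assumption|]. apply Cmod_ge_0. }
    unfold ball in Hb; simpl in Hb; unfold AbsRing_ball, abs, minus, plus, opp in Hb; simpl in Hb.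
    replace (om r + - 0) with (om r) in Hb by ring. apply Rle_lt_trans with (2 := Hb). apply RRle_abs.
  - symmetry in Hr0. apply Cmod_eq_0 in Hr0.
    replace (gamma y) with (gamma y0)
      by (replace (gamma y) with ((gamma y - gamma y0) + gamma y0)%C by ring; rewrite Hr0; ring).
    replace (k (gamma x) (gamma y0) - k (gamma x) (gamma y0))%C with (RtoC 0) by ring.
    now rewrite Cmod_0.
Qed.

Lemma kappa_pwc x : pwc nd thd (kappa x).
Proof.
  assert (Hcst : forall a : C, pwc nd thd (fun _ => a)).
  { intros a. apply pwc_continuous. intros y. apply Clim_const, locally_filter. }
  unfold kappa. repeat apply pwc_mult.
  - apply Hcst.
  - apply pwc_continuous. intros y. apply kernel_continuous.
  - apply (traced_pwc alpha _ (fun j x => (/ trace c j x)%C)).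
    + lra.
    + intros y. now rewrite gamma_comp_periodic.
    + apply c_inv_traced.
  - apply pwc_continuous. apply dgamma_CP.
Qed.

Lemma kappa_bounds : exists M0 M1, 0 <= M0 /\ 0 <= M1 /\
  (forall x y, Cmod (kappa x y) <= M0) /\
  (forall x x' y, Cmod (kappa x y - kappa x' y)%C <= M1 * rpow (Rabs (x - x')) mu).
Proof.
  destruct Hk as [[N0 HN0] [[Nmu HNmu] _]].
  destruct (gamma_lipschitz) as [L [HL0 HL]].
  destruct (CP_bounded _ dgamma_CP) as [Bg [HBg0 HBg]].
  assert (Hci : forall y, Cmod (/ c (gamma y))%C <= / c0).
  { intros y. rewrite Cmod_inv by apply c_neq_0. apply Rinv_le_contravar; [assumption|apply c_lower]. }
  assert (Hc0i : 0 < / c0) by now apply Rinv_0_lt_compat.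
  pose proof (Cmod_ge_0 lambda) as Hl. pose proof (rpow_ge_0 L mu) as HrL.
  pose proof (Rabs_pos N0) as HN0a. pose proof (Rabs_pos Nmu) as HNma.
  exists (Cmod lambda * Rabs N0 * / c0 * Bg), (Cmod lambda * (Rabs Nmu * rpow L mu) * / c0 * Bg).
  split; [repeat apply Rmult_le_pos; try assumption; lra|].
  split; [repeat apply Rmult_le_pos; try assumption; lra|].
  split.
  - intros x y. unfold kappa. rewrite !Cmod_mult.
    repeat apply Rmult_le_compat; repeat apply Rmult_le_pos; try apply Cmod_ge_0; try apply Rle_refl; auto.
    eapply Rle_trans; [apply HN0; apply on_curve_gamma|]. apply RRle_abs.
  - intros x x' y. unfold kappa.
    replace (lambda * k (gamma x) (gamma y) * / c (gamma y) * CDerive gamma y -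
             lambda * k (gamma x') (gamma y) * / c (gamma y) * CDerive gamma y)%C
      with (lambda * (k (gamma x) (gamma y) - k (gamma x') (gamma y)) * / c (gamma y) * CDerive gamma y)%C
      by ring.
    rewrite !Cmod_mult.
    set (r := rpow (Rabs (x - x')) mu).
    replace (Cmod lambda * (Rabs Nmu * rpow L mu) * / c0 * Bg * r)
      with (Cmod lambda * (Rabs Nmu * rpow L mu * r) * / c0 * Bg) by ring.
    repeat apply Rmult_le_compat; repeat apply Rmult_le_pos; try apply Cmod_ge_0; try apply Rle_refl; auto.
    (* The kernel hypothesis concerns distinct points, whereas different parameters may give the
       same one. *)
    destruct (excluded_middle_informative (gamma x = gamma x')) as [E|E].
    + rewrite E. replace (k (gamma x') (gamma y) - k (gamma x') (gamma y))%C with (RtoC 0) by ring.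
      rewrite Cmod_0. repeat apply Rmult_le_pos; try assumption. apply rpow_ge_0.
    + eapply Rle_trans; [apply HNmu; auto; apply on_curve_gamma|].
      assert (H0 : 0 < Cmod (gamma x - gamma x')%C).
      { apply Cmod_gt_0. intros H. apply E.
        replace (gamma x) with ((gamma x - gamma x') + gamma x')%C by ring. rewrite H. ring. }
      rewrite <- rpow_pos_eq by assumption. rewrite Rmult_assoc.
      unfold r. rewrite <- rpow_mult by (try apply Rabs_pos; lra).
      apply Rle_trans with (Rabs Nmu * rpow (Cmod (gamma x - gamma x')%C) mu).
      * apply Rmult_le_compat_r; [apply rpow_ge_0|apply RRle_abs].
      * apply Rmult_le_compat_l; [assumption|]. apply rpow_mono; [lra|apply Cmod_ge_0|apply HL].
Qed.

Let A := Aop kappa.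

Lemma CP_pwc u : CP u -> pwc nd thd u.
Proof. intros [H _]. now apply pwc_continuous. Qed.

Lemma Ktilde_Aop (w : C -> C) x : pwc nd thd (fun y => w (gamma y)) ->
  (lambda * Ktilde gamma k c w (gamma x))%C = A (fun y => w (gamma y)) x.
Proof.
  intros Hw. unfold Ktilde, contour_int.
  change (RInt (V := C_R_CompleteNormedModule) ?g 0 (2 * PI)) with (Cint g).
  assert (Hint : ex_Cint (fun y => (k (gamma x) (gamma y) * / c (gamma y) * w (gamma y) * CDerive gamma y)%C)).
  { apply (pwc_ex_Cint nd thd _ Hthd). repeat apply pwc_mult; auto.
    - apply pwc_continuous. intros y. apply kernel_continuous.
    - apply (traced_pwc alpha _ (fun j x => (/ trace c j x)%C)).
      + lra.
      + intros y. now rewrite gamma_comp_periodic.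
      + apply c_inv_traced.
    - apply pwc_continuous. apply dgamma_CP. }
  rewrite <- Cint_scal by assumption. unfold A, Aop. apply Cint_ext. intros y. unfold kappa. ring.
Qed.

(** Arguments are only piecewise continuous, because [A] also acts on [J_f] and on [w]; the images
    are nevertheless continuous and periodic. *)
Lemma operator_bounds : exists M, 0 <= M /\
  (forall u B, pwc nd thd u -> (forall y, 0 <= y <= 2 * PI -> Cmod (u y) <= B) ->
     bnd (A u) (M * B) /\
     forall s, 0 < s -> s <= mu -> holder everywhere s (M * B) (A u)) /\
  (forall u, pwc nd thd u -> (exists B, forall y, 0 <= y <= 2 * PI -> Cmod (u y) <= B) -> CP (A u)).
Proof.
  destruct kappa_bounds as [M0 [M1 [HM0 [HM1 [Kb Kh]]]]]. pose proof PI_RGT_0 as HP.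
  assert (Hb : forall u B, pwc nd thd u -> (forall y, 0 <= y <= 2 * PI -> Cmod (u y) <= B) ->
     bnd (A u) (2 * PI * (2 * M0 + M1) * B) /\
     forall s, 0 < s -> s <= mu -> holder everywhere s (2 * PI * (2 * M0 + M1) * B) (A u)).
  { intros u B Hu HB.
    assert (B0 : 0 <= B) by (apply Rle_trans with (2 := HB 0 ltac:(lra)); apply Cmod_ge_0).
    split.
    - intros x. eapply Rle_trans; [apply (Aop_sup nd thd Hthd kappa M0 kappa_pwc Kb u B Hu HB)|].
      apply Rmult_le_compat_r; [assumption|]. apply Rmult_le_compat_l; lra.
    - intros s Hs Hsm.
      now apply (Aop_holder nd thd Hthd kappa M0 M1 mu HM0 HM1 kappa_pwc Kb Kh). }
  exists (2 * PI * (2 * M0 + M1)). split; [|split; [exact Hb|]].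
  - apply Rmult_le_pos; lra.
  - intros u Hu [B HB]. split.
    + destruct (Hb u B Hu HB) as [_ H].
      apply holder_continuous with mu (2 * PI * (2 * M0 + M1) * B); [lra|]. apply H; lra.
    + intros x. unfold A, Aop. apply Cint_ext. intros y. unfold kappa.
      now rewrite gamma_periodic.
Qed.

Lemma A_linear u v a : pwc nd thd u -> pwc nd thd v ->
  forall x, A (fun y => (u y + a * v y)%C) x = (A u x + a * A v x)%C.
Proof. apply (Aop_linear nd thd Hthd kappa kappa_pwc). Qed.

Lemma A_minus u v : pwc nd thd u -> pwc nd thd v ->
  forall x, A (fun y => (u y - v y)%C) x = (A u x - A v x)%C.
Proof.
  intros Hu Hv x.
  replace (fun y => (u y - v y)%C) with (fun y => (u y + (- RtoC 1) * v y)%C)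
    by (apply functional_extensionality; intros; ring).
  rewrite A_linear by assumption. ring.
Qed.

Lemma A_CP u : CP u -> CP (A u).
Proof.
  intros Hu. destruct operator_bounds as [M [_ [_ H]]]. apply H; [now apply CP_pwc|].
  destruct (CP_bounded u Hu) as [B [_ HB]]. exists B. intros y _. apply HB.
Qed.

Definition lift (u : R -> C) (t : C) : C := u (angle gamma t).

Lemma lift_gamma u x : (forall y, u (y + 2 * PI) = u y) -> lift u (gamma x) = u x.
Proof.
  intros Hu. unfold lift. destruct (gamma_angle_shift x) as [q [Hq _]].
  rewrite <- (periodic_IZR u Hu q (angle gamma (gamma x))). now rewrite <- Hq.
Qed.

Lemma traced_in_kernel (w : C -> C) T : traced beta (fun x => w (gamma x)) T ->
  (forall x, w (gamma x) = A (fun y => w (gamma y)) x) -> forall x, w (gamma x) = RtoC 0.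
Proof.
  intros HT Hw x. apply Hker; [|intros t [y ->]|apply on_curve_gamma].
  - now apply (PH_of_traced beta w T).
  - rewrite Ktilde_Aop.
    + rewrite <- Hw. ring.
    + apply (traced_pwc beta _ T); auto. intros z. apply gamma_comp_periodic.
Qed.

(** The kernel hypothesis concerns piecewise [beta]-Hoelder functions. It applies to a continuous
    [u = A u], which is [beta]-Hoelder as an image under [A]. *)
Lemma A_kernel u : CP u -> (forall x, u x = A u x) -> forall x, u x = RtoC 0.
Proof.
  intros Hu HA x. pose proof (proj2 Hu) as Hp.
  assert (Hl : (fun y => lift u (gamma y)) = u)
    by (apply functional_extensionality; intros y; now apply lift_gamma).
  rewrite <- (lift_gamma u x Hp).
  apply (traced_in_kernel (lift u) (fun _ => u)).
  - rewrite Hl. destruct operator_bounds as [M [HM [HMb _]]].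
    destruct (CP_bounded u Hu) as [B [HB0 HB]].
    apply (traced_global beta u (M * B)); [now apply Rmult_le_pos|].
    apply holder_ext with (A u); [intros; symmetry; apply HA|].
    apply HMb; [now apply CP_pwc|intros; apply HB|assumption|lra].
  - intros y. rewrite Hl, lift_gamma by assumption. apply HA.
Qed.

(** The a priori bound for an arbitrary [u] follows from existence: the solution constructed for the
    datum [u - A u] satisfies the bound, and injectivity identifies it with [u]. *)
Lemma second_kind_solvable : exists Kf, 0 <= Kf /\
  (forall g, CP g -> exists u, CP u /\ forall x, (u x - A u x)%C = g x) /\
  (forall u G, CP u -> bnd (fun x => (u x - A u x)%C) G -> bnd u (Kf * G)).
Proof.
  destruct operator_bounds as [M [HM [HMb HMc]]].
  destruct (fredholm_alternative A M mu) as [Kf [HKf Hsol]].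
  - lra.
  - intros u v a Hu Hv. apply A_linear; now apply CP_pwc.
  - intros u B Hu HB. apply HMb; [now apply CP_pwc|]. intros; apply HB.
  - intros u B Hu HB. apply HMb; [now apply CP_pwc|intros; apply HB|lra|lra].
  - apply A_CP.
  - apply A_kernel.
  - apply sampling_operators. lra.
  - exists Kf. split; [assumption|]. split.
    + intros g Hg. destruct (CP_bounded g Hg) as [G [_ HG]].
      destruct (Hsol g G Hg HG) as [u [Hu [Hug _]]]. eauto.
    + intros u G Hu HG.
      destruct (Hsol _ G (CP_minus _ _ Hu (A_CP u Hu)) HG) as [v [Hv [Hvg Hvb]]].
      assert (Hd : forall x, (u x - v x)%C = RtoC 0).
      { apply A_kernel; [now apply CP_minus|]. intros x.
        rewrite A_minus by now apply CP_pwc.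
        replace (u x - v x)%C with ((u x - A u x) - (v x - A v x) + (A u x - A v x))%C by ring.
        rewrite Hvg. ring. }
      intros x. replace (u x) with ((u x - v x) + v x)%C by ring. rewrite Hd, Cplus_0_l. apply Hvb.
Qed.

Lemma c_traced_beta : traced beta (fun x => c (gamma x)) (trace c).
Proof.
  apply (traced_lower_exponent alpha); try lra.
  apply (PH_traced); auto. lra.
Qed.

Lemma cphi_traced phi T : traced beta (fun x => phi (gamma x)) T ->
  traced beta (fun x => (c (gamma x) * phi (gamma x))%C) (fun j x => (trace c j x * T j x)%C).
Proof.
  intros HT. apply (traced_mult beta (fun x => c (gamma x)) (fun x => phi (gamma x))); auto.
  apply c_traced_beta.
Qed.

Lemma cphi_pwc phi T : traced beta (fun x => phi (gamma x)) T ->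
  pwc nd thd (fun x => (c (gamma x) * phi (gamma x))%C).
Proof.
  intros HT. apply (traced_pwc beta _ _ Hbeta) with (2 := cphi_traced phi T HT).
  intros x. now rewrite !gamma_comp_periodic.
Qed.

Lemma solves_iff phi T f : traced beta (fun x => phi (gamma x)) T ->
  (solves gamma k c lambda f phi <->
   forall x, (c (gamma x) * phi (gamma x) - A (fun y => (c (gamma y) * phi (gamma y))%C) x)%C = f (gamma x)).
Proof.
  intros HT. pose proof (cphi_pwc phi T HT) as Hpw.
  assert (HK : forall x, (lambda * Kop gamma k phi (gamma x))%C
    = A (fun y => (c (gamma y) * phi (gamma y))%C) x).
  { intros x. rewrite <- (Ktilde_Aop (fun t => (c t * phi t)%C)) by assumption. f_equal.
    unfold Kop, Ktilde, contour_int. apply (RInt_ext (V := C_R_CompleteNormedModule)).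
    intros y _. match goal with |- @eq _ ?p ?q => change (@eq C p q) end.
    field. apply c_neq_0. }
  split.
  - intros H x. rewrite <- HK. apply H. apply on_curve_gamma.
  - intros H t [x ->]. rewrite HK. apply H.
Qed.

Lemma traced_bound s v T : 0 < s -> (forall x, v (x + 2 * PI) = v x) -> traced s v T ->
  exists B, bnd v B.
Proof.
  intros Hs Hp HT.
  destruct (uniform_constant (arc_index)
    (fun j B => forall x, in_arc j x -> Cmod (T j x) <= B) nd) as [B [_ HB]].
  - unfold arc_index; lia.
  - intros j M M' H HMM x Hx. specialize (H x Hx). lra.
  - intros j Hj. destruct (HT j Hj) as [[M [HM0 HM]] _].
    now apply (holder_bounded j s M).
  - exists B. intros x.
    destruct (arcs_cover x) as [j [q [Hi Hx]]].
    rewrite <- (periodic_IZR v Hp q x). rewrite (proj2 (HT j Hi)) by assumption.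
    apply (HB j Hi). unfold in_arc. lra.
Qed.

Lemma PH_data_bounds f : PH gamma nd thd alpha f -> exists B A0, 0 <= B /\ 0 <= A0 /\
  forall j, arc_index j ->
     (forall x, in_arc j x -> Cmod (trace f j x) <= B) /\
     holder (in_arc j) alpha A0 (trace f j).
Proof.
  intros Hf. assert (Ha : 0 < alpha) by lra.
  pose proof (PH_traced alpha f Ha Hf) as HT.
  destruct (uniform_constant (arc_index)
    (fun j M => holder (in_arc j) alpha M (trace f j)) nd) as [A0 [HA0 HA]].
  - unfold arc_index; lia.
  - intros j M M' H HMM. now apply holder_weaken with M.
  - intros j Hj. apply (HT j Hj).
  - destruct (uniform_constant (arc_index)
      (fun j B => forall x, in_arc j x -> Cmod (trace f j x) <= B) nd)
      as [B [HB0 HB]].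
    + unfold arc_index; lia.
    + intros j M M' H HMM x Hx. specialize (H x Hx). lra.
    + intros j Hj. apply (holder_bounded j alpha A0); auto.
    + exists B, A0. auto.
Qed.

Let J f := fun x => Jpart gamma nd thd f (gamma x).
Let F f := fun x => Cpart gamma nd thd f (gamma x).

Lemma J_pwc f : pwc nd thd (J f).
Proof.
  assert (Ha : 0 < alpha) by lra.
  apply (traced_pwc alpha _ (jump_trace f)); auto.
  - intros x. apply gamma_comp_periodic.
  - apply (jump_trace_traced); lra.
Qed.

Lemma F_CP f : PH gamma nd thd alpha f -> CP (F f).
Proof.
  intros Hf. assert (Ha : 0 < alpha) by lra.
  destruct (PH_data_bounds f Hf) as [B [A0 [HB0 [HA0 HB]]]].
  destruct (Cpart_bounds f alpha B A0) as [_ [_ H]]; auto; [lra|].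
  split.
  - apply holder_continuous with (2 := H). assumption.
  - intros x. apply gamma_comp_periodic.
Qed.

Lemma J_bounded f : PH gamma nd thd alpha f -> exists B, bnd (J f) B.
Proof.
  intros Hf. assert (Ha : 0 < alpha) by lra.
  destruct (PH_data_bounds f Hf) as [B [A0 [HB0 [HA0 HB]]]].
  destruct (Cpart_bounds f alpha B A0) as [H _]; auto; [lra|].
  eexists. exact H.
Qed.

Lemma AJ_CP f : PH gamma nd thd alpha f -> CP (A (J f)).
Proof.
  intros Hf. destruct operator_bounds as [M [_ [_ H]]]. apply H; [apply J_pwc|].
  destruct (J_bounded f Hf) as [B HB]. exists B. intros; apply HB.
Qed.

(* [f = F f + J f], so [w = u + J f] turns the equation for [w] into one for the continuous [u]. *)
Lemma regularized_equation f u : CP u ->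
  ((forall x, (u x - A u x)%C = (F f x + A (J f) x)%C) <->
   (forall x, ((u x + J f x) - A (fun y => (u y + J f y)%C) x)%C = f (gamma x))).
Proof.
  intros Hu.
  assert (HA : forall x, A (fun y => (u y + J f y)%C) x = (A u x + A (J f) x)%C).
  { intros x. replace (fun y => (u y + J f y)%C) with (fun y => (u y + RtoC 1 * J f y)%C)
      by (apply functional_extensionality; intros; ring).
    rewrite A_linear; [ring|now apply CP_pwc|apply J_pwc]. }
  assert (Hf : forall x, f (gamma x) = (F f x + J f x)%C) by (intros x; unfold F, J, Cpart; ring).
  split; intros H x; specialize (H x).
  - rewrite HA, Hf. replace (u x + J f x - (A u x + A (J f) x))%C
      with ((u x - A u x) + J f x - A (J f) x)%C by ring. rewrite H. ring.
  - rewrite HA, Hf in H. replace (u x - A u x)%C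
      with ((u x + J f x - (A u x + A (J f) x)) - J f x + A (J f) x)%C by ring. rewrite H. ring.
Qed.

Lemma c_inv_traced_beta : traced beta (fun x => (/ c (gamma x))%C)
  (fun j x => (/ trace c j x)%C).
Proof. apply (traced_lower_exponent alpha); try lra. apply c_inv_traced. Qed.

Lemma J_traced_beta f : traced beta (J f) (jump_trace f).
Proof. apply (jump_trace_traced); lra. Qed.

Lemma equation_solvable f : PH gamma nd thd alpha f ->
  exists phi, (PH gamma nd thd beta phi /\ solves gamma k c lambda f phi) /\
    forall phi', PH gamma nd thd beta phi' -> solves gamma k c lambda f phi' ->
      forall t, on_curve gamma t -> phi' t = phi t.
Proof.
  intros Hf. destruct second_kind_solvable as [Kf [_ [Hsol _]]].
  destruct (Hsol (fun x => (F f x + A (J f) x)%C)) as [u [Hu Hug]].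
  { apply CP_plus; [now apply F_CP|now apply AJ_CP]. }
  set (phi := fun t => (/ c t * (lift u t + Jpart gamma nd thd f t))%C).
  assert (Hphi : forall x, phi (gamma x) = (/ c (gamma x) * (u x + J f x))%C).
  { intros x. unfold phi. now rewrite lift_gamma by apply Hu. }
  (* Bootstrapping: [u = f_C + A (u + J_f)] with [u + J_f] bounded, so [u] inherits the exponent
     [alpha], which is then lowered to [beta]. *)
  assert (Hu_traced : traced beta u (fun _ => u)).
  { destruct operator_bounds as [M [HM [HMb _]]].
    destruct (CP_bounded u Hu) as [B [HB0 HB]].
    destruct (J_bounded f Hf) as [BJ HBJ].
    destruct (PH_data_bounds f Hf) as [Bf [A0 [HBf0 [HA0 HBf]]]].
    destruct (Cpart_bounds f alpha Bf A0) as [_ [_ HF]]; auto; try lra.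
    assert (BJ0 : 0 <= BJ) by (apply Rle_trans with (2 := HBJ 0); apply Cmod_ge_0).
    pose proof (pos_INR nd) as Hn.
    assert (H0 : 0 <= 2 * (INR nd * (A0 + INR nd * (2 * Bf)))).
    { assert (0 <= INR nd * (2 * Bf)) by (apply Rmult_le_pos; lra).
      assert (0 <= INR nd * (A0 + INR nd * (2 * Bf))) by (apply Rmult_le_pos; lra). lra. }
    apply (traced_lower_exponent alpha); try lra.
    apply (traced_global alpha u (2 * (INR nd * (A0 + INR nd * (2 * Bf))) + M * (B + BJ))).
    - assert (0 <= M * (B + BJ)) by (apply Rmult_le_pos; lra). lra.
    - apply holder_ext with (fun x => (F f x + A (fun y => (u y + J f y)%C) x)%C).
      + intros x _. pose proof (proj1 (regularized_equation f u Hu) Hug x) as H.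
        replace (F f x) with (f (gamma x) - J f x)%C by (unfold F, J, Cpart; ring).
        rewrite <- H. ring.
      + apply holder_plus; [exact HF|].
        apply HMb; try lra.
        * apply pwc_plus; [now apply CP_pwc|apply J_pwc].
        * intros y _. eapply Rle_trans; [apply Cmod_triangle|].
          specialize (HB y). specialize (HBJ y). lra. }
  assert (Hphi_traced : traced beta (fun x => phi (gamma x))
    (fun j x => (/ trace c j x * (u x + jump_trace f j x))%C)).
  { replace (fun x => phi (gamma x)) with (fun x => (/ c (gamma x) * (u x + J f x))%C)
      by (apply functional_extensionality; intros; now rewrite Hphi).
    apply (traced_mult beta (fun x => (/ c (gamma x))%C) (fun x => (u x + J f x)%C)); auto.
    - apply c_inv_traced_beta.
    - apply (traced_plus beta u (J f) (fun _ => u)); auto. apply J_traced_beta. }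
  assert (Hcphi : forall y, (c (gamma y) * phi (gamma y))%C = (u y + J f y)%C).
  { intros y. rewrite Hphi. field. apply c_neq_0. }
  assert (Hsolves : solves gamma k c lambda f phi).
  { apply (solves_iff phi _ f Hphi_traced). intros x.
    rewrite <- (proj1 (regularized_equation f u Hu) Hug x), Hcphi. f_equal. f_equal. f_equal.
    apply functional_extensionality. exact Hcphi. }
  exists phi. split; [split|].
  - now apply (PH_of_traced beta _ _ Hbeta Hphi_traced).
  - exact Hsolves.
  - intros phi' Hphi' Hs' t [x ->].
    pose proof (PH_traced beta phi' Hbeta Hphi') as HT'.
    pose proof (proj1 (solves_iff phi _ f Hphi_traced) Hsolves) as Hs1.
    pose proof (proj1 (solves_iff phi' _ f HT') Hs') as Hs2.
    (* The difference of the weighted solutions [c phi'] and [c phi] solves the homogeneous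
       equation. *)
    pose proof (traced_in_kernel (fun t => (c t * phi' t + (- RtoC 1) * (c t * phi t))%C) _
      (traced_plus beta _ _ _ _ (cphi_traced phi' _ HT')
         (traced_scal beta (- RtoC 1) _ _ (cphi_traced phi _ Hphi_traced)))) as H0.
    assert (Hz : (c (gamma x) * phi' (gamma x) + (- RtoC 1) * (c (gamma x) * phi (gamma x)))%C = RtoC 0).
    { apply H0. intros y.
      rewrite A_linear; [|eapply cphi_pwc; exact HT'|eapply cphi_pwc; exact Hphi_traced].
      replace (A (fun y => (c (gamma y) * phi' (gamma y))%C) y)
        with (c (gamma y) * phi' (gamma y) - f (gamma y))%C by (rewrite <- Hs2; ring).
      replace (A (fun y => (c (gamma y) * phi (gamma y))%C) y)
        with (c (gamma y) * phi (gamma y) - f (gamma y))%C by (rewrite <- Hs1; ring).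
      ring. }
    pose proof (c_neq_0 x) as Hcx.
    replace (phi' (gamma x)) with
      (/ c (gamma x) * (c (gamma x) * phi' (gamma x) + (- RtoC 1) * (c (gamma x) * phi (gamma x))) + phi (gamma x))%C
      by (field; assumption).
    rewrite Hz. ring.
Qed.

Lemma weighted_equation f phi : PH gamma nd thd alpha f ->
  PH gamma nd thd beta phi -> solves gamma k c lambda f phi ->
  let w := fun t => (c t * phi t)%C in
  (forall t, on_curve gamma t -> (w t - lambda * Ktilde gamma k c w t)%C = f t) /\
  (forall j, (1 <= j <= nd)%nat -> jump gamma thd w j = jump gamma thd f j).
Proof.
  intros Hf Hphi Hs w. assert (Ha : 0 < alpha) by lra.
  pose proof (PH_traced beta phi Hbeta Hphi) as HT.
  pose proof (PH_traced alpha f Ha Hf) as HTf.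
  pose proof (cphi_traced phi _ HT) as HTw. pose proof (cphi_pwc phi _ HT) as Hwp.
  change (traced beta (fun x => w (gamma x)) (fun j x => (trace c j x * trace phi j x)%C)) in HTw.
  pose proof (proj1 (solves_iff phi _ f HT) Hs) as Heq.
  split.
  - intros t [x ->]. rewrite Ktilde_Aop by assumption. apply Heq.
  - intros j Hj.
    assert (HAw : CP (A (fun x => w (gamma x)))).
    { destruct operator_bounds as [M [_ [_ H]]]. apply H; [assumption|].
      destruct (traced_bound beta (fun x => w (gamma x)) _ Hbeta (gamma_comp_periodic w) HTw) as [B HB].
      exists B. intros; apply HB. }
    assert (Hw : forall x, w (gamma x) = (f (gamma x) + A (fun x => w (gamma x)) x)%C).
    { intros x. rewrite <- Heq. unfold w. ring. }
    unfold jump.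
    assert (Ho : lat_out gamma w (thd j) = (lat_out gamma f (thd j) + A (fun x => w (gamma x)) (thd j))%C).
    { rewrite (lat_out_traced alpha f _ j Ha HTf Hj).
      apply (lim_Clim (at_right (thd j)) (fun x => w (gamma x))).
      apply (Clim_ext (at_right (thd j)) (fun x => (f (gamma x) + A (fun x => w (gamma x)) x)%C)).
      - apply filter_forall. intros x. symmetry. apply Hw.
      - apply Clim_plus; [apply within_filter, locally_filter| |].
        + now apply (traced_right alpha (fun x => f (gamma x))).
        + apply Clim_locally_right. apply HAw. }
    assert (Hi : lat_in gamma w (thd j) = (lat_in gamma f (thd j) + A (fun x => w (gamma x)) (thd j))%C).
    { rewrite (lat_in_traced alpha f _ j Ha HTf Hj).
      rewrite (lat_in_traced beta w _ j Hbeta HTw Hj). apply Hw. }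
    rewrite Ho, Hi. ring.
Qed.

(** * The discrete problem and its convergence *)

Lemma in_spline_space_spl m n rho s : (m = 2 \/ m = 3 \/ m = 4)%nat -> (5 <= n)%nat ->
  in_spline_space gamma m n rho s -> exists a, forall x, s (gamma x) = spl m n rho a x.
Proof.
  intros Hm Hn [a Ha]. exists (fun j => a (S j)). intros x.
  rewrite Ha by apply on_curve_gamma. now apply (spline_gamma).
Qed.

Lemma knot_node n rho i : knot n rho (S i) = node n rho i.
Proof. unfold knot, node. rewrite S_INR. f_equal. f_equal. ring. Qed.

Lemma collocates_spl m n rho s a f : (m = 2 \/ m = 3 \/ m = 4)%nat -> (5 <= n)%nat ->
  (forall x, s (gamma x) = spl m n rho a x) ->
  (collocates gamma nd thd k c lambda f n rho s <->
   forall i, (i < n)%nat ->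
     (spl m n rho a (node n rho i) - A (spl m n rho a) (node n rho i))%C =
     (F f (node n rho i) + A (J f) (node n rho i))%C).
Proof.
  intros Hm Hn Hs.
  assert (Es : (fun x => s (gamma x)) = spl m n rho a)
    by (apply functional_extensionality; exact Hs).
  assert (Hsp : pwc nd thd (fun x => s (gamma x))).
  { rewrite Es. apply CP_pwc. now apply spl_CP. }
  unfold collocates. split.
  - intros H i Hi. specialize (H (S i) ltac:(lia)). cbv zeta in H. rewrite knot_node in H.
    rewrite Ktilde_Aop in H by assumption. rewrite Ktilde_Aop in H by apply J_pwc.
    rewrite Es, Hs in H. exact H.
  - intros H i Hi. cbv zeta. replace i with (S (pred i)) by lia. rewrite knot_node.
    rewrite Ktilde_Aop by assumption. rewrite Ktilde_Aop by apply J_pwc.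
    rewrite Es, Hs. apply H. lia.
Qed.

Lemma uniform_trace_constant : exists Mc, 0 <= Mc /\ forall j, arc_index j ->
  holder (in_arc j) beta Mc (fun x => (/ trace c j x)%C).
Proof.
  apply (uniform_constant (arc_index)
    (fun j M => holder (in_arc j) beta M (fun x => (/ trace c j x)%C)) nd).
  - unfold arc_index; lia.
  - intros j M M' H HMM. now apply holder_weaken with M.
  - intros j Hj. apply (c_inv_traced_beta j Hj).
Qed.

(* The continuous part [u] of [w = c phi]. *)
Lemma solution_decomposition : exists Cu, 0 <= Cu /\ forall f phi,
  PH gamma nd thd alpha f -> PH gamma nd thd beta phi -> solves gamma k c lambda f phi ->
  exists u, CP u /\ (forall x, (c (gamma x) * phi (gamma x))%C = (u x + J f x)%C) /\
    (forall x, (u x - A u x)%C = (F f x + A (J f) x)%C) /\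
    (exists H, 0 <= H /\ holder everywhere alpha H u) /\
    forall N, PH_norm gamma nd thd alpha f = Finite N -> 0 <= N ->
      holder everywhere alpha (Cu * N) u.
Proof.
  assert (Ha : 0 < alpha) by lra.
  destruct operator_bounds as [M [HM [HMb HMc]]].
  destruct second_kind_solvable as [Kf [HKf [_ Hapr]]].
  destruct (PH_norm_controls alpha Ha) as [P [HP HPn]].
  pose proof (pos_INR nd) as Hn.
  set (q := INR nd) in *.
  (* [Cw * N] bounds [w = u + J_f]: the a priori estimate for the datum [f_C + A J_f], with [f_C] at
     most [(1 + 4 q) N] and [J_f] at most [4 q N], plus the bound of [J_f] itself. *)
  set (Cw := Kf * (1 + 4 * q + M * (4 * q)) + 4 * q).
  exists (2 * (q * (P + 2 * q)) + M * Cw). split.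
  { unfold Cw. assert (0 <= q * (P + 2 * q)) by (apply Rmult_le_pos; lra).
    assert (0 <= M * (4 * q)) by (apply Rmult_le_pos; lra).
    assert (0 <= Kf * (1 + 4 * q + M * (4 * q))) by (apply Rmult_le_pos; lra).
    assert (0 <= M * (Kf * (1 + 4 * q + M * (4 * q)) + 4 * q)) by (apply Rmult_le_pos; lra). lra. }
  intros f phi Hf Hphi Hs.
  pose proof (PH_traced beta phi Hbeta Hphi) as HT.
  set (w := fun t => (c t * phi t)%C).
  pose proof (cphi_traced phi _ HT) as HTw. pose proof (cphi_pwc phi _ HT) as Hwp.
  change (traced beta (fun x => w (gamma x)) (fun j x => (trace c j x * trace phi j x)%C)) in HTw.
  pose proof (proj1 (solves_iff phi _ f HT) Hs) as Heq.
  destruct (traced_bound beta (fun x => w (gamma x)) _ Hbeta (gamma_comp_periodic w) HTw) as [Bw HBw].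
  assert (HAw : CP (A (fun x => w (gamma x)))).
  { apply HMc; [assumption|]. exists Bw. intros; apply HBw. }
  set (u := fun x => (F f x + A (fun x => w (gamma x)) x)%C).
  assert (Hu : CP u) by (apply CP_plus; [now apply F_CP|assumption]).
  assert (Hwu : forall x, w (gamma x) = (u x + J f x)%C).
  { intros x. unfold u. replace (F f x) with (f (gamma x) - J f x)%C by (unfold F, J, Cpart; ring).
    rewrite <- Heq. unfold w. ring. }
  assert (Ew : (fun x => w (gamma x)) = (fun x => (u x + J f x)%C))
    by (apply functional_extensionality; exact Hwu).
  assert (Hueq : forall x, (u x - A u x)%C = (F f x + A (J f) x)%C).
  { apply (regularized_equation f u Hu). intros x. rewrite <- Ew, <- Hwu. apply Heq. }
  (* From [u = f_C + A w], with the bounds left as parameters: the statement is used once with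
     constants known merely to exist, and once with multiples of the norm of [f]. *)
  assert (Hhold : forall B A0 Bw', 0 <= B -> 0 <= A0 ->
    (forall j, arc_index j ->
      (forall x, in_arc j x -> Cmod (trace f j x) <= B) /\
      holder (in_arc j) alpha A0 (trace f j)) ->
    bnd (fun x => w (gamma x)) Bw' ->
    holder everywhere alpha (2 * (q * (A0 + q * (2 * B))) + M * Bw') u).
  { intros B A0 Bw' HB0 HA0 HB HBw'.
    destruct (Cpart_bounds f alpha B A0) as [_ [_ HF]]; auto; [lra|].
    apply holder_plus; [exact HF|]. apply HMb; auto; lra. }
  exists u. split; [assumption|]. split; [exact Hwu|]. split; [exact Hueq|]. split.
  - destruct (PH_data_bounds f Hf) as [B [A0 [HB0 [HA0 HB]]]].
    assert (Bw0 : 0 <= Bw) by (apply Rle_trans with (2 := HBw 0); apply Cmod_ge_0).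
    exists (2 * (q * (A0 + q * (2 * B))) + M * Bw). split; [|now apply (Hhold B A0 Bw)].
    assert (0 <= q * (2 * B)) by (apply Rmult_le_pos; lra).
    assert (0 <= q * (A0 + q * (2 * B))) by (apply Rmult_le_pos; lra).
    assert (0 <= M * Bw) by (apply Rmult_le_pos; lra). lra.
  - intros N HN HN0. specialize (HPn f N HN).
    assert (HPN : 0 <= P * N) by (apply Rmult_le_pos; lra).
    destruct (Cpart_bounds f alpha N (P * N)) as [HJb [HFb _]]; auto; [lra|].
    fold q in HJb, HFb.
    assert (HJN : 0 <= q * (2 * N * 2)) by (apply Rmult_le_pos; lra).
    assert (Hub : bnd u (Kf * (N + q * (2 * N * 2) + M * (q * (2 * N * 2))))).
    { apply Hapr; [assumption|]. intros x. rewrite Hueq.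
      eapply Rle_trans; [apply Cmod_triangle|]. apply Rplus_le_compat; [apply HFb|].
      apply (HMb (J f)); [apply J_pwc|]. intros y _. apply HJb. }
    assert (Hwb : bnd (fun x => w (gamma x)) (Cw * N)).
    { intros x. simpl. rewrite Hwu. eapply Rle_trans; [apply Cmod_triangle|].
      specialize (Hub x). specialize (HJb x). simpl in HJb. fold (J f x) in HJb.
      unfold Cw. replace ((Kf * (1 + 4 * q + M * (4 * q)) + 4 * q) * N)
        with (Kf * (N + q * (2 * N * 2) + M * (q * (2 * N * 2))) + q * (2 * N * 2)) by ring.
      apply Rplus_le_compat; assumption. }
    replace ((2 * (q * (P + 2 * q)) + M * Cw) * N)
      with (2 * (q * (P * N + q * (2 * N))) + M * (Cw * N)) by ring.
    now apply Hhold.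
Qed.

Lemma spline_collocation_convergence m : (m = 2 \/ m = 3 \/ m = 4)%nat ->
  exists K h0 : R, 0 < K /\ 0 < h0 /\
       forall n rho, mesh n < h0 -> (4 <= n)%nat ->
       forall f phi : C -> C,
         PH gamma nd thd alpha f ->
         PH gamma nd thd beta phi -> solves gamma k c lambda f phi ->
         (exists wh : C -> C,
            approx_solution gamma nd thd k c lambda f m n rho wh) /\
         (forall wh wh' : C -> C,
            approx_solution gamma nd thd k c lambda f m n rho wh ->
            approx_solution gamma nd thd k c lambda f m n rho wh' ->
            forall t, on_curve gamma t -> wh t = wh' t) /\
         (forall wh : C -> C,
            approx_solution gamma nd thd k c lambda f m n rho wh ->
            let phih := fun t => (/ c t * wh t)%C in
            PH gamma nd thd beta phih /\
            Rbar_le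
              (PH_norm gamma nd thd beta (fun t => (phi t - phih t)%C))
              (Rbar_mult (Finite (K * Rpower (mesh n) (alpha - beta)))
                         (PH_norm gamma nd thd alpha f))).
Proof.
  intros Hm. assert (Ha : 0 < alpha) by lra.
  destruct operator_bounds as [M [HM [HMb HMc]]].
  destruct second_kind_solvable as [Kf [HKf [_ Hapr]]].
  destruct (collocation_error A M Kf alpha beta) as [Ke [h0 [HKe [Hh0 [Hh01 Herr]]]]]; auto; try lra.
  { intros u v Hu Hv. apply A_minus; now apply CP_pwc. }
  { apply A_CP. }
  { intros u B Hu HB. apply HMb; [now apply CP_pwc|intros; apply HB|lra|lra]. }
  { intros u B Hu HB. apply HMb; [now apply CP_pwc|intros; apply HB|lra|lra]. }
  destruct solution_decomposition as [Cu [HCu Hdec]].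
  destruct uniform_trace_constant as [Mc [HMc0 HMcj]].
  destruct (PH_norm_le beta Hbeta) as [Pn [HPn HPnle]].
  (* Cost of multiplying the error by [1 / c]: [/ c0] for the sup norm, [Mc + / c0] for the seminorm
     by the product rule, and [Pn] for returning from the parameter to [arc_dist]. *)
  set (K3 := / c0 + Pn * (Mc + / c0)).
  assert (Hc0i : 0 < / c0) by now apply Rinv_0_lt_compat.
  assert (HK3 : 0 < K3).
  { unfold K3. assert (0 <= Pn * (Mc + / c0)) by (apply Rmult_le_pos; lra). lra. }
  (* The added 1 keeps the constant positive even if [Cu = 0]. *)
  exists (K3 * Ke * (Cu + 1)), h0. split.
  { apply Rmult_lt_0_compat; [now apply Rmult_lt_0_compat|lra]. }
  split; [assumption|].
  intros n rho Hmesh Hn4 f phi Hf Hphi Hs.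
  (* [mesh 4 = PI / 2] exceeds 1, whereas [h0 <= 1]; hence the five-term windows do not overlap
     themselves. *)
  assert (Hn : (5 <= n)%nat).
  { destruct (Nat.le_gt_cases 5 n) as [H|H]; [assumption|exfalso].
    assert (E : n = 4%nat) by lia. subst n. unfold mesh in Hmesh. simpl in Hmesh.
    pose proof PI2_3_2. lra. }
  pose proof (mesh_pos n Hn) as Hh.
  destruct (Hdec f phi Hf Hphi Hs) as [u [Hu [Hwu [Hueq [[H [H0 Hhol]] HN]]]]].
  assert (Hspl : forall a, (forall i, (i < n)%nat ->
         (spl m n rho a (node n rho i) - A (spl m n rho a) (node n rho i))%C = RtoC 0) ->
         forall x, spl m n rho a x = RtoC 0).
  { intros a Hz x.
    destruct (Herr m n rho Hm Hn Hmesh (fun _ => RtoC 0) 0 a) as [Hb _].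
    - apply CP_zero.
    - lra.
    - intros y z _ _. replace (RtoC 0 - RtoC 0)%C with (RtoC 0) by ring. rewrite Cmod_0. lra.
    - intros i Hi. rewrite Hz by assumption.
      assert (Hb : bnd (A (fun _ => RtoC 0)) (M * 0)).
      { apply HMb; [apply CP_pwc, CP_zero|]. intros y _. rewrite Cmod_0. lra. }
      specialize (Hb (node n rho i)). rewrite Rmult_0_r in Hb.
      replace (A (fun _ => RtoC 0) (node n rho i)) with (RtoC 0); [ring|].
      symmetry. apply Cmod_eq_0. pose proof (Cmod_ge_0 (A (fun _ => RtoC 0) (node n rho i))). lra.
    - specialize (Hb x). simpl in Hb. rewrite Rmult_0_r in Hb.
      assert (E : (RtoC 0 - spl m n rho a x)%C = RtoC 0).
      { apply Cmod_eq_0. pose proof (Cmod_ge_0 (RtoC 0 - spl m n rho a x)%C). lra. }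
      replace (spl m n rho a x) with (- (RtoC 0 - spl m n rho a x))%C by ring. rewrite E. ring. }
  split; [|split].
  (* Expanding in the functions [b i] turns collocation into a square matrix equation for the
     coefficients, solvable once it is injective. *)
  - set (b := fun i => spl m n rho (fun j => if Nat.eqb j i then RtoC 1 else RtoC 0)).
    assert (HbCP : forall i, CP (b i)) by (intros i; now apply spl_CP).
    assert (Hsb : forall a, spl m n rho a = fun x => csum n (fun j => (a j * b j x)%C)).
    { intros a. apply functional_extensionality. intros x. unfold spl at 1. apply csum_ext.
      intros j Hj. f_equal. unfold b, spl. rewrite (csum_single n _ j Hj).
      - rewrite Nat.eqb_refl. ring.
      - intros i Hi Hij. destruct (Nat.eqb_spec i j); [congruence|ring]. }
    assert (HAs : forall a x, A (spl m n rho a) x = csum n (fun j => (a j * A (b j) x)%C)).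
    { intros a x. rewrite Hsb.
      assert (Hq : forall q, A (fun y => csum q (fun j => (a j * b j y)%C)) x
        = csum q (fun j => (a j * A (b j) x)%C)).
      { induction q; simpl.
        - assert (Hb : bnd (A (fun _ => RtoC 0)) (M * 0)).
          { apply HMb; [apply CP_pwc, CP_zero|]. intros y _. rewrite Cmod_0. lra. }
          specialize (Hb x). rewrite Rmult_0_r in Hb. apply Cmod_eq_0.
          pose proof (Cmod_ge_0 (A (fun _ => RtoC 0) x)). lra.
        - rewrite A_linear; [now rewrite IHq| |now apply CP_pwc].
          apply CP_pwc. apply CP_csum. auto. }
      apply Hq. }
    assert (Hlin : forall a x, (spl m n rho a x - A (spl m n rho a) x)%C
      = csum n (fun j => ((b j x - A (b j) x) * a j)%C)).
    { intros a x. rewrite HAs, Hsb.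
      transitivity (csum n (fun j => (a j * b j x + (- RtoC 1) * (a j * A (b j) x))%C)).
      - rewrite csum_plus, csum_scal. ring.
      - apply csum_ext. intros; ring. }
    destruct (injective_system_solvable n (fun i j => (b j (node n rho i) - A (b j) (node n rho i))%C)
      (fun i => (F f (node n rho i) + A (J f) (node n rho i))%C)) as [a Hsol].
    (* Homogeneous collocation forces the spline to vanish as a function; [spl_coefficients_bound]
       with [D = 0] then makes its coefficients vanish. *)
    { intros a Hz.
      assert (H1 : forall x, spl m n rho a x = RtoC 0).
      { apply Hspl. intros i Hi. rewrite Hlin. now apply Hz. }
      intros i Hi. apply Cmod_eq_0. apply Rle_antisym; [|apply Cmod_ge_0].
      replace 0 with (3 * 0) by ring.
      apply (spl_coefficients_bound m n Hm Hn rho a 0); [|assumption].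
      intros l Hl. rewrite H1, Cmod_0. lra. }
    set (s := fun t => sum_n_m (G := C_AbelianMonoid)
            (fun j => (a (pred j) * RtoC (Bspline gamma m n rho j t))%C) 1 n).
    exists (fun t => (s t + Jpart gamma nd thd f t)%C). exists s.
    assert (Hs' : forall x, s (gamma x) = spl m n rho a x).
    { intros x. unfold s. now rewrite (spline_gamma). }
    split; [exists (fun j => a (pred j)); reflexivity|]. split; [|reflexivity].
    apply (collocates_spl m n rho s a f Hm Hn Hs'). intros i Hi. rewrite Hlin. now apply Hsol.
  - intros wh wh' [s [Hs1 [Hs2 Hs3]]] [s' [Hs1' [Hs2' Hs3']]] t [x ->].
    destruct (in_spline_space_spl m n rho s Hm Hn Hs1) as [a Ea].
    destruct (in_spline_space_spl m n rho s' Hm Hn Hs1') as [a' Ea'].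
    pose proof (proj1 (collocates_spl m n rho s a f Hm Hn Ea) Hs2) as C1.
    pose proof (proj1 (collocates_spl m n rho s' a' f Hm Hn Ea') Hs2') as C2.
    assert (Hz : forall x, spl m n rho (fun j => (a j + (- RtoC 1) * a' j)%C) x = RtoC 0).
    { apply Hspl. intros i Hi.
      replace (spl m n rho (fun j => (a j + - RtoC 1 * a' j)%C))
        with (fun x => (spl m n rho a x + (- RtoC 1) * spl m n rho a' x)%C)
        by (apply functional_extensionality; intros y; now rewrite spl_linear).
      rewrite A_linear by (apply CP_pwc; now apply spl_CP).
      specialize (C1 i Hi). specialize (C2 i Hi).
      replace (spl m n rho a (node n rho i) + - RtoC 1 * spl m n rho a' (node n rho i) -
        (A (spl m n rho a) (node n rho i) + - RtoC 1 * A (spl m n rho a') (node n rho i)))%C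
        with ((spl m n rho a (node n rho i) - A (spl m n rho a) (node n rho i)) -
              (spl m n rho a' (node n rho i) - A (spl m n rho a') (node n rho i)))%C by ring.
      rewrite C1, C2. ring. }
    rewrite Hs3, Hs3' by apply on_curve_gamma. rewrite Ea, Ea'.
    specialize (Hz x). rewrite spl_linear in Hz.
    replace (spl m n rho a x) with ((spl m n rho a x + - RtoC 1 * spl m n rho a' x) + spl m n rho a' x)%C by ring.
    rewrite Hz. ring.
  - intros wh [s [Hs1 [Hs2 Hs3]]] phih.
    destruct (in_spline_space_spl m n rho s Hm Hn Hs1) as [a Ea].
    pose proof (proj1 (collocates_spl m n rho s a f Hm Hn Ea) Hs2) as C1.
    assert (Hcol : forall i, (i < n)%nat ->
         (spl m n rho a (node n rho i) - A (spl m n rho a) (node n rho i))%C =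
         (u (node n rho i) - A u (node n rho i))%C).
    { intros i Hi. rewrite Hueq. now apply C1. }
    set (E := fun x => (u x - spl m n rho a x)%C).
    assert (HE : forall x, (phi (gamma x) - phih (gamma x))%C = (/ c (gamma x) * E x)%C).
    { intros x. unfold phih, E. rewrite Hs3 by apply on_curve_gamma. rewrite Ea.
      fold (J f x).
      replace (u x) with (c (gamma x) * phi (gamma x) - J f x)%C by (rewrite Hwu; ring).
      field. apply c_neq_0. }
    assert (HEt : forall D, 0 <= D -> bnd E D -> holder everywhere beta D E -> forall j, arc_index j ->
      (forall x, in_arc j x -> Cmod (/ trace c j x * E x)%C <= / c0 * D) /\
      holder (in_arc j) beta (Mc * D + / c0 * D) (fun x => (/ trace c j x * E x)%C)).
    { intros D HD HbD HhD j Hj.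
      assert (Hci : forall x, in_arc j x -> Cmod (/ trace c j x)%C <= / c0).
      { intros x Hx. pose proof (c_trace_lower j x Hj Hx) as Hl.
        rewrite Cmod_inv by (apply Cmod_gt_0; lra). apply Rinv_le_contravar; assumption. }
      split.
      - intros x Hx. rewrite Cmod_mult. apply Rmult_le_compat; try apply Cmod_ge_0; auto.
      - apply holder_mult; auto. apply (holder_restrict everywhere); auto. intros; exact I. }
    assert (HKh : 0 <= Ke * rpow (mesh n) (alpha - beta)).
    { apply Rmult_le_pos; [lra|apply rpow_ge_0]. }
    (* Here the constant [H] of [u] suffices, without reference to the norm of [f]; this gives the
       membership of [phih] in the space. *)
    assert (HTe : traced beta (fun x => (fun t => (phi t - phih t)%C) (gamma x))
      (fun j x => (/ trace c j x * E x)%C)).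
    { destruct (Herr m n rho Hm Hn Hmesh u H a Hu H0 Hhol Hcol) as [E1 E2].
      intros j Hj. split.
      - set (D := Ke * rpow (mesh n) (alpha - beta) * H) in *.
        assert (HD : 0 <= D) by (unfold D; apply Rmult_le_pos; assumption).
        exists (Mc * D + / c0 * D). split.
        + apply Rplus_le_le_0_compat; apply Rmult_le_pos; lra.
        + now apply HEt.
      - intros x Hx. simpl. rewrite HE. f_equal. apply (c_inv_traced j Hj). assumption. }
    assert (HTphi := PH_traced beta phi Hbeta Hphi).
    split.
    + apply (PH_of_traced beta phih
        (fun j x => (trace phi j x + (- RtoC 1) * (/ trace c j x * E x))%C) Hbeta).
      replace (fun x => phih (gamma x))
        with (fun x => (phi (gamma x) + (- RtoC 1) * (phi (gamma x) - phih (gamma x)))%C)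
        by (apply functional_extensionality; intros; ring).
      apply (traced_plus beta (fun x => phi (gamma x)) (fun x => ((- RtoC 1) * (phi (gamma x) - phih (gamma x)))%C)
        (trace phi) (fun j x => ((- RtoC 1) * (/ trace c j x * E x))%C)); auto.
      now apply traced_scal.
    + pose proof (PH_norm_nonneg alpha f) as Hpos.
      assert (Hpow : 0 < Rpower (mesh n) (alpha - beta)) by (unfold Rpower; apply exp_pos).
      assert (HKp : 0 < K3 * Ke * (Cu + 1) * Rpower (mesh n) (alpha - beta)).
      { apply Rmult_lt_0_compat; [|assumption].
        apply Rmult_lt_0_compat; [now apply Rmult_lt_0_compat|lra]. }
      (* The norm is an extended real. If it is [p_infty], so is the right-hand side, its factor
         being positive; [m_infty] contradicts nonnegativity. *)
      destruct (PH_norm gamma nd thd alpha f) as [N| |] eqn:EN.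
      * simpl in Hpos. specialize (HN N eq_refl Hpos).
        destruct (Herr m n rho Hm Hn Hmesh u (Cu * N) a Hu (Rmult_le_pos _ _ HCu Hpos) HN Hcol) as [E1 E2].
        set (D := Ke * rpow (mesh n) (alpha - beta) * (Cu * N)) in *.
        assert (HD : 0 <= D) by (unfold D; apply Rmult_le_pos; [assumption|now apply Rmult_le_pos]).
        eapply Rbar_le_trans.
        -- apply (HPnle _ (/ c0 * D) (Mc * D + / c0 * D)).
           ++ apply Rplus_le_le_0_compat; apply Rmult_le_pos; lra.
           ++ intros j Hj. destruct (HEt D HD E1 E2 j Hj) as [T1 T2].
              assert (Etr : forall x, in_arc j x ->
                trace (fun t => (phi t - phih t)%C) j x = (/ trace c j x * E x)%C).
              { intros x Hx.
                now rewrite (arc_trace_traced beta _ _ j x Hbeta HTe Hj Hx). }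
              split.
              ** intros x Hx. rewrite Etr by assumption. now apply T1.
              ** apply holder_ext with (2 := T2). intros x Hx. symmetry. now apply Etr.
        -- simpl.
           replace (/ c0 * D + Pn * (Mc * D + / c0 * D)) with (K3 * D) by (unfold K3; ring).
           unfold D. rewrite rpow_pos_eq by assumption.
           assert (HX : 0 <= K3 * Ke * Rpower (mesh n) (alpha - beta) * N).
           { apply Rmult_le_pos; [|assumption]. left.
             apply Rmult_lt_0_compat; [now apply Rmult_lt_0_compat|assumption]. }
           lra.
      * replace (Rbar_mult (K3 * Ke * (Cu + 1) * Rpower (mesh n) (alpha - beta)) p_infty) with p_infty.
        -- destruct (PH_norm gamma nd thd beta (fun t => (phi t - phih t)%C)); exact I.
        -- symmetry. apply is_Rbar_mult_unique. apply is_Rbar_mult_sym.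
           apply is_Rbar_mult_p_infty_pos. exact HKp.
      * destruct Hpos.
Qed.

End Contour.

Theorem mainTheorem10
  (gamma : R -> C) (nd : nat) (thd : nat -> R)
  (alpha beta mu : R) (k : C -> C -> C) (c : C -> C) (c0 : R) (lambda : C)
  (Hgamma : C2_contour gamma)
  (Hthd : break_params nd thd)
  (Hbeta : 0 < beta) (Hba : beta < alpha) (Ham : alpha < mu) (Hmu : mu <= 1)
  (Hk : kernel_regular gamma mu k)
  (Hc : PH gamma nd thd alpha c)
  (Hc0 : 0 < c0)
  (Hcinf : forall t, on_curve gamma t -> ~ break_point gamma nd thd t ->
             c0 <= Cmod (c t))
  (Hclat : forall j, (1 <= j <= nd)%nat ->
             lat_in gamma c (thd j) <> RtoC 0 /\ lat_out gamma c (thd j) <> RtoC 0)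
  (Hker : forall w : C -> C, PH gamma nd thd beta w ->
            (forall t, on_curve gamma t ->
               (w t - lambda * Ktilde gamma k c w t)%C = RtoC 0) ->
            forall t, on_curve gamma t -> w t = RtoC 0) :
  (forall f : C -> C, PH gamma nd thd alpha f ->
     exists phi : C -> C,
       (PH gamma nd thd beta phi /\ solves gamma k c lambda f phi) /\
       forall phi' : C -> C,
         PH gamma nd thd beta phi' -> solves gamma k c lambda f phi' ->
         forall t, on_curve gamma t -> phi' t = phi t)
  /\
  (forall f phi : C -> C,
     PH gamma nd thd alpha f ->
     PH gamma nd thd beta phi -> solves gamma k c lambda f phi ->
     let w := fun t => (c t * phi t)%C in
     (forall t, on_curve gamma t -> (w t - lambda * Ktilde gamma k c w t)%C = f t) /\
     (forall j, (1 <= j <= nd)%nat -> jump gamma thd w j = jump gamma thd f j))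
  /\
  (forall (m : nat) (eta : R) (rho : nat -> R),
     (m = 2 \/ m = 3 \/ m = 4)%nat ->
     0 < eta < 1 / (2 * INR nd) ->
     (forall n, (4 <= n)%nat -> admissible_phase nd thd eta n (rho n)) ->
     exists K h0 : R, 0 < K /\ 0 < h0 /\
       forall n : nat, (4 <= n)%nat -> mesh n < h0 ->
       forall f phi : C -> C,
         PH gamma nd thd alpha f ->
         PH gamma nd thd beta phi -> solves gamma k c lambda f phi ->
         (exists wh : C -> C,
            approx_solution gamma nd thd k c lambda f m n (rho n) wh) /\
         (forall wh wh' : C -> C,
            approx_solution gamma nd thd k c lambda f m n (rho n) wh ->
            approx_solution gamma nd thd k c lambda f m n (rho n) wh' ->
            forall t, on_curve gamma t -> wh t = wh' t) /\
         (forall wh : C -> C,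
            approx_solution gamma nd thd k c lambda f m n (rho n) wh ->
            let phih := fun t => (/ c t * wh t)%C in
            PH gamma nd thd beta phih /\
            Rbar_le
              (PH_norm gamma nd thd beta (fun t => (phi t - phih t)%C))
              (Rbar_mult (Finite (K * Rpower (mesh n) (alpha - beta)))
                         (PH_norm gamma nd thd alpha f)))).
Proof.
  split; [|split].
  - intros f Hf.
    exact (equation_solvable gamma Hgamma nd thd Hthd alpha beta mu k c c0 lambda Hbeta Hba Ham Hmu
      Hk Hc Hc0 Hcinf Hker f Hf).
  - intros f phi Hf Hphi Hs.
    exact (weighted_equation gamma Hgamma nd thd Hthd alpha beta mu k c c0 lambda Hbeta Hba Ham Hmu
      Hk Hc Hc0 Hcinf f phi Hf Hphi Hs).
  - intros m eta rho Hm Heta Hrho.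
    destruct (spline_collocation_convergence gamma Hgamma nd thd Hthd alpha beta mu k c c0 lambda
      Hbeta Hba Ham Hmu Hk Hc Hc0 Hcinf Hker m Hm) as [K [h0 [HK [Hh0 H]]]].
    exists K, h0. split; [assumption|]. split; [assumption|].
    intros n Hn Hmesh f phi Hf Hphi Hs. now apply H.
Qed.
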